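(* Let $\Bbbk$ be an algebraically closed field of characteristic $0$, and suppose that $A^G$ is a quantum Kleinian singularity over $\Bbbk$. Then the skew group ring $A \,\#\, G$ and the invariant ring $A^G$ are maximal orders.
   Context: For $q\in\Bbbk^\times$ the quantum plane is $\Bbbk_q[u,v] = \Bbbk\langle u,v\rangle/\langle vu - quv\rangle$, and the Jordan plane is $\Bbbk_J[u,v] = \Bbbk\langle u,v\rangle/\langle vu-uv-u^2\rangle$. ''$A^G$ is a quantum Kleinian singularity'' means that $(A,G)$ is one of the following pairs (where $n$ is a positive integer), with $G$ acting by $\Bbbk$-algebra automorphisms, and $A^G$ is its ring of invariants: (i) $A = \Bbbk_q[u,v]$ with $q\in\Bbbk^\times$, and $G = C_{n+1}=\langle g\rangle$ cyclic of order $n+1$, acting by $g\cdot u = \omega u$, $g\cdot v = \omega^{-1}v$, with $\omega$ a primitive $(n+1)$th root of unity; (ii) $A = \Bbbk_{-1}[u,v]$ and $G = S_2 = \langle h \mid h^2\rangle$, acting by $h\cdot u = v$, $h\cdot v = u$; (iii) $A = \Bbbk_{-1}[u,v]$ and $G = D_n = \langle g,h \mid g^n,h^2,(hg)^2\rangle$ dihedral of order $2n$, acting by $g\cdot u = \omega u$, $g\cdot v=\omega^{-1}v$, $h\cdot u = v$, $h\cdot v=u$, with $\omega$ a primitive $n$th root of unity; (iv) $A = \Bbbk_J[u,v]$ and $G = C_2 = \langle g\rangle$, acting by $g\cdot u=-u$, $g\cdot v = -v$. The skew group ring $A \,\#\, G$ is the free left $A$-module with basis $G$ and multiplication $(ax)(by)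 = a\,(x\cdot b)\, xy$ for $a,b\in A$, $x,y\in G$. A semiprime noetherian ring $R$ with Goldie quotient ring $Q(R)$ is a maximal order if there is no order $R'$ with $R\subsetneq R'\subseteq Q(R)$ and $aR'b\subseteq R$ for some nonzero $a,b\in R$. *)

(* Defs.v *)
From HB Require Import structures.
From mathcomp Require Import all_boot all_order all_algebra all_fingroup.
From mathcomp.multinomials Require Import monalg.
From mathcomp Require Import boolp.

Set Implicit Arguments.
Unset Strict Implicit.
Unset Printing Implicit Defensive.

Import GRing.Theory.
Local Open Scope ring_scope.
Local Open Scope quotient_scope.

Section TwoSidedIdeal.
Variables (R : pzRingType) (r : R).

Definition ideal_gen (x : R) : Prop :=
  exists s : seq (R * R), x = \sum_(t <- s) t.1 * r * t.2.

Lemma ideal_gen0 : ideal_gen 0.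
Proof. by exists [::]; rewrite big_nil. Qed.

Lemma ideal_genD x y : ideal_gen x -> ideal_gen y -> ideal_gen (x + y).
Proof. by move=> [s ->] [t ->]; exists (s ++ t); rewrite big_cat. Qed.

Lemma ideal_genMl a x : ideal_gen x -> ideal_gen (a * x).
Proof.
move=> [s ->]; exists [seq (a * t.1, t.2) | t <- s].
by rewrite big_map mulr_sumr; apply: eq_bigr => t _; rewrite !mulrA.
Qed.

Lemma ideal_genMr a x : ideal_gen x -> ideal_gen (x * a).
Proof.
move=> [s ->]; exists [seq (t.1, t.2 * a) | t <- s].
by rewrite big_map mulr_suml; apply: eq_bigr => t _; rewrite !mulrA.
Qed.

Lemma ideal_genN x : ideal_gen x -> ideal_gen (- x).
Proof. by move=> /(ideal_genMl (-1)); rewrite mulN1r. Qed.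

Definition ideal_eq (x y : R) : bool := `[< ideal_gen (x - y) >].

Lemma ideal_eq_equiv : equiv_class_of ideal_eq.
Proof.
split=> [x|x y|y x z].
- by apply/asboolP; rewrite subrr; exact: ideal_gen0.
- by apply/asboolP/asboolP => /ideal_genN; rewrite opprB.
- move=> /asboolP xy /asboolP yz; apply/asboolP.
  by have := ideal_genD xy yz; rewrite addrA subrK.
Qed.

End TwoSidedIdeal.

(* The free algebra k<u,v>, as the monoid algebra of the free monoid on two
   letters: false stands for u and true for v. *)
Notation freealg2 k := {malg k[{fmonom bool}]}.

Section FreeAlgebra.
Variable k : comNzRingType.

Definition free_u : freealg2 k := << fmu false >>.
Definition free_v : freealg2 k := << fmu true >>.

Lemma free_scaleAr (c : k) (x y : freealg2 k) : c *: (x * y) = x * (c *: y).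
Proof.
have cC (z : freealg2 k) : c%:MP * z = z * c%:MP.
  rewrite [LHS]fgmulUg [RHS]fgmulgU.
  by apply: eq_bigr => m _; rewrite mul1m mulm1 mulrC.
by rewrite -!mul_malgC mulrA cC -mulrA.
Qed.

Lemma free_coeff1M (x y : freealg2 k) :
  (x * y)@_mone = x@_mone * y@_mone.
Proof. exact: (rmorphM (mcoeff mone)). Qed.

Lemma free_coeff1_comb (c : k) (x y : freealg2 k) :
  x@_mone = 0 -> y@_mone = 0 -> (x - c *: y)@_mone = 0.
Proof. by move=> x0 y0; rewrite mcoeffB mcoeffZ x0 y0 mulr0 subr0. Qed.

Lemma free_coeff1Mr (x y : freealg2 k) : y@_mone = 0 -> (x * y)@_mone = 0.
Proof. by move=> y0; rewrite free_coeff1M y0 mulr0. Qed.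

Lemma free_u_coeff1 : free_u@_mone = 0.
Proof. by rewrite mcoeffU -val_eqE /= fm1 fmU. Qed.

Lemma free_v_coeff1 : free_v@_mone = 0.
Proof. by rewrite mcoeffU -val_eqE /= fm1 fmU. Qed.

End FreeAlgebra.

(* The quotient of k<u,v> by the two-sided ideal generated by r.  The relation
   is required to have no constant term, so that the quotient is a nonzero ring
   and can carry an algType structure. *)
Section PresentedAlgebra.
Variables (k : comNzRingType) (r : freealg2 k).

Canonical ideal_eq_rel := EquivRelPack (ideal_eq_equiv r).

Definition presalg of r@_mone = 0 : Type := {eq_quot ideal_eq_rel}.

Hypothesis r0 : r@_mone = 0.
Local Notation A := (presalg r0).

HB.instance Definition _ := Choice.copy A {eq_quot ideal_eq_rel}.

Definition presalg_pi (x : freealg2 k) : A := \pi_({eq_quot ideal_eq_rel}) x.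
Definition presalg_repr (x : A) : freealg2 k :=
  generic_quotient.repr (x : {eq_quot ideal_eq_rel}).
Local Notation pi := presalg_pi.
Local Notation rep := presalg_repr.

Lemma presalg_reprK x : pi (rep x) = x.
Proof. exact: reprK. Qed.

Lemma presalg_piP x y : pi x = pi y <-> ideal_gen r (x - y).
Proof.
split=> [|xy].
  by rewrite /presalg_pi => /eqmodP/asboolP.
by rewrite /presalg_pi; apply/eqmodP/asboolP.
Qed.

Let zero : A := pi 0.
Let one : A := pi 1.
Let opp := locked (fun x : A => pi (- rep x)).
Let add := locked (fun x y : A => pi (rep x + rep y)).
Let mul := locked (fun x y : A => pi (rep x * rep y)).
Let scale := locked (fun (c : k) (x : A) => pi (c *: rep x)).

Let rep_pi x : ideal_gen r (rep (pi x) - x).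
Proof. by apply/presalg_piP; rewrite presalg_reprK. Qed.

Let piN x : opp (pi x) = pi (- x).
Proof.
by rewrite /opp -lock; apply/presalg_piP; rewrite -opprD; apply: ideal_genN; exact: rep_pi.
Qed.

Let piD x y : add (pi x) (pi y) = pi (x + y).
Proof.
rewrite /add -lock; apply/presalg_piP; rewrite opprD addrACA.
by apply: ideal_genD; exact: rep_pi.
Qed.

Let piM x y : mul (pi x) (pi y) = pi (x * y).
Proof.
rewrite /mul -lock; apply/presalg_piP.
have -> : rep (pi x) * rep (pi y) - x * y =
    (rep (pi x) - x) * rep (pi y) + x * (rep (pi y) - y).
  by rewrite mulrBl mulrBr addrA subrK.
apply: ideal_genD; first by apply: ideal_genMr; exact: rep_pi.
by apply: ideal_genMl; exact: rep_pi.
Qed.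

Let piZ c x : scale c (pi x) = pi (c *: x).
Proof.
rewrite /scale -lock; apply/presalg_piP; rewrite -scalerBr -mul_malgC.
by apply: ideal_genMl; exact: rep_pi.
Qed.

Let addA : associative add.
Proof.
move=> x y z; rewrite -[x]presalg_reprK -[y]presalg_reprK -[z]presalg_reprK.
by rewrite !piD addrA.
Qed.

Let addC : commutative add.
Proof.
by move=> x y; rewrite -[x]presalg_reprK -[y]presalg_reprK !piD addrC.
Qed.

Let add0 : left_id zero add.
Proof. by move=> x; rewrite -[x]presalg_reprK piD add0r. Qed.

Let addN : left_inverse zero opp add.
Proof. by move=> x; rewrite -[x]presalg_reprK piN piD addNr. Qed.

HB.instance Definition _ := GRing.isZmodule.Build A addA addC add0 addN.

Let mulA : associative mul.
Proof.
move=> x y z; rewrite -[x]presalg_reprK -[y]presalg_reprK -[z]presalg_reprK.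
by rewrite !piM mulrA.
Qed.

Let mul1 : left_id one mul.
Proof. by move=> x; rewrite -[x]presalg_reprK piM mul1r. Qed.

Let mulr1_ : right_id one mul.
Proof. by move=> x; rewrite -[x]presalg_reprK piM mulr1. Qed.

Let mulDl : left_distributive mul add.
Proof.
move=> x y z; rewrite -[x]presalg_reprK -[y]presalg_reprK -[z]presalg_reprK.
by rewrite !(piD, piM) mulrDl.
Qed.

Let mulDr : right_distributive mul add.
Proof.
move=> x y z; rewrite -[x]presalg_reprK -[y]presalg_reprK -[z]presalg_reprK.
by rewrite !(piD, piM) mulrDr.
Qed.

Let one_neq0 : one != zero.
Proof.
apply/eqP => /presalg_piP[s]; rewrite subr0 => /(congr1 (mcoeff mone)).
rewrite raddf_sum big1 ?rmorph1; first by move/eqP; rewrite oner_eq0.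
by move=> t _; rewrite /= !free_coeff1M r0 mulr0 mul0r.
Qed.

HB.instance Definition _ :=
  GRing.Zmodule_isNzRing.Build A mulA mul1 mulr1_ mulDl mulDr one_neq0.

Let scaleA a b v : scale a (scale b v) = scale (a * b) v.
Proof. by rewrite -[v]presalg_reprK !piZ scalerA. Qed.

Let scale1 : left_id 1 scale.
Proof. by move=> v; rewrite -[v]presalg_reprK piZ scale1r. Qed.

Let scaleDr : right_distributive scale +%R.
Proof.
move=> a x y; rewrite -[x]presalg_reprK -[y]presalg_reprK.
by rewrite -[_ + _]/(add _ _) -[RHS]/(add _ _) !(piD, piZ) scalerDr.
Qed.

Let scaleDl v : {morph scale^~ v : a b / a + b}.
Proof.
move=> a b; rewrite -[v]presalg_reprK.
by rewrite -[RHS]/(add _ _) !(piD, piZ) scalerDl.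
Qed.

HB.instance Definition _ :=
  GRing.Zmodule_isLmodule.Build k A scaleA scale1 scaleDr scaleDl.

Let scaleAl (a : k) (x y : A) : a *: (x * y) = (a *: x) * y.
Proof.
rewrite -[x]presalg_reprK -[y]presalg_reprK.
rewrite -[LHS]/(scale a (mul _ _)) -[RHS]/(mul (scale a _) _).
by rewrite !(piM, piZ) scalerAl.
Qed.

HB.instance Definition _ := GRing.Lmodule_isLalgebra.Build k A scaleAl.

Let scaleAr (a : k) (x y : A) : a *: (x * y) = x * (a *: y).
Proof.
rewrite -[x]presalg_reprK -[y]presalg_reprK.
rewrite -[LHS]/(scale a (mul _ _)) -[RHS]/(mul _ (scale a _)).
by rewrite !(piM, piZ) free_scaleAr.
Qed.

HB.instance Definition _ := GRing.Lalgebra_isAlgebra.Build k A scaleAr.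

Lemma presalg_pi_is_linear : linear (pi : freealg2 k -> A).
Proof.
move=> c x y; rewrite -[RHS]/(add (scale c _) _).
by rewrite piZ piD.
Qed.

HB.instance Definition _ :=
  GRing.isLinear.Build k (freealg2 k) A *:%R pi presalg_pi_is_linear.

Lemma presalg_pi_is_monoid_morphism : monoid_morphism (pi : freealg2 k -> A).
Proof.
split; first exact: (erefl one).
by move=> x y; rewrite -[RHS]/(mul _ _) piM.
Qed.

HB.instance Definition _ :=
  GRing.isMonoidMorphism.Build (freealg2 k) A pi presalg_pi_is_monoid_morphism.

Lemma presalg_rel : pi r = 0.
Proof.
apply/presalg_piP; exists [:: (1, 1)].
by rewrite big_seq1 mulr1 mul1r subr0.
Qed.

Definition gen_u : A := pi (free_u k).
Definition gen_v : A := pi (free_v k).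

End PresentedAlgebra.

Section Planes.
Variable k : comNzRingType.
Local Notation u := (free_u k).
Local Notation v := (free_v k).

Definition qplane_rel (q : k) : freealg2 k := v * u - q *: (u * v).
Definition jplane_rel : freealg2 k := v * u - u * v - u ^+ 2.

Fact qplane_rel_coeff1 q : (qplane_rel q)@_mone = 0.
Proof.
apply: (@free_coeff1_comb k q (v * u)).
  exact: (@free_coeff1Mr k v u (free_u_coeff1 k)).
exact: (@free_coeff1Mr k u v (free_v_coeff1 k)).
Qed.

Fact jplane_rel_coeff1 : jplane_rel@_mone = 0.
Proof.
rewrite /jplane_rel -[u ^+ 2]scale1r.
apply: (@free_coeff1_comb k 1 (v * u - u * v)); last first.
  exact: (@free_coeff1Mr k u u (free_u_coeff1 k)).
rewrite -[u * v]scale1r; apply: (@free_coeff1_comb k 1 (v * u)).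
  exact: (@free_coeff1Mr k v u (free_u_coeff1 k)).
exact: (@free_coeff1Mr k u v (free_v_coeff1 k)).
Qed.

Definition qplane (q : k) : algType k := presalg (qplane_rel_coeff1 q).

Definition jplane : algType k := presalg jplane_rel_coeff1.

Definition qu (q : k) : qplane q := gen_u (qplane_rel_coeff1 q).
Definition qv (q : k) : qplane q := gen_v (qplane_rel_coeff1 q).
Definition ju : jplane := gen_u jplane_rel_coeff1.
Definition jv : jplane := gen_v jplane_rel_coeff1.

Lemma qplaneE q : qv q * qu q = q *: (qu q * qv q).
Proof.
apply: subr0_eq.
rewrite /qu /qv /gen_u /gen_v -!rmorphM -linearZ -linearB /=.
exact: presalg_rel.
Qed.

Lemma jplaneE : jv * ju = ju * jv + ju ^+ 2.
Proof.
apply: subr0_eq.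
rewrite opprD addrA expr2 /ju /jv /gen_u /gen_v -!rmorphM -!linearB /=.
exact: (presalg_rel jplane_rel_coeff1).
Qed.

End Planes.

(* MathComp's own actions are right actions, hence a separate notion of left
   action by algebra automorphisms; bijectivity of alg_act x follows from alg_act1 and
   alg_actM. *)
Record alg_action (k : comNzRingType) (gT : finGroupType) (A : algType k) :=
  AlgAction {
    alg_act :> gT -> {lrmorphism A -> A};
    alg_act1 : forall a, alg_act 1%g a = a;
    alg_actM : forall x y a, alg_act (x * y)%g a = alg_act x (alg_act y a)
  }.

Section SkewGroupRing.
Variables (k : comNzRingType) (gT : finGroupType) (A : algType k).

(* f : skew_ring al stands for the formal sum \sum_x f x . x *)
Definition skew_ring of alg_action gT A : Type := {ffun gT -> A}.

Variable al : alg_action gT A.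
Local Notation S := (skew_ring al).

HB.instance Definition _ := GRing.Zmodule.copy S {ffun gT -> A}.

Definition skew_single (a : A) (x : gT) : S :=
  [ffun y => if y == x then a else 0].
Definition skew_one : S := skew_single 1 1%g.
Definition skew_mul (f g : S) : S :=
  [ffun z => \sum_(x : gT) f x * al x (g (x^-1 * z)%g)].

Let skew_mulA : associative skew_mul.
Proof.
move=> f g h; apply/ffunP => z; rewrite !ffunE.
under eq_bigr => x _ do rewrite ffunE rmorph_sum mulr_sumr.
under [RHS]eq_bigr => x _ do rewrite ffunE mulr_suml.
rewrite [RHS]exchange_big /=; apply: eq_bigr => x _.
rewrite [RHS](reindex_inj (mulgI x)) /=; apply: eq_bigr => y _.
by rewrite mulKg rmorphM alg_actM mulrA invMg mulgA.
Qed.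

Let skew_mul1 : left_id skew_one skew_mul.
Proof.
move=> f; apply/ffunP => z; rewrite !ffunE (bigD1 1%g) //= big1 ?addr0.
  by rewrite ffunE eqxx mul1r alg_act1 invg1 mul1g.
by move=> x /negbTE x1; rewrite ffunE x1 mul0r.
Qed.

Let skew_mulr1 : right_id skew_one skew_mul.
Proof.
move=> f; apply/ffunP => z; rewrite !ffunE (bigD1 z) //= big1 ?addr0.
  by rewrite ffunE mulVg eqxx rmorph1 mulr1.
move=> x xz; rewrite ffunE -eq_mulVg1 (negbTE xz).
by rewrite rmorph0 mulr0.
Qed.

Let skew_mulDl : left_distributive skew_mul +%R.
Proof.
move=> f g h; apply/ffunP => z; rewrite !ffunE -big_split /=.
by apply: eq_bigr => x _; rewrite ffunE mulrDl.
Qed.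

Let skew_mulDr : right_distributive skew_mul +%R.
Proof.
move=> f g h; apply/ffunP => z; rewrite !ffunE -big_split /=.
by apply: eq_bigr => x _; rewrite ffunE rmorphD mulrDr.
Qed.

Let skew_one_neq0 : skew_one != 0.
Proof.
by apply/eqP => /ffunP/(_ 1%g)/eqP; rewrite !ffunE eqxx oner_eq0.
Qed.

HB.instance Definition _ := GRing.Zmodule_isNzRing.Build S
  skew_mulA skew_mul1 skew_mulr1 skew_mulDl skew_mulDr skew_one_neq0.

Lemma skew_singleM a b x y :
  skew_single a x * skew_single b y = skew_single (a * al x b) (x * y)%g.
Proof.
apply/ffunP => z; rewrite !ffunE (bigD1 x) //= big1 ?addr0.
  rewrite !ffunE eqxx -(inj_eq (mulgI x)) mulKVg.
  by case: eqP => // _; rewrite rmorph0 mulr0.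
by move=> t /negbTE tx; rewrite !ffunE tx mul0r.
Qed.

End SkewGroupRing.

Section InvariantRing.
Variables (k : comNzRingType) (gT : finGroupType) (A : algType k).
Variable al : alg_action gT A.

Definition invariants : {pred A} := [pred a | [forall x : gT, al x a == a]].

Lemma invariantP a : reflect (forall x, al x a = a) (a \in invariants).
Proof. by apply: (iffP forallP) => Ia x; apply/eqP; rewrite Ia. Qed.

Fact invariant_subring : subring_closed invariants.
Proof.
split=> [|a b /invariantP Ia /invariantP Ib|a b /invariantP Ia /invariantP Ib].
- by apply/invariantP => x; rewrite rmorph1.
- by apply/invariantP => x; rewrite rmorphB /= Ia Ib.
- by apply/invariantP => x; rewrite rmorphM /= Ia Ib.
Qed.

HB.instance Definition _ := GRing.isSubringClosed.Build A invariants
  invariant_subring.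

Record invariant_ring := InvariantRing {
  inv_val :> A;
  inv_valP : inv_val \in invariants
}.

HB.instance Definition _ := [isSub for inv_val].
HB.instance Definition _ := [Choice of invariant_ring by <:].
HB.instance Definition _ := [SubChoice_isSubNzRing of invariant_ring by <:].

End InvariantRing.

Section MaximalOrders.
Variable R : pzRingType.

Definition left_ideal (I : R -> Prop) : Prop :=
  [/\ I 0, forall x y, I x -> I y -> I (x + y) & forall a x, I x -> I (a * x)].

Definition right_ideal (I : R -> Prop) : Prop :=
  [/\ I 0, forall x y, I x -> I y -> I (x + y) & forall a x, I x -> I (x * a)].

Definition nilpotent_ideal (I : R -> Prop) : Prop :=
  exists n : nat, forall s : seq R,
    size s = n -> (forall x, x \in s -> I x) -> \prod_(x <- s) x = 0.

Definition semiprime : Prop :=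
  forall I : R -> Prop, left_ideal I -> right_ideal I -> nilpotent_ideal I ->
    forall x, I x -> x = 0.

Definition acc (P : (R -> Prop) -> Prop) : Prop :=
  forall I : nat -> R -> Prop, (forall n, P (I n)) ->
    (forall n x, I n x -> I n.+1 x) ->
    exists N : nat, forall n x, (N <= n)%N -> I n x -> I N x.

Definition noetherian : Prop := acc left_ideal /\ acc right_ideal.

(* S is a subring of Q having Q as its two-sided classical quotient ring *)
Definition order_in (Q : unitRingType) (S : Q -> Prop) : Prop :=
  [/\ [/\ S 1, forall x y, S x -> S y -> S (x - y)
        & forall x y, S x -> S y -> S (x * y)],
      forall c, S c ->
        (forall x, S x -> c * x = 0 -> x = 0) ->
        (forall x, S x -> x * c = 0 -> x = 0) -> c \is a GRing.unit,
      forall x, exists a c, [/\ S a, S c, c \is a GRing.unit & x = a / c]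
    & forall x, exists a c, [/\ S a, S c, c \is a GRing.unit & x = c^-1 * a]].

Definition in_image (Q : unitRingType) (i : R -> Q) (x : Q) : Prop :=
  exists a, x = i a.

Definition quotient_ring (Q : unitRingType) (i : {rmorphism R -> Q}) : Prop :=
  injective i /\ order_in (in_image i).

(* By Goldie's theorem a semiprime noetherian ring has a quotient ring, which is
   unique up to a unique isomorphism over R, so it does not matter which one is
   used: the last clause is required of all of them. *)
Definition maximal_order : Prop :=
  [/\ semiprime, noetherian &
      forall (Q : unitRingType) (i : {rmorphism R -> Q}), quotient_ring i ->
        ~ exists S : Q -> Prop,
          [/\ order_in S,
              forall x, in_image i x -> S x,
              exists2 x, S x & ~ in_image i x
            & exists a b : R, [/\ a != 0, b != 0 &
                forall x, S x -> in_image i (i a * x * i b)]]].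

End MaximalOrders.

(* al is the action of G = gT on A in one of the four cases; in each of them G
   is pinned down by its generators, relations and order. *)
Inductive quantum_kleinian (k : fieldType) :
    forall (gT : finGroupType) (A : algType k), alg_action gT A -> Prop :=
| QKcyclic (q w : k) (n : nat) (gT : finGroupType) (g : gT)
    (al : alg_action gT (qplane q)) of
    q != 0 & (0 < n)%N & n.+1.-primitive_root w &
    #[g]%g = n.+1 & <[g]>%g = [set: gT] &
    al g (qu q) = w *: qu q & al g (qv q) = w^-1 *: qv q :
    quantum_kleinian al
| QKswap (gT : finGroupType) (h : gT) (al : alg_action gT (qplane (-1))) of
    #[h]%g = 2%N & <[h]>%g = [set: gT] &
    al h (qu (-1)) = qv (-1) & al h (qv (-1)) = qu (-1) :
    quantum_kleinian al
| QKdihedral (w : k) (n : nat) (gT : finGroupType) (g h : gT)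
    (al : alg_action gT (qplane (-1))) of
    (0 < n)%N & n.-primitive_root w &
    (g ^+ n = 1)%g & (h ^+ 2 = 1)%g & ((h * g) ^+ 2 = 1)%g &
    <<[set g; h]>>%g = [set: gT] & #|gT| = n.*2 &
    al g (qu (-1)) = w *: qu (-1) & al g (qv (-1)) = w^-1 *: qv (-1) &
    al h (qu (-1)) = qv (-1) & al h (qv (-1)) = qu (-1) :
    quantum_kleinian al
| QKjordan (gT : finGroupType) (g : gT) (al : alg_action gT (jplane k)) of
    #[g]%g = 2%N & <[g]>%g = [set: gT] &
    al g (ju k) = - ju k & al g (jv k) = - jv k :
    quantum_kleinian al.

(* Main.v *)
(** A prime noetherian ring is a maximal order as soon as, for every nonzero
    two-sided ideal [I], each endomorphism of [I] as a right module, and each one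
    as a left module, is multiplication by an element of the ring.

    In all four cases the plane [A] satisfies [v u = q u v + b u^2], so with
    [t = u^-1 v] it embeds in the twisted polynomial ring [k[t][u; sigma]],
    [sigma t = q t + b].  The pair (degree in [u], degree in [t]) of the leading
    coefficient is multiplicative and has values in the cone [0 <= j <= d]; by
    Dickson's lemma [A] is noetherian on both sides, and so are [A # G] and, through
    the Reynolds operator, [A^G].

    For cyclic [G] the degrees of invariants form a saturated subsemigroup of the
    cone.  If [phi] is an endomorphism of an ideal, its degree [delta] satisfies
    [deg x + m delta] in the cone for all [m], hence [delta] is the degree of an
    invariant, and subtracting a leading term ends the proof by induction.

    In the dihedral case [A] is finite over its center.  An ideal of [A^G] contains a
    central [z != 0], and [phi] is multiplication by [a / z], where [z^m] divides
    [z (a r)^(m + 1)] for all invariant [r] and all [m].  On leading coefficients this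
    forces the one of [z] to divide that of [a] in [k[t]]; the symmetry exchanging [u]
    and [v] bounds the degree of the quotient, so that a leading term can again be
    subtracted.

    Finally [A^G = e (A # G) e] for the mean [e] of [G], and the ideal generated by
    [e] contains two elements of [A] forming a regular sequence, so the property of
    endomorphisms of ideals, as well as primeness, passes from [A^G] to [A # G]. *)
Require Import Defs.
From HB Require Import structures.
From mathcomp Require Import all_boot all_algebra all_fingroup cyclic zify ring.
From mathcomp.multinomials Require Import monalg.
From mathcomp Require Import boolp.

Set Implicit Arguments.
Unset Strict Implicit.
Unset Printing Implicit Defensive.

Import GRing.Theory.
Local Open Scope ring_scope.


(** * Coordinates on the planes *)

Section Twist.
Variables (k : comNzRingType) (q b : k).

Definition twist_aff : {poly k} := q *: 'X + b%:P.

(** Once [t = u^-1 v] is adjoined, this is what happens to [f] when it crosses [u^e]: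
    [f u^e = u^e (twist e f)]. *)
Definition twist (e : nat) (f : {poly k}) : {poly k} :=
  iter e (fun g => g \Po twist_aff) f.

Lemma twistS e f : twist e.+1 f = twist e f \Po twist_aff. Proof. by []. Qed.

Lemma twistD e1 e2 f : twist (e1 + e2) f = twist e1 (twist e2 f).
Proof. exact: iterD. Qed.

Lemma twist_is_linear e : linear (twist e).
Proof. by elim: e => // e IH c f g; rewrite !twistS IH linearP. Qed.

HB.instance Definition _ e :=
  GRing.isLinear.Build k {poly k} {poly k} _ (twist e) (@twist_is_linear e).

Lemma twist_is_monoid_morphism e : monoid_morphism (twist e).
Proof.
split; first by elim: e => // e; rewrite twistS => ->; rewrite comp_polyC.
by elim: e => // e IH f g; rewrite !twistS IH rmorphM.
Qed.

HB.instance Definition _ e :=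
  GRing.isMonoidMorphism.Build {poly k} {poly k} (twist e)
    (@twist_is_monoid_morphism e).

End Twist.

Arguments twist {k} q b e f : simpl never.

Section TwistSize.
Variables (k : fieldType) (q b : k).
Hypothesis q0 : q != 0.
Local Notation twist := (twist q b).

Lemma size_twist e f : size (twist e f) = size f.
Proof.
elim: e => // e IH; rewrite (twistS q b) size_comp_poly2 // /twist_aff.
by rewrite size_polyDl size_scale // size_polyX // ltnS size_polyC leq_b1.
Qed.

Lemma twist_eq0 e f : (twist e f == 0) = (f == 0).
Proof. by rewrite -!size_poly_eq0 size_twist. Qed.

End TwistSize.

Lemma plane_relM (k : comNzRingType) (B : lalgType k) (q b : k) (u v y : B) :
  (v * u - q *: (u * v) - b *: u ^+ 2) * y =
  v * (u * y) - q *: (u * (v * y)) - b *: (u * (u * y)).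
Proof. by rewrite expr2 !mulrBl -!scalerAl !mulrA. Qed.

Lemma lalg_combM (k : comNzRingType) (B : lalgType k) (c : k) (x x' y : B) :
  (c *: x + x') * y = c *: (x * y) + x' * y.
Proof. by rewrite mulrDl scalerAl. Qed.

Section Coordinates.
Variables (k : comNzRingType) (q b : k).
Variables (r : freealg2 k) (r0 : r@_mone = 0).
Local Notation A := (presalg r0).
Local Notation tw := (twist q b).
Local Notation "'t" := ('X : {poly k}).

(** Effect of a letter multiplied on the left: since [v = u t], one has
    [v u^m f = u^(m+1) (twist m t) f]. *)
Definition shift_u (F : nat -> {poly k}) (n : nat) : {poly k} :=
  if n is m.+1 then F m else 0.
Definition shift_v (F : nat -> {poly k}) (n : nat) : {poly k} :=
  if n is m.+1 then tw m 't * F m else 0.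

Definition word_coord (w : seq bool) : nat -> {poly k} :=
  foldr (fun l F => if l then shift_v F else shift_u F)
    (fun n => if n is 0 then 1 else 0) w.

Definition free_coord (n : nat) (x : freealg2 k) : {poly k} :=
  mmap polyC (fun w : {fmonom bool} => word_coord (val w) n) x.

Lemma free_coord_is_linear n : linear (free_coord n).
Proof.
move=> c x y; rewrite /free_coord mmapD; congr (_ + _).
rewrite (mmapEw (msuppZ_le _ _)) mmapE scaler_sumr.
by apply: eq_bigr => w _; rewrite mcoeffZ /= polyCM -mulrA mul_polyC.
Qed.

HB.instance Definition _ n :=
  GRing.isLinear.Build k (freealg2 k) {poly k} _ (free_coord n)
    (free_coord_is_linear n).

Lemma free_induction (P : freealg2 k -> Prop) :
  (forall c x y, P x -> P y -> P (c *: x + y)) -> P 1 ->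
  (forall x, P x -> P (free_u k * x)) -> (forall x, P x -> P (free_v k * x)) ->
  forall x, P x.
Proof.
move=> PL P1 Pu Pv.
have P0 : P 0 by have := PL (-1) _ _ P1 P1; rewrite scaleN1r addNr.
have PZ c x : P x -> P (c *: x) by move=> Px; rewrite -[_ *: _]addr0; exact: PL.
have Pw (w : seq bool) : P << FMonom w >>.
  elim: w => [|l w IH].
    suff -> : FMonom [::] = mone :> {fmonom bool} by [].
    by apply: val_inj; rewrite /= fm1.
  have -> : << FMonom (l :: w) >> = << fmu l >> * << FMonom w >> :> freealg2 k.
    rewrite malgM_def fgmulUU mulr1; congr << _ >>.
    by apply: val_inj; rewrite /= fmM fmU.
  by case: l; [exact: Pv|exact: Pu].
move=> x; rewrite (monalgE x); elim/big_ind: _ => //.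
  by move=> y z Py Pz; rewrite -[y]scale1r; exact: PL.
move=> w _; suff -> : << x@_w *g w >> = x@_w *: << FMonom (val w) >> :> freealg2 k.
  exact/PZ/Pw.
by apply/malgP => m; rewrite mcoeffZ !mcoeffU fmK mulrnAr mulr1.
Qed.

Lemma free_coord1 n : free_coord n 1 = if n is 0 then 1 else 0.
Proof. by rewrite /free_coord mmapU ?fm1 /= ?fm1 ?mul1r. Qed.

Lemma free_coord_letter l n x :
  free_coord n (<< fmu l >> * x) =
  (if l then shift_v else shift_u) (free_coord^~ x) n.
Proof.
rewrite malgM_def fgmulUg raddf_sum /=.
under eq_bigr do rewrite mul1r /free_coord mmapU /= fmM fmU /=.
case: l n => [] [|n] /=.
- by rewrite big1 // => w _; rewrite mulr0.
- by rewrite /free_coord mmapE mulr_sumr; apply: eq_bigr => w _; rewrite mulrCA.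
- by rewrite big1 // => w _; rewrite mulr0.
- by [].
Qed.

Lemma free_coord_uM n x :
  free_coord n (free_u k * x) = if n is m.+1 then free_coord m x else 0.
Proof. exact: (free_coord_letter false). Qed.

Lemma free_coord_vM n x :
  free_coord n (free_v k * x) =
  if n is m.+1 then tw m 't * free_coord m x else 0.
Proof. exact: (free_coord_letter true). Qed.

Hypothesis rE :
  r = free_v k * free_u k - q *: (free_u k * free_v k) - b *: free_u k ^+ 2.

Lemma twistSX n : tw n.+1 't = q *: tw n 't + b%:P.
Proof.
by rewrite -addn1 twistD twistS comp_polyX linearD linearZ /= -alg_polyC linearZ /= rmorph1.
Qed.

Lemma free_coordP n c x y : free_coord n (c *: x + y) = c *: free_coord n x + free_coord n y.
Proof. exact: free_coord_is_linear. Qed.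

Lemma free_coordB n x y : free_coord n (x - y) = free_coord n x - free_coord n y.
Proof. exact: (raddfB (free_coord n)). Qed.

Lemma free_coordZ n c x : free_coord n (c *: x) = c *: free_coord n x.
Proof. by have := free_coordP n c x 0; rewrite !addr0 => ->; rewrite (raddf0 (free_coord n)) addr0. Qed.

(** In degree [n + 2] the relation reduces to [twist (n+1) t = q (twist n t) + b]; in degrees [0]
    and [1] all terms vanish. *)
Lemma shift_rel (X : Type) (F : nat -> X -> {poly k}) (mu mv : X -> X) n y :
  (forall n x, F n (mu x) = if n is m.+1 then F m x else 0) ->
  (forall n x, F n (mv x) = if n is m.+1 then tw m 't * F m x else 0) ->
  F n (mv (mu y)) - q *: F n (mu (mv y)) - b *: F n (mu (mu y)) = 0.
Proof.
move=> Fu Fv; case: n => [|[|n]]; rewrite !(Fu, Fv) ?scaler0 ?subr0 //.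
  by rewrite mulr0.
by rewrite twistSX mulrDl mul_polyC -scalerAl addrAC addrK subrr.
Qed.

Lemma free_coord_comb n x y z :
  free_coord n (x - q *: y - b *: z) =
  free_coord n x - q *: free_coord n y - b *: free_coord n z.
Proof.
have combE X Y Z : free_coord n (X - Y - Z) =
    free_coord n X - free_coord n Y - free_coord n Z by rewrite !free_coordB.
by rewrite combE; congr (_ - _ - _); exact: free_coordZ.
Qed.

Lemma free_coord_relM n y : free_coord n (r * y) = 0.
Proof.
have -> : r * y = free_v k * (free_u k * y) - q *: (free_u k * (free_v k * y))
   - b *: (free_u k * (free_u k * y)).
  by rewrite rE; exact: (@plane_relM k (freealg2 k) q b (free_u k) (free_v k)).
rewrite free_coord_comb.
exact: (@shift_rel (freealg2 k) free_coord ( *%R (free_u k)) ( *%R (free_v k))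
  n y free_coord_uM free_coord_vM).
Qed.

Lemma free_coordP0 n c x y :
  free_coord n x = 0 -> free_coord n y = 0 -> free_coord n (c *: x + y) = 0.
Proof. by rewrite free_coordP => -> ->; rewrite scaler0 addr0. Qed.

(** The right factor is covered by [free_coord_relM]; the left factor is removed letter by letter,
    since a letter only shifts the coordinates and multiplies them by polynomials. *)
Lemma free_coord_ideal n x : ideal_gen r x -> free_coord n x = 0.
Proof.
case=> s ->; rewrite (raddf_sum (free_coord n)) big1 // => -[a y] _ /=.
rewrite -mulrA; elim/free_induction: a n => [c a a' Ha Ha'||a IH|a IH] n.
- rewrite (_ : (c *: a + a') * (r * y) = c *: (a * (r * y)) + a' * (r * y)).
    exact: free_coordP0 (Ha n) (Ha' n).
  exact: (@lalg_combM k (freealg2 k)).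
- by rewrite mul1r free_coord_relM.
- by rewrite -mulrA free_coord_uM; case: n => //= n.
- by rewrite -mulrA free_coord_vM; case: n => //= n; rewrite IH mulr0.
Qed.

Definition pres_coord (n : nat) (x : A) : {poly k} := free_coord n (presalg_repr x).

Lemma pres_coord_pi n x : pres_coord n (presalg_pi r0 x) = free_coord n x.
Proof.
apply/eqP; rewrite -subr_eq0 -linearB; apply/eqP/free_coord_ideal.
by apply/(presalg_piP r0); rewrite presalg_reprK.
Qed.

Lemma pres_coord_is_linear n : linear (pres_coord n).
Proof.
move=> c x y; rewrite -[x]presalg_reprK -[y]presalg_reprK.
by rewrite -linearP /= !pres_coord_pi linearP.
Qed.

HB.instance Definition _ n :=
  GRing.isLinear.Build k A {poly k} _ (pres_coord n) (pres_coord_is_linear n).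

Definition pres_coord_linear n : {linear A -> {poly k}} := pres_coord n.

Local Notation u := (gen_u r0).
Local Notation v := (gen_v r0).

Lemma presalg_induction (P : A -> Prop) :
  (forall c x y, P x -> P y -> P (c *: x + y)) -> P 1 ->
  (forall x, P x -> P (u * x)) -> (forall x, P x -> P (v * x)) ->
  forall x, P x.
Proof.
move=> PL P1 Pu Pv x; rewrite -[x]presalg_reprK.
elim/free_induction: (presalg_repr x) => [c y z Py Pz||y Py|y Py].
- by rewrite linearP; exact: PL.
- by rewrite rmorph1.
- by rewrite rmorphM; exact: Pu.
- by rewrite rmorphM; exact: Pv.
Qed.

Lemma presalg_vu : v * u = q *: (u * v) + b *: u ^+ 2.
Proof.
apply/eqP; rewrite -subr_eq0 opprD addrA /gen_u /gen_v -rmorphXn -!rmorphM.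
by rewrite -!linearZ -!linearB /= -rE presalg_rel.
Qed.

Lemma pres_coord1 n : pres_coord n 1 = if n is 0 then 1 else 0.
Proof. by rewrite -(rmorph1 (presalg_pi r0)) pres_coord_pi free_coord1. Qed.

Lemma pres_coord_uM n x : pres_coord n.+1 (u * x) = pres_coord n x.
Proof.
by rewrite -[x]presalg_reprK -rmorphM !pres_coord_pi (free_coord_uM,free_coord_vM).
Qed.

Lemma pres_coord0_uM x : pres_coord 0 (u * x) = 0.
Proof. by rewrite -[x]presalg_reprK -rmorphM !pres_coord_pi (free_coord_uM,free_coord_vM). Qed.

Lemma pres_coord_vM n x : pres_coord n.+1 (v * x) = tw n 't * pres_coord n x.
Proof.
by rewrite -[x]presalg_reprK -rmorphM !pres_coord_pi (free_coord_uM,free_coord_vM).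
Qed.

Lemma pres_coord0_vM x : pres_coord 0 (v * x) = 0.
Proof. by rewrite -[x]presalg_reprK -rmorphM !pres_coord_pi (free_coord_uM,free_coord_vM). Qed.

End Coordinates.

(* [coordinate n x] is the polynomial [f_n] in [t = u^-1 v] when [x] is written as the
   sum of the [u^n f_n]; note that [f u = u (twist 1 f)] for [f] in [k[t]]. *)
Record plane_coord (k : fieldType) (q b : k) (A : algType k) (u v : A) :=
  PlaneCoord {
    coordinate :> nat -> {linear A -> {poly k}};
    plane_rel : v * u = q *: (u * v) + b *: u ^+ 2;
    plane_ind : forall P : A -> Prop,
      (forall c x y, P x -> P y -> P (c *: x + y)) -> P 1 ->
      (forall x, P x -> P (u * x)) -> (forall x, P x -> P (v * x)) ->
      forall x, P x;
    coord1 : forall n, coordinate n 1 = if n is 0 then 1 else 0;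
    coord_uM : forall n x, coordinate n.+1 (u * x) = coordinate n x;
    coord0_uM : forall x, coordinate 0 (u * x) = 0;
    coord_vM : forall n x,
      coordinate n.+1 (v * x) = twist q b n 'X * coordinate n x;
    coord0_vM : forall x, coordinate 0 (v * x) = 0
  }.

Definition presalg_plane_coord (k : fieldType) (q b : k) (kc := k : comNzRingType)
  (r : freealg2 kc) (r0 : r@_mone = 0)
  (rE : r = free_v kc * free_u kc - (q : kc) *: (free_u kc * free_v kc)
          - (b : kc) *: free_u kc ^+ 2) :
  plane_coord q b (gen_u r0) (gen_v r0) :=
  @PlaneCoord k q b (presalg r0) (gen_u r0) (gen_v r0)
    (@pres_coord_linear kc q b r r0 rE) (@presalg_vu kc q b r r0 rE)
    (@presalg_induction kc r r0) (@pres_coord1 kc q b r r0 rE)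
    (@pres_coord_uM kc q b r r0 rE) (@pres_coord0_uM kc q b r r0 rE) (@pres_coord_vM kc q b r r0 rE)
    (@pres_coord0_vM kc q b r r0 rE).

(** * Homogeneous components and injectivity of the coordinates *)

Section PlaneCoord.
Variables (k : fieldType) (q b : k) (A : algType k) (u v : A).
Hypothesis q0 : q != 0.
Variable coord : plane_coord q b u v.
Local Notation tw := (twist q b).
Local Notation "'t" := ('X : {poly k}).

(** A Cauchy product twisted by the rule [(u^i f) (u^j g) = u^(i+j) (twist j f) g]. *)
Lemma coordM n x y :
  coord n (x * y) = \sum_(i < n.+1) tw (n - i) (coord i x) * coord (n - i)%N y.
Proof.
elim/(plane_ind coord): x n => [c x x' Hx Hx'||x IH|x IH] n.
- rewrite mulrDl -scalerAl linearP /= Hx Hx' scaler_sumr -big_split /=.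
  by apply: eq_bigr => i _; rewrite linearP !linearP /= mulrDl scalerAl.
- rewrite mul1r big_ord_recl big1 ?addr0 /= => [|i _].
    by rewrite coord1 subn0 rmorph1 mul1r.
  by rewrite coord1 linear0 mul0r.
- rewrite -mulrA; case: n => [|n].
    by rewrite coord0_uM big_ord1 coord0_uM mul0r.
  rewrite coord_uM IH [RHS]big_ord_recl coord0_uM linear0 mul0r add0r.
  by apply: eq_bigr => i _; rewrite coord_uM.
- rewrite -mulrA; case: n => [|n].
    by rewrite coord0_vM big_ord1 coord0_vM mul0r.
  rewrite coord_vM IH [RHS]big_ord_recl coord0_vM linear0 mul0r add0r mulr_sumr.
  apply: eq_bigr => i _; rewrite coord_vM rmorphM /= subSS mulrA; congr (_ * _ * _).
  by rewrite -twistD subnK // -ltnS.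
Qed.

(** A letter [v] raises the degree in [t] and the degree in [u] by one, a letter [u] only the
    latter; this is the edge [j <= d] of the cone of exponents. *)
Lemma size_coord n x : (size (coord n x) <= n.+1)%N.
Proof.
elim/(plane_ind coord): x n => [c x y Hx Hy||x IH|x IH] n.
- rewrite linearP (leq_trans (size_polyD _ _)) // geq_max Hy.
  by rewrite (leq_trans (size_scale_leq _ _)) ?Hx.
- by rewrite coord1; case: n => [|n]; rewrite ?size_poly1 ?size_poly0.
- case: n => [|n]; first by rewrite coord0_uM size_poly0.
  by rewrite coord_uM (leq_trans (IH n)).
- case: n => [|n]; first by rewrite coord0_vM size_poly0.
  rewrite coord_vM (leq_trans (size_polyMleq _ _)) // size_twist // size_polyX /=.
  by rewrite ltnS.
Qed.

Fixpoint homog (d : nat) (x : A) : Prop :=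
  if d is d'.+1 then exists y z, [/\ homog d' y, homog d' z & x = u * y + v * z]
  else exists c, x = c *: 1.

Lemma homogSP d x : homog d.+1 x ->
  exists y z, [/\ homog d y, homog d z & x = u * y + v * z].
Proof. by []. Qed.

Lemma homogP d c x y : homog d x -> homog d y -> homog d (c *: x + y).
Proof.
elim: d x y => [|d IH] x y /=.
  by move=> [a ->] [a' ->]; exists (c * a + a'); rewrite scalerDl scalerA.
move=> [y1 [z1 [H1 H2 ->]]] [y2 [z2 [H3 H4 ->]]].
exists (c *: y1 + y2), (c *: z1 + z2); split; [exact: IH|exact: IH|].
by rewrite !mulrDr -!scalerAr addrACA scalerDr.
Qed.

Lemma homog0 d : homog d 0.
Proof.
elim: d => [|d IH] /=; first by exists 0; rewrite scale0r.
by exists 0, 0; split=> //; rewrite !mulr0 addr0.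
Qed.

Lemma homog_u d x : homog d x -> homog d.+1 (u * x).
Proof. by move=> Hx; exists x, 0; split=> //; [exact: homog0|rewrite mulr0 addr0]. Qed.

Lemma homog_v d x : homog d x -> homog d.+1 (v * x).
Proof. by move=> Hx; exists 0, x; split=> //; [exact: homog0|rewrite mulr0 add0r]. Qed.

(** The relation moves each [u] to the left past [v], so the only normal monomial that does not
    start with [u] is a pure power of [v]. *)
Lemma homog_normal d x : homog d.+1 x ->
  exists y c, homog d y /\ x = u * y + c *: v ^+ d.+1.
Proof.
elim: d x => [|d IH] x /homogSP[y [z [Hy Hz ->]]].
  by case: Hz => c ->; exists y, c; split=> //; rewrite expr1 -scalerAr mulr1.
have [z' [c [Hz' ->]]] := IH _ Hz.
exists (y + (q *: (v * z') + b *: (u * z'))), c; split.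
  rewrite -[y]scale1r; apply: (homogP _ Hy); apply: homogP; first exact: homog_v.
  by rewrite -[_ *: _]addr0; apply: homogP; [exact: homog_u|exact: homog0].
rewrite !mulrDr -!scalerAr -exprS !addrA; congr (_ + _); rewrite -addrA; congr (_ + _).
by rewrite [LHS]mulrA (plane_rel coord) mulrDl -!scalerAl expr2 !mulrA.
Qed.

Lemma coord_homog d n x : homog d x -> n != d -> coord n x = 0.
Proof.
elim: d n x => [|d IH] n x /=.
  by move=> [c ->]; rewrite linearZ /= coord1; case: n => //= n; rewrite scaler0.
move=> [y [z [Hy Hz ->]]]; rewrite linearD /=; case: n => [|n].
  by rewrite coord0_uM coord0_vM addr0.
by rewrite eqSS => nd; rewrite coord_uM coord_vM !IH // mulr0 addr0.
Qed.

Lemma size_coord_vn d : size (coord d (v ^+ d)) = d.+1.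
Proof.
elim: d => [|d IH]; first by rewrite coord1 size_poly1.
rewrite exprS coord_vM size_mul -?size_poly_eq0 ?IH ?size_twist // ?size_polyX //.
Qed.

(** The coordinate of [v^(d+1)] has degree exactly [d + 1], too large to be cancelled by that of
    [u * y]; so its coefficient is zero, and [u] can be stripped off. *)
Lemma coord_homog_inj d x : homog d x -> coord d x = 0 -> x = 0.
Proof.
elim: d x => [|d IH] x.
  case=> c ->; rewrite linearZ /= coord1 => /eqP.
  by rewrite scaler_eq0 oner_eq0 orbF => /eqP ->; rewrite scale0r.
move=> /homog_normal[y [c [Hy ->]]]; rewrite linearD linearZ /= coord_uM => H.
have c0 : c = 0.
  apply/eqP; apply: contraT => c0; move: H => /eqP; rewrite addrC addr_eq0.
  move=> /eqP/(congr1 (size \o @polyseq k)) /=; rewrite size_scale // size_coord_vn size_opp.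
  by move=> Hs; have := size_coord d y; rewrite -Hs ltnn.
by move: H; rewrite c0 !scale0r !addr0 => /(IH _ Hy) ->; rewrite mulr0.
Qed.

(** A multiple of [v^(d+1)] accounts for the coefficient of [t^(d+1)]; the rest comes from degree
    [d] through multiplication by [u]. *)
Lemma coord_homog_surj d (f : {poly k}) : (size f <= d.+1)%N ->
  exists2 x, homog d x & coord d x = f.
Proof.
elim: d f => [|d IH] f fd.
  exists (f`_0 *: 1); first by exists f`_0.
  by rewrite linearZ /= coord1 [in RHS](size1_polyC fd) alg_polyC.
pose g := coord d.+1 (v ^+ d.+1).
have g0 : lead_coef g != 0 by rewrite lead_coef_eq0 -size_poly_eq0 size_coord_vn.
pose c := f`_d.+1 / lead_coef g.
have [] := IH (f - c *: g).
  apply/leq_sizeP => j; rewrite leq_eqVlt => /predU1P[<-|dj].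
    have -> : (f - c *: g)`_d.+1 = f`_d.+1 - c * lead_coef g.
      by rewrite coefB coefZ lead_coefE size_coord_vn.
    by rewrite divfK // subrr.
  rewrite coefB coefZ !nth_default ?mulr0 ?subr0 // ?size_coord_vn //.
  exact: leq_trans fd _.
move=> y Hy yE; exists (u * y + c *: v ^+ d.+1); last first.
  by rewrite linearD linearZ /= coord_uM yE subrK.
rewrite addrC; apply: homogP; last exact: homog_u.
elim: d.+1 => [|e IHe]; first by exists 1; rewrite scale1r.
by rewrite exprS; exact: homog_v.
Qed.

(** The equation is required for every large [M] so that two decompositions can be added with a
    common bound. *)
Lemma homog_decomp x : exists (h : nat -> A) N, (forall d, homog d (h d)) /\
  forall M, (N <= M)%N -> x = \sum_(d < M) h d.
Proof.
elim/(plane_ind coord): x => [c x y|| x| x].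
- move=> [h [N [Hh xE]]] [h' [N' [Hh' yE]]].
  exists (fun d => c *: h d + h' d), (maxn N N'); split=> [d|M].
    exact: homogP.
  by rewrite geq_max => /andP[/xE -> /yE ->]; rewrite big_split /= scaler_sumr.
- exists (fun d => if d is 0 then 1 else 0), 1%N; split=> [[|d]|[|M] // _].
  + by exists 1; rewrite scale1r.
  + exact: homog0.
  + by rewrite big_ord_recl big1 ?addr0.
- move=> [h [N [Hh xE]]]; exists (fun d => if d is d'.+1 then u * h d' else 0), N.+1.
  split=> [[|d]|[|M] // NM]; [exact: homog0|exact: homog_u|].
  by rewrite big_ord_recl add0r /= -mulr_sumr -xE.
- move=> [h [N [Hh xE]]]; exists (fun d => if d is d'.+1 then v * h d' else 0), N.+1.
  split=> [[|d]|[|M] // NM]; [exact: homog0|exact: homog_v|].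
  by rewrite big_ord_recl add0r /= -mulr_sumr -xE.
Qed.

Lemma coord_support x : exists N, forall n, (N <= n)%N -> coord n x = 0.
Proof.
have [h [N [Hh xE]]] := homog_decomp x; exists N => n Nn.
rewrite (xE N) // linear_sum big1 // => d _; apply: coord_homog (Hh d) _.
by rewrite gtn_eqF // (leq_trans (ltn_ord d)).
Qed.

Lemma coord_inj x : (forall n, coord n x = 0) -> x = 0.
Proof.
have [h [N [Hh xE]]] := homog_decomp x => x0.
suff h0 d : h d = 0 by rewrite (xE N) // big1.
apply: (coord_homog_inj (Hh d)).
rewrite -(x0 d) (xE (maxn N d.+1)) ?leq_maxl // linear_sum /=.
have dM : (d < maxn N d.+1)%N by rewrite leq_maxr.
rewrite (bigD1 (Ordinal dM)) //= big1 ?addr0 // => i id.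
by apply: coord_homog (Hh i) _; rewrite eq_sym.
Qed.

End PlaneCoord.

(** * Noetherian rings with a degree *)

Lemma nondecreasing_subsequence (f : nat -> nat) :
  exists2 s : nat -> nat, (forall i j, (i < j)%N -> (s i < s j)%N)
    & forall i j, (i <= j)%N -> (f (s i) <= f (s j))%N.
Proof.
have min N : exists n, (N <= n)%N /\ forall m, (N <= m)%N -> (f n <= f m)%N.
  have exP : exists v, `[< exists2 n, (N <= n)%N & f n = v >].
    by exists (f N); apply/asboolP; exists N.
  case: (ex_minnP exP) => v /asboolP[n Nn fn] vmin; exists n; split=> // m Nm.
  by rewrite fn; apply: vmin; apply/asboolP; exists m.
have [g gP] := choice min.
pose s := fix s i := if i is i'.+1 then g (s i').+1 else g 0.
have sS i : (s i < s i.+1)%N by have [] := gP (s i).+1.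
exists s; first by apply: (homo_ltn ltn_trans).
apply: (homo_leq leqnn leq_trans) => i.
case: i => [|i]; first by have [_] := gP 0; apply.
by have [_] := gP (s i).+1; apply; exact: leq_trans (sS i) (ltnW (sS i.+1)).
Qed.

Lemma dickson (f g : nat -> nat) :
  exists i j, [/\ (i < j)%N, (f i <= f j)%N & (g i <= g j)%N].
Proof.
have [s s_lt fs] := nondecreasing_subsequence f.
have [t t_lt gt] := nondecreasing_subsequence (g \o s).
by exists (s (t 0)), (s (t 1)); split; [exact/s_lt/t_lt|exact/fs/ltnW/t_lt|exact: gt].
Qed.

Lemma chain_mono (T : Type) (I : nat -> T -> Prop) :
  (forall n x, I n x -> I n.+1 x) ->
  forall m n x, (m <= n)%N -> I m x -> I n x.
Proof.
move=> IS m n x /subnKC <-; elim: (n - m)%N => [|d IH]; first by rewrite addn0.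
by move=> /IH; rewrite addnS; exact: IS.
Qed.

Lemma left_ideal_opp (R : pzRingType) (I : R -> Prop) x :
  left_ideal I -> I x -> I (- x).
Proof. by case=> _ _ IM Ix; rewrite -mulN1r; exact: IM. Qed.

Lemma left_idealB (R : pzRingType) (I : R -> Prop) x y :
  left_ideal I -> I x -> I y -> I (x - y).
Proof. by move=> LI Ix Iy; case: (LI) => _ ID _; apply: ID => //; exact: left_ideal_opp. Qed.

(* Since [a.2 <= a.1], the code orders such pairs lexicographically. *)
Definition lex_code (a : nat * nat) : nat := a.1 * a.1.+1 + a.2.

(* The degree of [x] is to be thought of as an exponent in the cone
   [0 <= a.2 <= a.1]; the last clause says that the set of degrees is saturated. *)
Record degree (R : nzRingType) (dg : R -> nat * nat) : Prop := Degree {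
  degM : forall x y : R, x != 0 -> y != 0 -> x * y != 0 /\
    dg (x * y) = ((dg x).1 + (dg y).1, (dg x).2 + (dg y).2)%N;
  deg_cone : forall x : R, x != 0 -> ((dg x).2 <= (dg x).1)%N;
  deg_lower : forall x y : R, x != 0 -> y != 0 -> dg x = dg y ->
    exists s : R, (forall r : R, s * r = r * s) /\
      (x - s * y != 0 -> (lex_code (dg (x - s * y)%R) < lex_code (dg x))%N);
  deg_sat : forall x y : R, x != 0 -> y != 0 -> ((dg y).2 <= (dg x).2)%N ->
    ((dg y).1 - (dg y).2 <= (dg x).1 - (dg x).2)%N ->
    exists2 m : R, m != 0 & dg x = ((dg m).1 + (dg y).1, (dg m).2 + (dg y).2)%N
}.

Lemma degree_converse (R : nzRingType) (dg : R -> nat * nat) :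
  degree dg -> degree (dg : R^c -> nat * nat).
Proof.
move=> D; split.
- by move=> x y x0 y0; rewrite addnC [X in (_, X)]addnC; exact: (degM D).
- exact: (deg_cone D).
- move=> x y x0 y0 xy; have [s [sC sP]] := deg_lower D x0 y0 xy.
  by exists s; rewrite sC in sP; split=> [r|]; [exact/esym/sC|exact: sP].
- exact: (deg_sat D).
Qed.

(** If the chain is not stationary, an element of least code outside [I N] has a degree that is
    divisible by no degree of a nonzero element of [I N]: otherwise its leading term could be
    cancelled. Iterating contradicts Dickson's lemma. *)
Lemma degree_acc (R : nzRingType) (dg : R -> nat * nat) :
  degree dg -> acc (@left_ideal R).
Proof.
move=> D I LI IS; apply: contrapT => nstab.
have Imono := chain_mono IS.
have ex N : exists p : R * nat, [/\ (N <= p.2)%N, I p.2 p.1, p.1 != 0,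
    ~ I N p.1 & forall y, I N y -> y != 0 ->
      ((dg y).2 <= (dg p.1).2)%N ->
      ((dg y).1 - (dg y).2 <= (dg p.1).1 - (dg p.1).2)%N -> False].
  pose P c := exists x n, [/\ (N <= n)%N, I n x, ~ I N x & lex_code (dg x) = c].
  have exP : exists c, `[< P c >].
    have [[n [x [Nn In nI]]]|none] :=
        pselect (exists n x, [/\ (N <= n)%N, I n x & ~ I N x]).
      by exists (lex_code (dg x)); apply/asboolP; exists x, n.
    exfalso; apply: nstab; exists N => n x Nn In; apply: contrapT => nI.
    by apply: none; exists n, x.
  case: (ex_minnP exP) => c /asboolP[x [n [Nn In nI xc]]] cmin.
  have x0 : x != 0 by apply/eqP => x0; apply: nI; rewrite x0; case: (LI N).
  exists (x, n); split=> //= y Iy y0 le2 le1.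
  have [m m0 mE] := deg_sat D x0 y0 le2 le1.
  have [my0 myE] := degM D m0 y0; rewrite -mE in myE.
  have [s [_ sP]] := deg_lower D x0 my0 (esym myE).
  have Ismy : I N (s * (m * y)) by case: (LI N) => _ _ IM; apply: (IM); apply: (IM).
  have nI' : ~ I N (x - s * (m * y)).
    move=> H; apply: nI; rewrite -[x](subrK (s * (m * y))).
    by case: (LI N) => _ ID _; exact: ID.
  have d0 : x - s * (m * y) != 0.
    by apply/eqP => d0; apply: nI'; rewrite d0; case: (LI N).
  have := sP d0; rewrite xc ltnNge => /negP; apply; apply: cmin; apply/asboolP.
  exists (x - s * (m * y)), n; split=> //.
  by apply: left_idealB => //; exact: Imono Ismy.
have [g gP] := choice ex.
(* The element [x i] below lies in [I (N i.+1)], and its degree is divisible by none coming from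
   [I (N i)]. *)
pose N := fix N i := if i is i'.+1 then (g (N i')).2 else 0%N.
have N_le i j : (i <= j)%N -> (N i <= N j)%N.
  by apply: (homo_leq leqnn leq_trans) => {}i; have [] := gP (N i).
pose x i := (g (N i)).1.
have [i [j [ij le2 le1]]] :=
  dickson (fun i => (dg (x i)).2) (fun i => (dg (x i)).1 - (dg (x i)).2)%N.
have [_ Ix x0 _ _] := gP (N i).
have [_ _ _ _ H] := gP (N j).
apply: (H (x i)) => //; exact: (Imono _ _ _ (N_le i.+1 j ij)).
Qed.

(** Finite free modules over a left noetherian ring are noetherian. Only closure conditions on [J]
    are asked, so that the result also applies to the converse ring with twisted coefficients. *)
Lemma acc_finfun (A : pzRingType) (I : finType) (J : nat -> {ffun I -> A} -> Prop) :
  acc (@left_ideal A) ->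
  (forall n, J n 0) -> (forall n f g, J n f -> J n g -> J n (f + g)) ->
  (forall n a f, J n f -> J n [ffun i => a * f i]) ->
  (forall n f, J n f -> J n.+1 f) ->
  exists N, forall n f, (N <= n)%N -> J n f -> J N f.
Proof.
move=> accA J0 JD JM JS; have Jmono := chain_mono JS.
have JB n f g : J n f -> J n g -> J n (f - g).
  move=> Jf Jg; apply: JD => //; have := JM n (-1) g Jg.
  by congr (J n _); apply/ffunP => i; rewrite !ffunE mulN1r.
suff [N HN] : exists N, forall n f, (N <= n)%N -> J n f ->
    (forall i, i \notin enum I -> f i = 0) -> J N f.
  by exists N => n f Nn Jf; apply: (HN n) => // i; rewrite mem_enum.
elim: (enum I) => [|i s [N1 IH]].
  exists 0%N => n f _ _ f0; suff -> : f = 0 by [].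
  by apply/ffunP => i; rewrite ffunE f0.
(* These ideals consist of the values at [i] of members supported on [i :: s]; once they are
   stationary, subtracting a suitable [g] clears the coordinate [i]. *)
pose K n a := exists f, [/\ J n f, forall j, j \notin i :: s -> f j = 0 & f i = a].
have [|n a [f [Jf fs fi]]|N2 HN2] := accA K.
- move=> n; split.
  + by exists 0; split=> [|j _|]; rewrite ?ffunE.
  + move=> a b [f [Jf fs fi]] [g [Jg gs gi]]; exists (f + g).
    split=> [|j js|]; [exact: JD|by rewrite ffunE fs // gs // addr0|].
    by rewrite ffunE fi gi.
  + move=> c a [f [Jf fs fi]]; exists [ffun j => c * f j].
    by split=> [|j js|]; rewrite ?ffunE ?fi ?fs ?mulr0 //; exact: JM.
- by exists f; split=> //; exact: JS.
exists (maxn N1 N2) => n f; rewrite geq_max => /andP[N1n N2n] Jf fs.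
have [|g [Jg gs gi]] := HN2 n (f i) N2n; first by exists f.
rewrite -[f](subrK g); apply: JD; last exact: (Jmono _ _ _ (leq_maxr _ _) Jg).
apply: (Jmono _ _ _ (leq_maxl _ _)); apply: (IH n) => //.
  by apply: JB => //; exact: Jmono Jg.
move=> j js; rewrite !ffunE; have [->|ji] := eqVneq j i; first by rewrite gi subrr.
by rewrite fs ?gs ?subrr // inE negb_or ji.
Qed.

(** A left ideal [J] of [R] is recovered from its extension [A (f J)], because [g] maps the
    extension back into [J]; the Reynolds operator will serve as [g]. *)
Lemma acc_retract (R A : pzRingType) (f : R -> A) (g : A -> R) :
  {morph f : x y / x * y} -> (forall x y, g (x + y) = g x + g y) -> g 0 = 0 ->
  (forall a r, g (a * f r) = g a * r) -> g 1 = 1 ->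
  acc (@left_ideal A) -> acc (@left_ideal R).
Proof.
move=> fM gD g0 gM g1 accA J LJ JS.
pose K n (x : A) := exists2 s : seq (A * R),
  (forall t, t \in s -> J n t.2) & x = \sum_(t <- s) t.1 * f t.2.
have [|n x [s Js ->]|N HN] := accA K.
- move=> n; split.
  + by exists [::]; rewrite ?big_nil.
  + move=> x y [s Js ->] [t Jt ->]; exists (s ++ t); last by rewrite big_cat.
    by move=> p; rewrite mem_cat => /orP[/Js|/Jt].
  + move=> a x [s Js ->]; exists [seq (a * t.1, t.2) | t <- s].
      by move=> p /mapP[t /Js Jt ->].
    by rewrite big_map mulr_sumr; apply: eq_bigr => t _; rewrite mulrA.
- by exists s => // t /Js; exact: JS.
exists N => n r Nn Jr; have [|s Js rE] := HN n (f r) Nn.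
  by exists [:: (1, r)]; rewrite ?big_seq1 ?mul1r // => t; rewrite inE => /eqP ->.
have [JN0 JND JNM] := LJ N.
have -> : r = \sum_(t <- s) g t.1 * t.2.
  transitivity (g (f r)); first by rewrite -[f r]mul1r gM g1 mul1r.
  rewrite rE; elim: s {Js rE} => [|t s IH]; first by rewrite !big_nil.
  by rewrite !big_cons gD IH gM.
by rewrite big_seq; elim/big_ind: _ => // t /Js; exact: JNM.
Qed.

Definition right_ore (R : nzRingType) : Prop :=
  forall x y : R, x != 0 -> y != 0 -> exists a b, [/\ a != 0, b != 0 & x * a = y * b].

(** The right ideals [y^i x R] are not independent, as their partial sums are stationary. Cancelling
    powers of [y] on the left of a nontrivial relation leaves a nonzero term in [x], which is then a
    right multiple of [y]. *)
Lemma noetherian_right_ore (R : nzRingType) :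
  (forall x y : R, x != 0 -> y != 0 -> x * y != 0) ->
  acc (@right_ideal R) -> right_ore R.
Proof.
move=> dom accR x y x0 y0.
pose J n z := exists r : nat -> R, z = \sum_(i < n) y ^+ i * x * r i.
have [|n z [r ->]|N HN] := accR J.
- move=> n; split.
  + by exists (fun=> 0); rewrite big1 // => i _; rewrite mulr0.
  + move=> a b [r ->] [t ->]; exists (fun i => r i + t i).
    by rewrite -big_split; apply: eq_bigr => i _; rewrite mulrDr.
  + move=> a b [r ->]; exists (fun i => r i * a).
    by rewrite mulr_suml; apply: eq_bigr => i _; rewrite mulrA.
- exists (fun i => if (i < n)%N then r i else 0).
  rewrite big_ord_recr /= ltnn mulr0 addr0.
  by apply: eq_bigr => i _; rewrite ltn_ord.
have [|r rE] := HN N.+1 (y ^+ N * x) (leqnSn N).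
  exists (fun i => if i == N then 1 else 0); rewrite big_ord_recr /= eqxx mulr1 big1 ?add0r //.
  by move=> i _; rewrite ltn_eqF ?mulr0.
suff ore M (s : nat -> R) : \sum_(i < M) y ^+ i * x * s i = 0 ->
    (exists2 i, (i < M)%N & s i != 0) ->
    exists a b, [/\ a != 0, b != 0 & x * a = y * b].
  apply: (ore N.+1 (fun i => if i == N then -1 else r i)).
    rewrite big_ord_recr /= eqxx mulrN1 rE.
    apply/eqP; rewrite subr_eq0; apply/eqP; apply: eq_bigr => i _.
    by rewrite ltn_eqF.
  by exists N; rewrite // eqxx oppr_eq0 oner_eq0.
elim: M s => [|M IH] s; first by move=> _ [].
rewrite big_ord_recl expr0 mul1r => /eqP; rewrite addr_eq0 => sE [i iM si].
have yE : \sum_(i < M) y ^+ (lift ord0 i) * x * s (lift ord0 i) =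
    y * \sum_(i < M) y ^+ i * x * s i.+1.
  by rewrite mulr_sumr; apply: eq_bigr => j _; rewrite exprS !mulrA.
rewrite yE -mulrN in sE.
have [s00|s00] := eqVneq (s 0%N) 0; last first.
  exists (s 0%N), (- \sum_(i < M) y ^+ i * x * s i.+1); split=> //; last exact/eqP.
  apply: contraTneq (dom _ _ x0 s00) => b0.
  by rewrite negbK (eqP sE) b0 mulr0.
apply: (IH (fun i => s i.+1)).
  apply/eqP; apply: contraTT sE => ?.
  by rewrite s00 mulr0 eq_sym mulrN oppr_eq0 dom.
by case: i iM si => [|i] iM si; [rewrite s00 eqxx in si|exists i].
Qed.

(** * Multipliers of ideals and maximal orders *)

Definition prime_ring (R : nzRingType) : Prop :=
  forall x y : R, (forall r, x * r * y = 0) -> x = 0 \/ y = 0.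

(** Only the values of [phi] on [I] matter. Over [R^c] the condition concerns endomorphisms of [I]
    as a left module. *)
Definition inner_multipliers (R : nzRingType) : Prop :=
  forall (I : R -> Prop) (phi : R -> R),
    left_ideal I -> right_ideal I -> (exists2 x, I x & x != 0) ->
    (forall x, I x -> I (phi x)) ->
    (forall x y, I x -> I y -> phi (x + y) = phi x + phi y) ->
    (forall x r, I x -> phi (x * r) = phi x * r) ->
    exists t, forall x, I x -> phi x = t * x.

(** By the Ore condition an endomorphism vanishing at one nonzero [x0] vanishes on [I]; the
    induction lowers the code of [phi x0] until this value is zero. *)
Lemma degree_multipliers (R : nzRingType) (dg : R -> nat * nat) :
  degree dg -> right_ore R -> inner_multipliers R.
Proof.
move=> D ore I phi LI RI [x0 Ix0 x0n].
have dom (x y : R) : x != 0 -> y != 0 -> x * y != 0 by move=> a b; have [] := degM D a b.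
have [c] := ubnP (lex_code (dg (phi x0))).
elim: c phi => // c IH phi phic phiI phiD phiM.
have phi0 : phi 0 = 0 by rewrite -(mulr0 x0) phiM // !mulr0.
have [px0|px0] := eqVneq (phi x0) 0.
  exists 0 => y Iy; rewrite mul0r; have [->//|y0] := eqVneq y 0.
  have [a [b [a0 b0 xyE]]] := ore x0 y x0n y0.
  apply/eqP; apply: contraT => py0; have := dom _ _ py0 b0.
  by rewrite -phiM // -xyE phiM // px0 mul0r eqxx.
(* All degrees are shifted by the same vector. Its entries might be negative a priori, hence the
   additive form. *)
have dgphi y : I y -> y != 0 -> phi y != 0 /\
    ((dg (phi y)).1 + (dg x0).1 = (dg y).1 + (dg (phi x0)).1)%N /\
    ((dg (phi y)).2 + (dg x0).2 = (dg y).2 + (dg (phi x0)).2)%N.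
  move=> Iy y0; have [a [b [a0 b0 xyE]]] := ore x0 y x0n y0.
  have pE : phi x0 * a = phi y * b by rewrite -!phiM // xyE.
  have py0 : phi y != 0.
    by apply: contraTneq (dom _ _ px0 a0) => py; rewrite pE py mul0r negbK.
  split=> //; have [_] := degM D px0 a0; have [_] := degM D x0n a0.
  rewrite xyE pE; have [_ ->] := degM D y0 b0; have [_ ->] := degM D py0 b0.
  by case=> ? ? [? ?]; lia.
have iterP m : [/\ I (iter m phi x0), iter m phi x0 != 0,
   ((dg (iter m phi x0)).1 + m * (dg x0).1 = m * (dg (phi x0)).1 + (dg x0).1)%N &
   ((dg (iter m phi x0)).2 + m * (dg x0).2 = m * (dg (phi x0)).2 + (dg x0).2)%N].
  elim: m => [|m [Im m0 m1 m2]] /=; first by split=> //; lia.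
  have [? [? ?]] := dgphi _ Im m0.
  by split=> //; [exact: phiI|lia|lia].
(* A negative shift would leave the cone after one iteration more than the size of the entry it
   diminishes. *)
have le2 : ((dg x0).2 <= (dg (phi x0)).2)%N.
  have [_ _ _] := iterP (dg x0).2.+1; nia.
have le1 : ((dg x0).1 - (dg x0).2 <= (dg (phi x0)).1 - (dg (phi x0)).2)%N.
  have [_ m0 m1 m2] := iterP ((dg x0).1 - (dg x0).2).+1.
  have := deg_cone D m0; have := deg_cone D x0n; have := deg_cone D px0; nia.
have [m m0 mE] := deg_sat D px0 x0n le2 le1.
have [mx0 mxE] := degM D m0 x0n; rewrite -mE in mxE.
have [s [_ sP]] := deg_lower D px0 mx0 (esym mxE).
pose psi x := phi x - s * (m * x).
have [ps0|ps0] := eqVneq (psi x0) 0.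
  exists (s * m) => y Iy; rewrite -mulrA; apply/eqP; rewrite -subr_eq0 -/(psi y).
  have [->|y0] := eqVneq y 0; first by rewrite /psi phi0 !mulr0 subr0.
  have [a [b [a0 b0 xyE]]] := ore x0 y x0n y0.
  apply: contraT => py0; have := dom _ _ py0 b0.
  rewrite mulrBl -phiM // -!mulrA -xyE phiM // !mulrA -mulrBl -mulrA -/(psi x0).
  by rewrite ps0 mul0r eqxx.
have [|x Ix|x y Ix Iy|x r Ix|t tP] := IH psi.
- exact: leq_trans (sP ps0) _.
- apply: left_idealB => //; first exact: phiI.
  by case: (LI) => _ _ IM; apply: (IM); apply: (IM).
- by rewrite /psi phiD // !mulrDr opprD addrACA.
- by rewrite /psi phiM // mulrBl !mulrA.
- by exists (t + s * m) => x Ix; rewrite mulrDl -tP // /psi -mulrA subrK.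
Qed.

Section MaximalOrderCriterion.
Variable R : nzRingType.
Hypothesis primeR : prime_ring R.

Lemma prime_semiprime : semiprime R.
Proof.
move=> I [_ _ IM] _ [n nilI] x Ix; apply/eqP; apply: contraT => x0.
suff [s [sn sI]] : exists s : seq R, [/\ size s = n, (forall y, y \in s -> I y) &
    \prod_(y <- s) y != 0] by rewrite nilI ?eqxx.
elim: (n) => [|m [s [sm sI s0]]]; first by exists [::]; rewrite big_nil oner_eq0.
have [r rP] : exists r, \prod_(y <- s) y * r * x != 0.
  apply: contrapT => none; have [r|/eqP|/eqP] := @primeR (\prod_(y <- s) y) x.
  - by apply/eqP; apply: contraT => ?; case: none; exists r.
  - by rewrite (negbTE s0).
  - by rewrite (negbTE x0).
exists (rcons s (r * x)); rewrite size_rcons sm; split=> // [y|].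
  by rewrite mem_rcons inE => /predU1P[->|/sI //]; exact: IM.
by rewrite -cats1 big_cat big_seq1 /= mulrA.
Qed.

Variables (Q : unitRingType) (i : {rmorphism R -> Q}).
Hypothesis iQ : quotient_ring i.

(** Multiplication by [q] on [L] agrees with multiplication by some [t] in [R]. Then [q - t] kills
    [L], and clearing its denominator brings the question back to primeness of [R]. *)
Lemma stable_inner (q : Q) (L : R -> Prop) :
  inner_multipliers R -> left_ideal L -> right_ideal L -> (exists2 x, L x & x != 0) ->
  (forall y, L y -> exists2 z, L z & i z = q * i y) -> exists t, q = i t.
Proof.
case: iQ => iI [_ _ _ frac] MR LL RL [y0 Ly0 y00] stab.
have /choice[phi phiP] : forall y, exists z, L y -> L z /\ i z = q * i y.
  move=> y; have [Ly|nLy] := pselect (L y); last by exists 0.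
  by have [z Lz zE] := stab y Ly; exists z.
have [||||t tP] := MR L phi LL RL; first by exists y0.
- by move=> x /phiP[].
- move=> x y Lx Ly; apply: iI; case: LL => _ LD _.
  by rewrite rmorphD /= !(proj2 (phiP _ _)) ?rmorphD ?mulrDr //; exact: LD.
- move=> x r Lx; apply: iI; case: RL => _ _ LM.
  by rewrite rmorphM /= !(proj2 (phiP _ _)) ?rmorphM ?mulrA //; exact: LM.
exists t; apply/eqP; rewrite -subr_eq0.
have [_ [_ [[a ->] [c ->] cU qE]]] := frac (q - i t).
suff a0 : a = 0 by rewrite qE a0 rmorph0 mulr0.
have [r| |/eqP] := @primeR a y0; [|by []|by rewrite (negbTE y00)].
have Lr : L (r * y0) by case: LL => _ _; apply.
apply: iI; rewrite -mulrA rmorphM rmorph0.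
apply: (mulrI (x := (i c)^-1)); rewrite ?unitrV // mulr0 mulrA -qE mulrBl.
by rewrite -(proj2 (phiP _ Lr)) tP // rmorphM subrr.
Qed.

Lemma stable_inner_right (q : Q) (L : R -> Prop) :
  inner_multipliers R^c -> left_ideal L -> right_ideal L ->
  (exists2 x, L x & x != 0) ->
  (forall y, L y -> exists2 z, L z & i z = i y * q) -> exists t, q = i t.
Proof.
case: iQ => iI [_ _ frac _] MR LL RL [y0 Ly0 y00] stab.
have /choice[phi phiP] : forall y, exists z, L y -> L z /\ i z = i y * q.
  move=> y; have [Ly|nLy] := pselect (L y); last by exists 0.
  by have [z Lz zE] := stab y Ly; exists z.
have [||||t tP] := MR L phi RL LL; first by exists y0.
- by move=> x /phiP[].
- move=> x y Lx Ly; apply: iI; case: LL => _ LD _.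
  by rewrite rmorphD /= !(proj2 (phiP _ _)) ?rmorphD ?mulrDl //; exact: LD.
- move=> x r Lx; apply: iI; case: LL => _ _ LM.
  change (i (phi ((r : R) * x)) = i ((r : R) * phi x)).
  by rewrite rmorphM /= !(proj2 (phiP _ _)) ?rmorphM ?mulrA //; exact: LM.
exists t; apply/eqP; rewrite -subr_eq0.
have [_ [_ [[a ->] [c ->] cU qE]]] := frac (q - i t).
suff a0 : a = 0 by rewrite qE a0 rmorph0 mul0r.
have [r|/eqP|] := @primeR y0 a; [|by rewrite (negbTE y00)|by []].
have Lr : L (y0 * r) by case: RL => _ _; apply.
apply: iI; rewrite rmorphM rmorph0.
apply: (mulIr (x := (i c)^-1)); rewrite ?unitrV // mul0r -mulrA -qE mulrBr.
by rewrite -(proj2 (phiP _ Lr)) tP // rmorphM subrr.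
Qed.

End MaximalOrderCriterion.

Lemma maximal_orderP (R : nzRingType) :
  prime_ring R -> noetherian R -> inner_multipliers R -> inner_multipliers R^c ->
  maximal_order R.
Proof.
move=> primeR noethR MR MRc; split=> //; first exact: prime_semiprime.
move=> Q i iQ [S [[[S1 SB SM] _ _ _] RS [x Sx nx] [a [b [a0 b0 aSb]]]]].
have iI : injective i by case: iQ.
have SD y z : S y -> S z -> S (y + z).
  move=> Sy Sz; rewrite -[z]opprK; apply: (SB) => //; rewrite -sub0r; apply: (SB) => //.
  by rewrite -(subrr 1); exact: SB.
have Si y : S (i y) by apply: RS; exists y.
(* This ideal contains [b] and is stable under left multiplication by each [a s], whence [a S] lies
   in [R]. *)
pose L y := forall s, S s -> in_image i (i a * s * i y).
have LL : left_ideal L.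
  split=> [s Ss|y z Ly Lz s Ss|c y Ly s Ss].
  - by exists 0; rewrite !rmorph0 mulr0.
  - have [t tE] := Ly s Ss; have [t' t'E] := Lz s Ss.
    by exists (t + t'); rewrite !rmorphD mulrDr /= tE t'E.
  - by rewrite rmorphM mulrA -(mulrA (i a)); apply: Ly; exact: SM.
have RL : right_ideal L.
  split=> [||c y Ly s Ss]; [by case: LL|by case: LL|].
  by have [t tE] := Ly s Ss; exists (t * c); rewrite !rmorphM mulrA tE.
have aS s : S s -> in_image i (i a * s).
  move=> Ss; apply: (stable_inner primeR iQ MR LL RL); first by exists b.
  move=> y Ly; have [z zE] := Ly s Ss; exists z; last by rewrite zE.
  move=> s' Ss'; rewrite -zE.
  have -> : i a * s' * (i a * s * i y) = i a * (s' * (i a * s)) * i y.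
    by rewrite !mulrA.
  exact: Ly (SM _ _ Ss' (SM _ _ (Si a) Ss)).
(* By the previous step this ideal contains [a]; it is stable under right multiplication by [S],
   which puts [x] in [R]. *)
pose K y := forall s, S s -> in_image i (i y * s).
have KL : right_ideal K.
  split=> [s Ss|y z Ky Kz s Ss|c y Ky s Ss].
  - by exists 0; rewrite !rmorph0 mul0r.
  - have [t tE] := Ky s Ss; have [t' t'E] := Kz s Ss.
    by exists (t + t'); rewrite !rmorphD mulrDl /= tE t'E.
  - by rewrite rmorphM -mulrA; apply: Ky; exact: SM.
have LK : left_ideal K.
  split=> [||c y Ky s Ss]; [by case: KL|by case: KL|].
  by have [t tE] := Ky s Ss; exists (c * t); rewrite !rmorphM -mulrA tE.
have [t xt] : exists t, x = i t.
  apply: (stable_inner_right primeR iQ MRc LK KL); first by exists a.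
  move=> y Ky; have [z zE] := Ky x Sx; exists z; last by rewrite zE.
  by move=> s Ss; rewrite -zE -mulrA; apply: Ky; exact: SM.
by apply: nx; exists t.
Qed.

(** * Passage from a corner to the ring *)

(* [p] and [w] play the role of a regular sequence of length two inside the
   ideal [T e T]. *)
Record big_corner (R T : nzRingType) (j : R -> T) (p w : T) : Prop := BigCorner {
  cornerD : {morph j : x y / x + y};
  cornerM : {morph j : x y / x * y};
  corner_inj : injective j;
  corner_full : forall x, exists r, j 1 * x * j 1 = j r;
  corner_p : ideal_gen (j 1) p;
  corner_w : ideal_gen (j 1) w;
  corner_normall : forall x, exists y, p * x = y * p;
  corner_normalr : forall x, exists y, x * p = p * y;
  corner_regl : forall x, p * x = 0 -> x = 0;
  corner_regr : forall x, x * p = 0 -> x = 0;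
  corner_modl : forall x y, w * x = p * y -> exists z, x = p * z;
  corner_modr : forall x y, x * w = y * p -> exists z, x = z * p
}.

Lemma ideal_gen_converse (T : pzRingType) (r x : T) :
  ideal_gen r x -> @ideal_gen T^c r x.
Proof.
case=> s ->; exists [seq (t.2, t.1) | t <- s].
rewrite big_map; apply: eq_bigr => t _.
by rewrite -[RHS]/((t.1 : T) * (r * t.2)) mulrA.
Qed.

Lemma big_corner_converse (R T : nzRingType) (j : R -> T) (p w : T) :
  big_corner j p w -> big_corner (j : R^c -> T^c) p w.
Proof.
case=> jD jM jI jF Lp Lw nl nr rl rr ml mr; split=> //.
- by move=> x y; exact: jM.
- by move=> x; have [r rE] := jF x; exists r; rewrite -rE -mulrA.
- exact: ideal_gen_converse.
- exact: ideal_gen_converse.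
Qed.

Section Transfer.
Variables (R T : nzRingType) (j : R -> T) (p w : T).
Hypothesis C : big_corner j p w.
Local Notation e := (j 1).

Lemma corner0 : j 0 = 0.
Proof. by apply: (addrI (j 0)); rewrite -(cornerD C) !addr0. Qed.

Lemma corner_er r : j r * e = j r. Proof. by rewrite -(cornerM C) mulr1. Qed.

(** Such an [x] kills the whole ideal generated by [e], in particular the regular element [p]. *)
Lemma ideal_gen_cancel x : (forall a, x * a * e = 0) -> x = 0.
Proof.
move=> H; apply: (corner_regr C); have [s ->] := corner_p C.
by rewrite mulr_sumr big1 // => t _; rewrite !mulrA H mul0r.
Qed.

Lemma ideal_gen_cancell x : (forall a, e * a * x = 0) -> x = 0.
Proof.
move=> H; apply: (corner_regl C); have [s ->] := corner_p C.
by rewrite mulr_suml big1 // => t _; rewrite -(mulrA t.1 e) -(mulrA t.1) H mulr0.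
Qed.

Lemma corner_neq0 x : x != 0 ->
  exists a b r, r != 0 /\ e * a * x * b * e = j r.
Proof.
move=> x0; apply: contrapT => none; move/eqP: x0; apply.
apply: ideal_gen_cancell => a; apply: ideal_gen_cancel => b.
have [r rE] := corner_full C (a * x * b); rewrite !mulrA in rE.
rewrite rE; have [->|r0] := eqVneq r 0; first exact: corner0.
by case: none; exists a, b, r.
Qed.

Hypothesis domR : forall x y : R, x != 0 -> y != 0 -> x * y != 0.

Lemma corner_prime : prime_ring T.
Proof.
move=> x y xTy; have [->|x0] := eqVneq x 0; first by left.
have [->|y0] := eqVneq y 0; first by right.
have [a [b [r [r0 rE]]]] := corner_neq0 x0.
have [c [d [s [s0 sE]]]] := corner_neq0 y0.
have := domR r0 s0; suff -> : r * s = 0 by rewrite eqxx.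
apply: (corner_inj C); rewrite (cornerM C) -rE -sE corner0.
transitivity (e * a * (x * (b * e * e * c) * y) * d * e); first by rewrite !mulrA.
by rewrite xTy mulr0 !mul0r.
Qed.

Hypothesis MR : inner_multipliers R.

Section Multiplier.
Variables (I : T -> Prop) (phi : T -> T).
Hypotheses (LI : left_ideal I) (RI : right_ideal I).
Hypothesis I_neq0 : exists2 x, I x & x != 0.
Hypothesis phiI : forall x, I x -> I (phi x).
Hypothesis phiD : forall x y, I x -> I y -> phi (x + y) = phi x + phi y.
Hypothesis phiM : forall x r, I x -> phi (x * r) = phi x * r.

Let I0 : I 0. Proof. by case: LI. Qed.
Let ID x y : I x -> I y -> I (x + y). Proof. by case: LI => _ H _; exact: H. Qed.
Let IMl a x : I x -> I (a * x). Proof. by case: LI => _ _ H; exact: H. Qed.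
Let IMr a x : I x -> I (x * a). Proof. by case: RI => _ _ H; exact: H. Qed.

Let phi0 : phi 0 = 0.
Proof. by have := @phiM 0 0 I0; rewrite !mulr0. Qed.

(** Compression to the corner turns [r -> e b phi (a r)] into an endomorphism of the ideal induced
    by [I] on [R], which is nonzero by [corner_neq0]. *)
Lemma corner_multiplier a b :
  exists rho, forall r, I (j r) -> e * b * phi (a * j r) = j rho * j r.
Proof.
have /choice[psi psiP] : forall r, exists s, I (j r) -> e * b * phi (a * j r) = j s.
  move=> r; have [Ir|nIr] := pselect (I (j r)); last by exists 0.
  have [s sE] := corner_full C (b * phi (a * j r)); exists s => _.
  by rewrite -sE -!mulrA -phiM -?mulrA ?corner_er //; exact: IMl.
have [||||||rho rhoP] := MR (I := fun r => I (j r)) (phi := psi).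
- split=> [|x y|x y Iy]; first by rewrite corner0.
    by rewrite (cornerD C); exact: ID.
  by rewrite (cornerM C); exact: IMl.
- split=> [|x y|x y Iy]; first by rewrite corner0.
    by rewrite (cornerD C); exact: ID.
  by rewrite (cornerM C); exact: IMr.
- case: I_neq0 => x Ix /corner_neq0[c [d [r [r0 rE]]]]; exists r => //.
  by rewrite -rE; apply: IMr; apply: IMr; apply: IMl.
- by move=> r Ir; rewrite -psiP //; apply/IMl/phiI/IMl.
- move=> r s Ir Is; apply: (corner_inj C); rewrite (cornerD C) -!psiP //.
    by rewrite -mulrDr -phiD -?mulrDr ?(cornerD C) //; exact: IMl.
  by rewrite (cornerD C); exact: ID.
- move=> r s Ir; apply: (corner_inj C); rewrite (cornerM C) -!psiP //.
    by rewrite (cornerM C) mulrA phiM ?mulrA //; exact: IMl.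
  by rewrite (cornerM C); exact: IMr.
by exists rho => r Ir; rewrite psiP // rhoP // (cornerM C).
Qed.

(** By additivity it is enough to treat [a e b phi (c e d x)]. After right multiplication by any
    [y e] this is computed in the corner, and [ideal_gen_cancel] removes [y e] again. *)
Lemma ideal_gen_multiplier w1 w2 : ideal_gen e w1 -> ideal_gen e w2 ->
  exists t, forall x, I x -> w1 * phi (w2 * x) = t * x.
Proof.
case=> s1 -> [s2 ->]; elim: s1 => [|[a b] s1 [t1 IH1]].
  by exists 0 => x _; rewrite big_nil !mul0r.
suff [t2 tP] : exists t, forall x, I x ->
    a * e * b * phi ((\sum_(t <- s2) t.1 * e * t.2) * x) = t * x.
  by exists (t2 + t1) => x Ix; rewrite big_cons !mulrDl tP // IH1.
elim: s2 {s1 t1 IH1} => [|[c d] s2 [t2 IH2]].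
  by exists 0 => x _; rewrite big_nil !mul0r phi0 mulr0.
suff [t1 tP] : exists t, forall x, I x -> a * e * b * phi (c * e * d * x) = t * x.
  exists (t1 + t2) => x Ix; rewrite big_cons mulrDl phiD; try exact: IMl.
  by rewrite mulrDr tP // IH2 // mulrDl.
have [rho rhoP] := corner_multiplier c b; exists (a * j rho * d) => x Ix.
have -> : a * j rho * d * x = a * (j rho * e * d * x) by rewrite corner_er !mulrA.
have -> : a * e * b * phi (c * e * d * x) = a * (e * b * phi (c * e * d * x)).
  by rewrite !mulrA.
congr (a * _).
apply/eqP; rewrite -subr_eq0; apply/eqP/ideal_gen_cancel => y.
have [r rE] := corner_full C (d * x * y).
have Ir : I (j r) by rewrite -rE; apply: IMr; apply: IMl; apply: IMr; exact: IMl.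
rewrite !mulrBl; apply/eqP; rewrite subr_eq0; apply/eqP.
transitivity (e * b * phi (c * j r)).
  rewrite -(mulrA _ y e) -(mulrA (e * b)) -phiM; last exact: IMl.
  by rewrite -rE !mulrA.
by rewrite rhoP // -rE !mulrA.
Qed.

End Multiplier.

Let pI x y : p * x = p * y -> x = y.
Proof. by move/eqP; rewrite -subr_eq0 -mulrBr => /eqP/(corner_regl C)/eqP; rewrite subr_eq0 => /eqP. Qed.

Let Ip x y : x * p = y * p -> x = y.
Proof. by move/eqP; rewrite -subr_eq0 -mulrBl => /eqP/(corner_regr C)/eqP; rewrite subr_eq0 => /eqP. Qed.

(** Write [t p = p y] and [b p = p c] by normality; the hypothesis becomes [w y = p c], to which
    [corner_modl] applies. *)
Lemma corner_mod w' b t : p * w = w' * p -> p * b = w' * t -> exists z, t = p * z.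
Proof.
move=> wE bE; have [y yE] := corner_normalr C t.
have [c cE] := corner_normalr C b.
have [|z zE] := corner_modl C (x := y) (y := c).
  by apply: pI; rewrite mulrA wE -mulrA -yE mulrA -bE -mulrA cE.
have [z' z'E] := corner_normall C z.
by exists z'; apply: Ip; rewrite yE zE z'E mulrA.
Qed.



End Transfer.

(** The maps [x -> w1 phi (w2 x)] with [w1], [w2] among [p], [w] are multiplications. The regular
    sequence is used once to remove [w1], and once more in the converse ring to remove [w2]. *)
Lemma corner_multipliers (R T : nzRingType) (j : R -> T) (p w : T) :
  big_corner j p w -> (forall x y : R, x != 0 -> y != 0 -> x * y != 0) ->
  inner_multipliers R -> inner_multipliers T.
Proof.
move=> C domR MR I phi LI RI I_neq0 phiI phiD phiM.
have primeT := corner_prime C domR.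
have mult w1 w2 : ideal_gen (j 1) w1 -> ideal_gen (j 1) w2 ->
    exists t, forall x, I x -> w1 * phi (w2 * x) = t * x.
  by move=> L1 L2; apply: (ideal_gen_multiplier C MR LI RI I_neq0 phiI phiD phiM).
have IMl a x : I x -> I (a * x) by case: LI => _ _; apply.
have same s t : (forall x, I x -> s * x = t * x) -> s = t.
  move=> st; case: I_neq0 => x Ix x0; apply/eqP; rewrite -subr_eq0; apply/eqP.
  have [r| //|/eqP] := primeT (s - t) x; last by rewrite (negbTE x0).
  by rewrite -mulrA mulrBl st ?subrr //; exact: IMl.
have pI x y : p * x = p * y -> x = y.
  move/eqP; rewrite -subr_eq0 -mulrBr => /eqP/(corner_regl C)/eqP.
  by rewrite subr_eq0 => /eqP.
have [w' wE] := corner_normall C w.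
have half w2 : ideal_gen (j 1) w2 -> exists t, forall x, I x -> phi (w2 * x) = t * x.
  move=> Lw2; have [tp tpP] := mult _ _ (corner_p C) Lw2.
  have [tw twP] := mult _ _ (corner_w C) Lw2.
  have [|t tE] := corner_mod C (b := tw) (t := tp) wE.
    by apply: same => x Ix; rewrite -!mulrA -twP // -tpP // !mulrA wE.
  by exists t => x Ix; apply: pI; rewrite tpP // tE mulrA.
have [tp tpP] := half _ (corner_p C).
have [tw twP] := half _ (corner_w C).
have [w1 w1E] := corner_normalr C w.
have twE : tw * p = tp * w1.
  by apply: same => x Ix; rewrite -!mulrA -twP ?mulrA ?w1E -?mulrA ?tpP //; exact: IMl.
have [t tE] : exists t : T, tp = t * p.
  exact: (corner_mod (big_corner_converse C) (b := tw) (t := tp) w1E twE).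
exists t => x Ix; have [y yE] := corner_normalr C x.
apply/eqP; rewrite -subr_eq0; apply/eqP/(corner_regr C)/same => c Ic.
(* Normality moves [p] to the left of [x], where the known form of [phi (p * _)] applies. *)
have xE : x * (p * c) = p * (y * c) by rewrite mulrA yE mulrA.
rewrite mul0r -mulrA mulrBl -phiM // xE tpP; last exact: IMl.
by rewrite tE -!(mulrA t) xE subrr.
Qed.

(** * Skew group rings and invariants *)

Section SkewRing.
Variables (k : fieldType) (gT : finGroupType) (A : algType k).
Variable al : alg_action gT A.
Local Notation T := (skew_ring al).
Local Notation R := (invariant_ring al).

Definition skew_const (a : A) : T := skew_single al a 1%g.

Lemma skew_constMl a (f : T) z : (skew_const a * f) z = a * f z.
Proof.
rewrite ffunE (bigD1 1%g) //= big1 ?addr0 => [|x /negbTE x1].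
  by rewrite ffunE eqxx alg_act1 invg1 mul1g.
by rewrite ffunE x1 mul0r.
Qed.

Lemma skew_constMr a (f : T) z : (f * skew_const a) z = f z * al z a.
Proof.
rewrite ffunE (bigD1 z) //= big1 ?addr0 => [|x xz].
  by rewrite ffunE mulVg eqxx.
by rewrite ffunE -eq_mulVg1 (negbTE xz) linear0 mulr0.
Qed.

Lemma al_invr x a : al x (al x^-1%g a) = a.
Proof. by rewrite -alg_actM mulgV alg_act1. Qed.

Lemma skew_left_acc : acc (@left_ideal A) -> acc (@left_ideal T).
Proof.
move=> accA J LJ JS; apply: (acc_finfun accA) => // n.
- by case: (LJ n).
- by move=> f g; case: (LJ n) => _ JD _; exact: JD.
- move=> a f Jf; suff -> : [ffun i => a * f i] = skew_const a * (f : T).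
    by case: (LJ n) => _ _ JM; exact: JM.
  by apply/ffunP => z; rewrite ffunE skew_constMl.
Qed.

Lemma skew_right_acc : acc (@right_ideal A) -> acc (@right_ideal T).
Proof.
move=> accA J RJ JS.
(* Right multiplication by [a] acts on the coefficient at [x] as [al x a]; this twist identifies the
   skew ring with a free right module. *)
pose th (F : {ffun gT -> A^c}) : T := [ffun x => al x (F x : A)].
have [||||N HN] := @acc_finfun A^c gT (fun n F => J n (th F)) accA.
- move=> n; suff -> : th 0 = 0 by case: (RJ n).
  by apply/ffunP => x; rewrite !ffunE linear0.
- move=> n F G JF JG; suff -> : th (F + G) = th F + th G.
    by case: (RJ n) => _ JD _; exact: JD.
  by apply/ffunP => x; rewrite !ffunE linearD.
- move=> n a F JF; suff -> : th [ffun i => a * F i] = th F * skew_const a.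
    by case: (RJ n) => _ _ JM; exact: JM.
  by apply/ffunP => x; rewrite skew_constMr !ffunE rmorphM.
- by move=> n F; exact: JS.
exists N => n f Nn Jf.
suff fE : th [ffun x => al x^-1%g (f x)] = f by have := HN n _ Nn; rewrite -fE; apply; rewrite fE.
by apply/ffunP => x; rewrite !ffunE al_invr.
Qed.

Hypothesis k0 : [pchar k] =i pred0.

Let c : k := #|gT|%:R^-1.

Let cardG_neq0 : #|gT|%:R != 0 :> k.
Proof. by rewrite ((pcharf0P k).1 k0); apply/eqP => /card0_eq/(_ 1%g). Qed.

Definition reynolds_val (a : A) : A := c *: \sum_x al x a.

Lemma reynolds_valP a : reynolds_val a \in invariants al.
Proof.
apply/invariantP => x; rewrite linearZ linear_sum /=; congr (_ *: _).
rewrite [RHS](reindex_inj (mulgI x)) /=.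
by apply: eq_bigr => y _; rewrite alg_actM.
Qed.

Definition reynolds a : R := InvariantRing (reynolds_valP a).

Lemma inv_val_inj : injective (@inv_val k gT A al).
Proof. exact: val_inj. Qed.

Lemma inv_valE (r : R) x : al x (inv_val r) = inv_val r.
Proof. exact: (invariantP _ _ (inv_valP r)). Qed.

Lemma reynoldsD a b : reynolds (a + b) = reynolds a + reynolds b.
Proof.
apply: inv_val_inj; rewrite [RHS]/= /reynolds_val -scalerDr -big_split /=.
by congr (_ *: _); apply: eq_bigr => x _; rewrite linearD.
Qed.

Lemma reynolds0 : reynolds 0 = 0.
Proof.
by apply: (addrI (reynolds 0)); rewrite -reynoldsD !addr0.
Qed.

Lemma reynoldsMr a (r : R) : reynolds (a * inv_val r) = reynolds a * r.
Proof.
apply: inv_val_inj; rewrite [RHS]/= /reynolds_val -scalerAl mulr_suml.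
by congr (_ *: _); apply: eq_bigr => x _; rewrite rmorphM /= inv_valE.
Qed.

Lemma reynoldsMl a (r : R) : reynolds (inv_val r * a) = r * reynolds a.
Proof.
apply: inv_val_inj; rewrite [RHS]/= /reynolds_val -scalerAr mulr_sumr.
by congr (_ *: _); apply: eq_bigr => x _; rewrite rmorphM /= inv_valE.
Qed.

Lemma reynolds_id (r : R) : reynolds (inv_val r) = r.
Proof.
apply: inv_val_inj; rewrite /= /reynolds_val.
under eq_bigr do rewrite inv_valE.
by rewrite sumr_const -scaler_nat scalerA mulVf // scale1r.
Qed.

Lemma invariant_left_acc : acc (@left_ideal A) -> acc (@left_ideal R).
Proof.
apply: (@acc_retract R A (@inv_val k gT A al) reynolds) => //.
- exact: reynoldsD.
- exact: reynolds0.
- exact: reynoldsMr.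
- exact: (reynolds_id 1).
Qed.

Lemma invariant_right_acc : acc (@right_ideal A) -> acc (@right_ideal R).
Proof.
apply: (@acc_retract R^c A^c (@inv_val k gT A al) reynolds).
- by [].
- exact: reynoldsD.
- exact: reynolds0.
- by move=> a r; exact: reynoldsMl.
- exact: (reynolds_id 1).
Qed.

(* [corner r = r e], where [e = corner 1] is the mean of [gT]. *)
Definition corner (r : R) : T := [ffun=> c *: inv_val r].

Lemma corner_morphD : {morph corner : x y / x + y}.
Proof. by move=> x y; apply/ffunP => z; rewrite !ffunE -scalerDr. Qed.

Lemma corner_morphM : {morph corner : x y / x * y}.
Proof.
move=> x y; apply/ffunP => z; rewrite !ffunE.
under eq_bigr do rewrite !ffunE linearZ /= inv_valE -scalerAl -scalerAr.
by rewrite sumr_const -scaler_nat scalerA mulfV // scale1r.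
Qed.

Lemma corner_morph_inj : injective corner.
Proof.
move=> x y /ffunP/(_ 1%g); rewrite !ffunE => /scalerI xy.
by apply: inv_val_inj; apply: xy; rewrite invr_eq0.
Qed.

(** Group elements are absorbed by the mean [e], so [x] may be replaced by the sum of its
    coefficients; and [e a e] is the average of [a] times [e]. *)
Lemma corner_morph_full (x : T) : exists r, corner 1 * x * corner 1 = corner r.
Proof.
exists (reynolds (\sum_z x z)); apply/ffunP => z; rewrite !ffunE.
rewrite /= /reynolds_val scaler_sumr [RHS]scaler_sumr.
under eq_bigr do rewrite !ffunE linearZ /= rmorph1 -scalerAr mulr1.
rewrite -!scaler_sumr; congr (_ *: _); rewrite exchange_big scaler_sumr /=.
apply: eq_bigr => y _; rewrite (reindex_inj (mulgI y)) /=.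
under eq_bigr do rewrite mulKg ffunE -scalerAl mul1r.
by rewrite -scaler_sumr (linear_sum (al y)).
Qed.

Hypothesis domA : forall a b : A, a != 0 -> b != 0 -> a * b != 0.

(** The counterpart in [A] of the conditions of [big_corner]; semi-invariance allows them to be
    checked coefficient by coefficient in the skew ring. *)
Record regular_pair (p w : A) : Prop := RegularPair {
  rp_neq0 : p != 0;
  rp_semip : forall x, exists2 a : k, a != 0 & al x p = a *: p;
  rp_semiw : forall x, exists2 a : k, a != 0 & al x w = a *: w;
  rp_normall : forall a, exists b, p * a = b * p;
  rp_normalr : forall a, exists b, a * p = p * b;
  rp_modl : forall a b, w * a = p * b -> exists d, a = p * d;
  rp_modr : forall a b, a * w = b * p -> exists d, a = d * p
}.

Lemma ffun_choice (P : gT -> A -> Prop) :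
  (forall x, exists a, P x a) -> exists f : T, forall x, P x (f x).
Proof.
by move=> /choice[f fP]; exists [ffun x => f x] => x; rewrite ffunE.
Qed.

Lemma big_corner_skew p w : regular_pair p w ->
  ideal_gen (corner 1) (skew_const p) -> ideal_gen (corner 1) (skew_const w) ->
  big_corner corner (skew_const p) (skew_const w).
Proof.
case=> p0 semip semiw nl nr ml mr Lp Lw; split=> //.
- exact: corner_morphD.
- exact: corner_morphM.
- exact: corner_morph_inj.
- exact: corner_morph_full.
- move=> x; have [y yP] : exists y : T, forall z, p * x z = y z * al z p.
    apply: (@ffun_choice (fun z b => p * x z = b * al z p)) => z.
    have [b bE] := nl (x z); have [a a0 aE] := semip z.
    by exists (a^-1 *: b); rewrite aE -scalerAr -scalerAl scalerA mulfV // scale1r.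
  by exists y; apply/ffunP => z; rewrite skew_constMl skew_constMr.
- move=> x; have [y yP] : exists y : T, forall z, x z * al z p = p * y z.
    apply: (@ffun_choice (fun z b => x z * al z p = p * b)) => z.
    have [b bE] := nr (x z); have [a a0 aE] := semip z.
    by exists (a *: b); rewrite aE -!scalerAr bE.
  by exists y; apply/ffunP => z; rewrite skew_constMl skew_constMr.
- move=> x /ffunP px0; apply/ffunP => z; have := px0 z; rewrite skew_constMl !ffunE.
  by apply: contra_eq => xz; exact: domA.
- move=> x /ffunP px0; apply/ffunP => z; have := px0 z; rewrite skew_constMr !ffunE.
  have [a a0 ->] := semip z; apply: contra_eq => xz.
  by apply: domA; rewrite // scaler_eq0 negb_or a0.
- move=> x y /ffunP xy; have [d dP] : exists d : T, forall z, x z = p * d z.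
    apply: (@ffun_choice (fun z b => x z = p * b)) => z; apply: (ml _ (y z)).
    by have := xy z; rewrite !skew_constMl.
  by exists d; apply/ffunP => z; rewrite skew_constMl.
- move=> x y /ffunP xy; have [d dP] : exists d : T, forall z, x z = d z * al z p.
    apply: (@ffun_choice (fun z b => x z = b * al z p)) => z.
    have [a a0 aE] := semip z; have [b b0 bE] := semiw z.
    have [d dE] : exists d, x z = d * p.
      apply: (mr _ (b^-1 *: (a *: y z))).
      have := xy z; rewrite !skew_constMr aE bE -!scalerAr => xyz.
      by rewrite -!scalerAl -xyz scalerA mulVf // scale1r.
    by exists (a^-1 *: d); rewrite aE -scalerAr -scalerAl scalerA mulfV // scale1r.
  by exists d; apply/ffunP => z; rewrite skew_constMr.
Qed.

Lemma invariant_domain (x y : R) : x != 0 -> y != 0 -> x * y != 0.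
Proof.
rewrite -!(inj_eq inv_val_inj) => x0 y0; exact: domA.
Qed.

Lemma domain_prime (S : nzRingType) :
  (forall x y : S, x != 0 -> y != 0 -> x * y != 0) -> prime_ring S.
Proof.
move=> domS x y /(_ 1); rewrite mulr1.
have [->|x0] := eqVneq x 0; first by left.
have [->|y0] := eqVneq y 0; first by right.
by move=> xy; have := domS _ _ x0 y0; rewrite xy eqxx.
Qed.

Lemma maximal_orders p w :
  acc (@left_ideal A) -> acc (@right_ideal A) -> regular_pair p w ->
  ideal_gen (corner 1) (skew_const p) -> ideal_gen (corner 1) (skew_const w) ->
  inner_multipliers R -> inner_multipliers R^c ->
  maximal_order T /\ maximal_order R.
Proof.
move=> accl accr pw Lp Lw MR MRc; have C := big_corner_skew pw Lp Lw.
have domR := invariant_domain.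
have domRc (x y : R^c) : x != 0 -> y != 0 -> x * y != 0.
  by move=> x0 y0; exact: invariant_domain.
split; apply: maximal_orderP => //.
- exact: corner_prime C domR.
- by split; [exact: skew_left_acc|exact: skew_right_acc].
- exact: corner_multipliers C domR MR.
- exact: corner_multipliers (big_corner_converse C) domRc MRc.
- exact: domain_prime.
- by split; [exact: invariant_left_acc|exact: invariant_right_acc].
Qed.

End SkewRing.

(** * The degree on a plane *)

Section PlaneDegree.
Variables (k : fieldType) (q b : k) (A : algType k) (u v : A).
Hypothesis q0 : q != 0.
Variable coord : plane_coord q b u v.
Local Notation tw := (twist q b).

Lemma coord_surj (F : nat -> {poly k}) :
  (forall n, size (F n) <= n.+1)%N -> (exists N, forall n, (N <= n)%N -> F n = 0) ->
  exists x, forall n, coord n x = F n.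
Proof.
move=> sF [N FN].
have /choice[h hP] : forall n, exists x, homog u v n x /\ coord n x = F n.
  by move=> n; have [x] := coord_homog_surj q0 coord (sF n); exists x.
exists (\sum_(i < N) h i) => n; rewrite linear_sum /=.
have [nN|Nn] := ltnP n N; last first.
  rewrite FN // big1 // => i _; have [hi _] := hP i.
  by apply: (coord_homog coord hi); rewrite gtn_eqF // (leq_trans (ltn_ord i)).
rewrite (bigD1 (Ordinal nN)) //= big1 ?addr0 => [|i ni]; first by have [] := hP n.
by have [hi _] := hP i; apply: (coord_homog coord hi); rewrite eq_sym.
Qed.

Lemma coord_eq x y : (forall n, coord n x = coord n y) -> x = y.
Proof.
move=> xy; apply/eqP; rewrite -subr_eq0; apply/eqP/(coord_inj q0 (coord := coord)) => n.
by rewrite linearB /= xy subrr.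
Qed.

Definition top_le d x := forall n, (d < n)%N -> coord n x = 0.

Lemma top_exists x : x != 0 -> exists d, coord d x != 0 /\ top_le d x.
Proof.
move=> x0; have [N xN] := coord_support coord x.
have exP : exists n, coord n x != 0.
  apply: contrapT => none; move/eqP: x0; apply; apply: (coord_inj q0 (coord := coord)) => n.
  by apply/eqP; apply: contraT => ?; case: none; exists n.
have ubP n : coord n x != 0 -> (n <= N)%N.
  by apply: contraNT; rewrite -ltnNge => /ltnW/xN ->.
case: (ex_maxnP exP ubP) => d d0 dmax; exists d; split=> // n dn.
by apply/eqP; apply: contraLR dn => /dmax; rewrite -leqNgt.
Qed.

(** By [top_exists] the default value is taken only at [x = 0]. *)
Definition top x : nat :=
  if pselect (exists d, coord d x != 0 /\ top_le d x) is left h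
  then projT1 (cid h) else 0.

Lemma topP x : x != 0 -> coord (top x) x != 0 /\ top_le (top x) x.
Proof.
by move=> /top_exists; rewrite /top; case: pselect => // h _; case: (cid h).
Qed.

Lemma top_eq d x : coord d x != 0 -> top_le d x -> top x = d.
Proof.
move=> dx xd; have x0 : x != 0 by apply: contraNneq dx => ->; rewrite linear0.
have [tx xt] := topP x0; apply/eqP; rewrite eqn_leq.
by apply/andP; split; rewrite leqNgt; apply/negP; [move/xd/eqP|move/xt/eqP]; apply/negP.
Qed.

Lemma coordM_top d e x y : top_le d x -> top_le e y ->
  coord (d + e)%N (x * y) = tw e (coord d x) * coord e y.
Proof.
move=> xd ye; rewrite coordM (bigD1 (inord d)) //= inordK ?ltnS ?leq_addr // addKn.
rewrite big1 ?addr0 // => i id; have [di|di] := ltnP d i.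
  by rewrite (xd _ di) linear0 mul0r.
have {}di : (i < d)%N.
  rewrite ltn_neqAle di andbT; apply: contraNneq id => di'.
  by rewrite -val_eqE /= inordK ?di' // ltnS leq_addr.
by rewrite (ye (d + e - i)%N) ?mulr0 //; lia.
Qed.

Lemma top_leM d e x y : top_le d x -> top_le e y -> top_le (d + e) (x * y).
Proof.
move=> xd ye n den; rewrite coordM big1 // => i _; have [di|di] := ltnP d i.
  by rewrite (xd _ di) linear0 mul0r.
by rewrite (ye (n - i)%N) ?mulr0 //; lia.
Qed.

Lemma plane_topM (x y : A) : x != 0 -> y != 0 ->
  coord (top x + top y)%N (x * y) != 0 /\ top (x * y) = (top x + top y)%N.
Proof.
move=> /topP[x0 xd] /topP[y0 ye].
have xy0 : coord (top x + top y)%N (x * y) != 0.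
  by rewrite coordM_top // mulf_neq0 // twist_eq0.
by split=> //; apply: top_eq => //; exact: top_leM.
Qed.

Lemma plane_domain (x y : A) : x != 0 -> y != 0 -> x * y != 0.
Proof.
by move=> x0 y0; have [+ _] := plane_topM x0 y0; apply: contraNneq => ->; rewrite linear0.
Qed.

Definition plane_deg x : nat * nat := (top x, (size (coord (top x) x)).-1).

Lemma plane_degM (x y : A) : x != 0 -> y != 0 ->
  plane_deg (x * y) = ((plane_deg x).1 + (plane_deg y).1,
                       (plane_deg x).2 + (plane_deg y).2)%N.
Proof.
move=> x0 y0; have [_ xyt] := plane_topM x0 y0.
rewrite /plane_deg xyt; congr (_, _); have [cx xd] := topP x0; have [cy ye] := topP y0.
rewrite coordM_top // size_mul ?twist_eq0 // size_twist //=.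
move: cx cy; rewrite -!size_poly_gt0.
by case: (size _) => // m _; case: (size _) => //= n _; rewrite addnS.
Qed.

Lemma plane_deg_cone x : ((plane_deg x).2 <= (plane_deg x).1)%N.
Proof. by have := size_coord q0 coord (top x) x; rewrite /plane_deg /=; lia. Qed.

(** The constant matches the leading coefficients of the top coordinates. If the top index drops, so
    does the code, because the second entry never exceeds the first. *)
Lemma plane_deg_lower (x y : A) : x != 0 -> y != 0 -> plane_deg x = plane_deg y ->
  exists c : k, x - c *: y != 0 ->
    (lex_code (plane_deg (x - c *: y)) < lex_code (plane_deg x))%N.
Proof.
move=> x0 y0 xy; have [txy sxy] : top x = top y /\
    (size (coord (top x) x)).-1 = (size (coord (top y) y)).-1 by case: xy.
have [cx xd] := topP x0; have [cy ye] := topP y0.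
pose c := lead_coef (coord (top x) x) / lead_coef (coord (top x) y).
exists c; have zE n : coord n (x - c *: y) = coord n x - c *: coord n y.
  by rewrite linearB linearZ.
move: (x - c *: y) zE => z zE z0; have [cz zd] := topP z0.
have tz : (top z <= top x)%N.
  rewrite leqNgt; apply/negP => tz; move/eqP: cz; apply.
  by rewrite zE xd // ye -?txy // scaler0 subr0.
have := plane_deg_cone z.
have [tzx|tzx] := ltnP (top z) (top x); first by rewrite /lex_code /plane_deg /=; nia.
have {tzx}tzE : top z = top x by lia.
suff : ((plane_deg z).2 < (plane_deg x).2)%N \/ (size (coord (top x) z) = 0)%N.
  rewrite /lex_code /plane_deg /= -tzE; case; first by lia.
  by move/eqP; rewrite size_poly_eq0 (negbTE cz).
rewrite /plane_deg tzE /=.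
have sz : (size (coord (top x) z) < size (coord (top x) x))%N.
  have cx0 : (0 < size (coord (top x) x))%N by rewrite size_poly_gt0.
  have cy0 : (0 < size (coord (top x) y))%N by rewrite txy size_poly_gt0.
  have sE : size (coord (top x) y) = size (coord (top x) x).
    by move: cx0 cy0 sxy; rewrite -txy; lia.
  rewrite -[X in (_ < X)%N]prednK // ltnS; apply/leq_sizeP => j.
  rewrite leq_eqVlt => /predU1P[<-|lj].
    rewrite zE coefB coefZ -lead_coefE -sE -lead_coefE.
    by rewrite divfK ?subrr // lead_coef_eq0 txy.
  have sj : (size (coord (top x) x) <= j)%N by rewrite -(prednK cx0).
  by rewrite zE coefB coefZ !nth_default ?sE ?mulr0 ?subr0.
by case: (size (coord (top x) z)) sz => [|m]; [right|left; move: sz; case: (size _)].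
Qed.

(** The element is [u^d t^j], which belongs to [A] because [j <= d]. *)
Lemma coord_monomial d j : (j <= d)%N ->
  exists x, forall n, coord n x = if n == d then 'X^j else 0.
Proof.
move=> jd; apply: coord_surj => [n|].
  by case: eqP => [->|_]; rewrite ?size_poly0 // size_polyXn ltnS.
by exists d.+1 => n dn; rewrite gtn_eqF.
Qed.

Lemma plane_deg_monomial d j x :
  (forall n, coord n x = if n == d then 'X^j else 0) -> x != 0 /\ plane_deg x = (d, j).
Proof.
move=> xE; have tx : top x = d.
  apply: top_eq => [|n dn]; rewrite xE ?eqxx ?gtn_eqF //.
  by rewrite -size_poly_gt0 size_polyXn.
split; last by rewrite /plane_deg tx xE eqxx size_polyXn.
have : coord d x != 0 by rewrite xE eqxx -size_poly_gt0 size_polyXn.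
by apply: contraNneq => ->; rewrite linear0.
Qed.


Lemma plane_degree : degree plane_deg.
Proof.
split=> [x y x0 y0|x x0|x y x0 y0 xy|x y x0 y0 le2 le1].
- by split; [exact: plane_domain|exact: plane_degM].
- exact: plane_deg_cone.
- have [c cP] := plane_deg_lower x0 y0 xy; exists c%:A.
  by rewrite mulr_algl; split=> // r; rewrite mulr_algl mulr_algr.
- have cx := plane_deg_cone x; have cy := plane_deg_cone y.
  have [|m mE] := @coord_monomial ((plane_deg x).1 - (plane_deg y).1)
    ((plane_deg x).2 - (plane_deg y).2); first lia.
  have [m0 dm] := plane_deg_monomial mE; exists m => //.
  have [E1 E2] : (plane_deg x).1 = ((plane_deg x).1 - (plane_deg y).1 + (plane_deg y).1)%N
    /\ (plane_deg x).2 = ((plane_deg x).2 - (plane_deg y).2 + (plane_deg y).2)%N by lia.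
  by rewrite dm [LHS]surjective_pairing; congr (_, _); [exact: E1|exact: E2].
Qed.

Lemma plane_left_acc : acc (@left_ideal A).
Proof. exact: degree_acc plane_degree. Qed.

Lemma plane_right_acc : acc (@right_ideal A).
Proof. exact: degree_acc (degree_converse plane_degree). Qed.

Lemma u_neq0 : u != 0.
Proof.
apply: contraTneq (oner_neq0 {poly k}) => u0.
have u1 : u * 1 = 0 by rewrite u0 mul0r.
by rewrite -[1](coord1 coord 0) -coord_uM u1 linear0 eqxx.
Qed.

Lemma coord_unM m n x : coord (n + m)%N (u ^+ m * x) = coord n x.
Proof.
elim: m x => [|m IH] x; first by rewrite addn0 mul1r.
by rewrite addnS exprS -mulrA coord_uM IH.
Qed.

Lemma coord_unM_small m n x : (n < m)%N -> coord n (u ^+ m * x) = 0.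
Proof.
elim: m n x => // m IH [|n] x nm; rewrite exprS -mulrA ?coord0_uM //.
by rewrite coord_uM IH.
Qed.

Lemma coord_vnM m n : exists2 f : {poly k}, size f = m.+1 &
  forall x, coord (n + m)%N (v ^+ m * x) = f * coord n x.
Proof.
elim: m => [|m [f sf fE]].
  by exists 1 => [|x]; rewrite ?size_poly1 // addn0 !mul1r.
exists (tw (n + m) 'X * f) => [|x].
  by rewrite size_mul -?size_poly_gt0 ?size_twist ?size_polyX ?sf.
by rewrite addnS exprS -mulrA coord_vM fE mulrA.
Qed.

Lemma coord_Mv x : coord 0 (x * v) = 0 /\
  forall n, coord n.+1 (x * v) = tw 1 (coord n x) * 'X.
Proof.
elim/(plane_ind coord): x => [c x y [x0 IHx] [y0 IHy]||x [x0 IH]|x [x0 IH]].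
- rewrite mulrDl -scalerAl; split=> [|n]; rewrite [LHS]linearP /= ?x0 ?y0 ?scaler0 ?addr0 //.
  by rewrite IHx IHy [coord n (_ + _)]linearP [tw 1 (_ + _)]linearP mulrDl -scalerAl.
- have E n : coord n v = coord n (v * 1) by rewrite mulr1.
  rewrite mul1r; split=> [|n]; rewrite E ?coord0_vM // coord_vM coord1.
  by case: n => [|n]; rewrite ?rmorph1 ?mulr1 ?mul1r // linear0 mul0r mulr0.
- rewrite -mulrA; split=> [|[|n]]; rewrite ?coord0_uM ?coord_uM ?x0 ?IH //.
  by rewrite linear0 mul0r.
- rewrite -mulrA; split=> [|[|n]]; rewrite ?coord0_vM ?coord_vM ?x0 ?IH //.
    by rewrite mulr0 linear0 mul0r.
  by rewrite rmorphM /= -twistD mulrA.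
Qed.

Lemma coord_Mvn m n x : exists2 f : {poly k}, size f = m.+1 &
  coord (n + m)%N (x * v ^+ m) = tw m (coord n x) * f.
Proof.
elim: m => [|m [f sf fE]].
  by exists 1; rewrite ?size_poly1 // addn0 !mulr1.
exists (tw 1 f * 'X).
  by rewrite size_mul -?size_poly_gt0 ?size_twist ?size_polyX ?sf // addn2.
rewrite addnS exprSr mulrA.
by have [_ ->] := coord_Mv (x * v ^+ m); rewrite fE rmorphM /= -twistD mulrA.
Qed.

Lemma u_normall m x : exists y, u ^+ m * x = y * u ^+ m.
Proof.
have H y : exists z, u * y = z * u.
  elim/(plane_ind coord): y => [c x1 x2 [y1 E1] [y2 E2]||y [z E]|y [z E]].
  - by exists (c *: y1 + y2); rewrite mulrDr mulrDl -scalerAr -scalerAl E1 E2.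
  - by exists 1; rewrite mulr1 mul1r.
  - by exists (u * z); rewrite E mulrA.
  (* The relation gives [(v - b u) u = q u v]. *)
  - exists (q^-1 *: ((v - b *: u) * z)).
    rewrite -scalerAl -mulrA -E [in RHS]mulrA mulrBl -scalerAl (plane_rel coord) expr2.
    by rewrite addrK -scalerAl scalerA mulVf // scale1r mulrA.
elim: m x => [|m IH] x; first by exists x; rewrite mulr1 mul1r.
have [y yE] := IH x; have [z zE] := H y.
by exists z; rewrite exprS -mulrA yE mulrA zE -mulrA -exprS.
Qed.

Lemma u_normalr m x : exists y, x * u ^+ m = u ^+ m * y.
Proof.
have H y : exists z, y * u = u * z.
  elim/(plane_ind coord): y => [c x1 x2 [y1 E1] [y2 E2]||y [z E]|y [z E]].
  - by exists (c *: y1 + y2); rewrite mulrDr mulrDl -scalerAr -scalerAl E1 E2.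
  - by exists 1; rewrite mulr1 mul1r.
  - by exists (u * z); rewrite -mulrA E mulrA.
  - exists ((q *: v + b *: u) * z).
    by rewrite -mulrA E !mulrA (plane_rel coord) mulrDr -!scalerAr expr2.
elim: m x => [|m IH] x; first by exists x; rewrite mulr1 mul1r.
have [y yE] := IH x; have [z zE] := H y.
by exists z; rewrite exprSr mulrA yE -mulrA zE mulrA.
Qed.

(** Division by [u^m] shifts the coordinates down by [m]; the hypothesis keeps the shifted exponents
    in the cone. *)
Lemma div_un m x :
  (forall n, coord n x != 0 -> (size (coord n x) + m <= n.+1)%N) ->
  exists y, x = u ^+ m * y.
Proof.
move=> xm; have [||y yE] := @coord_surj (fun n => coord (n + m)%N x).
- move=> n; have [->|c0] := eqVneq (coord (n + m)%N x) 0; first by rewrite size_poly0.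
  by have := xm _ c0; rewrite -addSn leq_add2r.
- have [N xN] := coord_support coord x; exists N => n Nn; apply: xN.
  exact: leq_trans Nn (leq_addr _ _).
exists y; apply: coord_eq => n; have [nm|mn] := ltnP n m; last first.
  by rewrite -(subnK mn) coord_unM yE.
rewrite coord_unM_small //; apply/eqP; apply: contraT => c0.
by have := xm _ c0; move: c0; rewrite -size_poly_gt0; case: (size _) => // s _; lia.
Qed.

(** Multiplication by [v^m] adds [m] to the degree in [t], while a coordinate of [y] in degree [n]
    has degree at most [n]; the difference is the room that [div_un] asks for. *)
Lemma vn_modl m x y : v ^+ m * x = u ^+ m * y -> exists z, x = u ^+ m * z.
Proof.
move=> xy; apply: div_un => n c0; have [f sf fE] := coord_vnM m n.
have f0 : f != 0 by rewrite -size_poly_gt0 sf.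
have := size_coord q0 coord n y; rewrite -(coord_unM m) -xy fE size_mul // sf.
by rewrite addSn addnC.
Qed.

Lemma vn_modr m x y : x * v ^+ m = y * u ^+ m -> exists z, x = z * u ^+ m.
Proof.
move=> xy; have [y' yE] := u_normalr m y; rewrite yE in xy.
have [|z ->] := @div_un m x; last exact: u_normall.
move=> n c0; have [f sf fE] := coord_Mvn m n x.
have f0 : f != 0 by rewrite -size_poly_gt0 sf.
have := size_coord q0 coord n y'; rewrite -(coord_unM m) -xy fE.
by rewrite size_mul ?twist_eq0 // size_twist // sf addnS.
Qed.

End PlaneDegree.

(** * Diagonal cyclic actions *)

Section Isolate.
Variables (k : fieldType) (gT : finGroupType) (A : algType k).
Variable al : alg_action gT A.
Hypothesis k0 : [pchar k] =i pred0.
Local Notation T := (skew_ring al).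

Lemma al_expg_scale g (x : A) (w : k) i :
  al g x = w *: x -> al (g ^+ i)%g x = w ^+ i *: x.
Proof.
move=> gx; elim: i => [|i IH]; first by rewrite alg_act1 scale1r.
by rewrite expgSr alg_actM gx linearZ /= IH scalerA -exprS.
Qed.

Definition cyclic_mean (g : gT) : T :=
  [ffun z => if z \in <[g]>%g then (#[g]%g%:R^-1 : k)%:A else 0].

(** At [g^i] the right-hand side is [x^(N-1)] times the mean of the powers [w^(i j)], a geometric
    sum that vanishes unless [g^i = 1]. *)
Lemma cyclic_isolate g (x : A) (w : k) :
  (forall i, (w ^+ i == 1) = (#[g]%g %| i)%N) -> al g x = w *: x ->
  skew_const al (x ^+ #[g]%g.-1) =
  \sum_(j < #[g]%g) skew_const al (x ^+ (#[g]%g.-1 - j)) * cyclic_mean g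
     * skew_const al (x ^+ j).
Proof.
set N := #[g]%g => wN gx; have N0 : (0 < N)%N by exact: order_gt0.
have NK : N%:R != 0 :> k by rewrite ((pcharf0P k).1 k0) -lt0n.
apply/ffunP => z; rewrite sum_ffunE ffunE.
under eq_bigr do rewrite skew_constMr skew_constMl ffunE.
case: ifP => [/eqP ->|z1].
  rewrite group1 (eq_bigr (fun=> N%:R^-1 *: x ^+ N.-1)) => [|j _].
    by rewrite sumr_const card_ord -scaler_nat scalerA mulfV // scale1r.
  rewrite alg_act1 -scalerAr mulr1 -scalerAl -exprD subnK //.
  by rewrite -ltnS prednK.
have [/cycleP[i zE]|_] := boolP (z \in <[g]>%g); last first.
  by rewrite big1 // => j _; rewrite mulr0 mul0r.
rewrite (eq_bigr (fun j : 'I_N => (N%:R^-1 * (w ^+ i) ^+ j) *: x ^+ N.-1)) => [|j _].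
  rewrite -scaler_suml -mulr_sumr.
  have wi : w ^+ i - 1 != 0.
    rewrite subr_eq0 wN; apply: contraFN z1; rewrite zE => /dvdnP[m ->].
    by rewrite mulnC expgM expg_order expg1n.
  suff -> : \sum_(j < N) (w ^+ i) ^+ j = 0 by rewrite mulr0 scale0r.
  apply: (mulfI wi); rewrite mulr0 -subrX1 -exprM mulnC exprM.
  by have /eqP -> : w ^+ N == 1 by [rewrite wN]; rewrite expr1n subrr.
rewrite zE rmorphXn /= (al_expg_scale _ gx) exprZn -!scalerAr -!scalerAl mulr1.
by rewrite scalerA mulrC -exprD subnK // -ltnS prednK.
Qed.

End Isolate.

Section DiagonalAction.
Variables (k : fieldType) (q b : k) (A : algType k) (u v : A).
Hypothesis q0 : q != 0.
Variable coord : plane_coord q b u v.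
Variables (gT : finGroupType) (al : alg_action gT A) (g : gT) (w : k) (N : nat).
Hypothesis wN : N.-primitive_root w.
Hypothesis gN : #[g]%g = N.
Hypothesis gu : al g u = w *: u.
Hypothesis gv : al g v = w^-1 *: v.
Hypothesis bw : b = 0 \/ w^-1 = w.
Local Notation tw := (twist q b).

Lemma root_neq0 : w != 0.
Proof.
apply: contraTneq (oner_neq0 k) => w0; have := prim_expr_order wN.
by rewrite w0 expr0n gtn_eqF ?(prim_order_gt0 wN) // => <-; rewrite eqxx.
Qed.

Lemma root_order i : (w ^+ i == 1) = (#[g]%g %| i)%N.
Proof. by rewrite gN (prim_order_dvd wN). Qed.

Lemma rootV_order i : (w^-1 ^+ i == 1) = (#[g]%g %| i)%N.
Proof. by rewrite exprVn invr_eq1 root_order. Qed.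

(** The eigenvalue of [u^d t^j], as [t = u^-1 v] has eigenvalue [w^-2]. *)
Definition weight (d j : nat) : k := w ^+ d * w^-1 ^+ (j + j).

Lemma weightD d j d' j' :
  weight (d + d') (j + j') = weight d j * weight d' j'.
Proof. by rewrite /weight addnACA !exprD mulrACA. Qed.

Lemma twistX n : exists2 c, b = 0 -> c = 0 & tw n 'X = q ^+ n *: 'X + c%:P.
Proof.
elim: n => [|n [c c0 IH]]; first by exists 0; rewrite // scale1r addr0.
exists (q * c + b) => [bE|]; first by rewrite c0 // bE mulr0 addr0.
rewrite twistSX IH scalerDr scalerA -exprS -addrA; congr (_ + _).
by rewrite polyCD polyCM mul_polyC.
Qed.

(** A twist of [t] has a constant term only if [b != 0]; then [w^-1 = w], so [t] has weight one and
    the constant term scales like the linear one. *)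
Lemma coord_diagonal x d j : (coord d (al g x))`_j = weight d j * (coord d x)`_j.
Proof.
elim/(plane_ind coord): x d j => [c x y IHx IHy||x IH|x IH] d j.
- by rewrite !linearP /= !coefD !coefZ IHx IHy mulrDr mulrCA.
- rewrite rmorph1 coord1; case: d => [|d]; last by rewrite coef0 mulr0.
  by rewrite coef1; case: eqP => [->|]; rewrite ?mulr0 // /weight mulr1 mulr1.
- rewrite rmorphM /= gu -scalerAl linearZ /= coefZ.
  case: d => [|d]; first by rewrite !coord0_uM coef0 !mulr0.
  by rewrite !coord_uM IH /weight exprS !mulrA.
- rewrite rmorphM /= gv -scalerAl linearZ /= coefZ.
  case: d => [|d]; first by rewrite !coord0_vM coef0 !mulr0.
  rewrite !coord_vM; have [c c0 ->] := twistX d.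
  rewrite !mulrDl !mul_polyC -!scalerAl !coefD !coefZ !coefXM.
  have w0 := root_neq0; rewrite !mulrDr; congr (_ + _).
    case: j => [|j]; first by rewrite !mulr0.
    have -> : weight d.+1 j.+1 = w^-1 * weight d j.
      by rewrite /weight addSn addnS !exprS -mulrA (mulrCA (w ^+ d)) mulVKf // mulrCA.
    by rewrite /= IH; move: (weight d j) => W; rewrite -!mulrA (mulrCA W).
  case: bw => [/c0 ->|wV]; first by rewrite !mul0r !mulr0.
  have -> : weight d.+1 j = w^-1 * weight d j by rewrite /weight exprS wV mulrA.
  by rewrite /= IH; move: (weight d j) => W; rewrite -!mulrA (mulrCA W).
Qed.

Hypothesis k0 : [pchar k] =i pred0.
Hypothesis gT_cyclic : <[g]>%g = [set: gT].
Local Notation R := (invariant_ring al).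
Local Notation T := (skew_ring al).
Local Notation deg := (plane_deg coord).

Lemma cyclic_invariant x : al g x = x -> x \in invariants al.
Proof.
move=> gx; apply/invariantP => z.
have /cycleP[i ->] : z \in <[g]>%g by rewrite gT_cyclic inE.
by rewrite (al_expg_scale (w := 1)) ?scale1r // expr1n scale1r.
Qed.

Lemma cyclic_semi_invariant (x : A) (a : k) : a != 0 -> al g x = a *: x ->
  forall z, exists2 c : k, c != 0 & al z x = c *: x.
Proof.
move=> a0 gx z; have /cycleP[i ->] : z \in <[g]>%g by rewrite gT_cyclic inE.
by exists (a ^+ i); [rewrite expf_neq0|exact: al_expg_scale].
Qed.

Lemma weight_invariant (r : R) : r != 0 ->
  weight (deg (inv_val r)).1 (deg (inv_val r)).2 = 1.
Proof.
rewrite -(inj_eq (@inv_val_inj _ _ _ al)) => r0.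
have [c0 _] := topP q0 coord r0; set d := top _ _ in c0.
have := coord_diagonal (inv_val r) d (size (coord d (inv_val r))).-1.
rewrite inv_valE -lead_coefE -{1}[lead_coef _]mul1r => /mulIf -> //.
by rewrite lead_coef_eq0.
Qed.

(** For saturation: monomials are eigenvectors, and the one whose exponent is the difference of the
    degrees of two invariants has weight one, hence is invariant. *)
Lemma invariant_degree : degree (fun r : R => deg (inv_val r)).
Proof.
have vI := @inv_val_inj _ _ _ al; have D := plane_degree q0 coord.
have neq0 (r : R) : r != 0 -> inv_val r != 0 by rewrite -(inj_eq vI).
split=> [x y|x /neq0|x y|x y x0 y0 le2 le1].
- rewrite -[x * y == 0](inj_eq vI) => /neq0 x0 /neq0 y0; exact: (degM D x0 y0).
- by move/(deg_cone D).
- move=> /neq0 x0 /neq0 y0 xy; have [c cP] := plane_deg_lower q0 x0 y0 xy.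
  have cI : c%:A \in invariants al by apply/invariantP => z; rewrite linearZ rmorph1.
  exists (InvariantRing cI); split=> [r|].
    by apply: vI; rewrite /= mulr_algl mulr_algr.
  by rewrite -(inj_eq vI) /= mulr_algl; exact: cP.
- have cx := deg_cone D (neq0 _ x0); have cy := deg_cone D (neq0 _ y0).
  set dx := deg (inv_val x) in le2 le1 cx *; set dy := deg (inv_val y) in le2 le1 cy *.
  have [E1 E2] : dx.1 = (dx.1 - dy.1 + dy.1)%N /\ dx.2 = (dx.2 - dy.2 + dy.2)%N by lia.
  have [|m mE] := @coord_monomial _ q b _ u v q0 coord (dx.1 - dy.1) (dx.2 - dy.2); first lia.
  have [m0 dm] := plane_deg_monomial q0 mE.
  have mI : m \in invariants al.
    apply/cyclic_invariant/(coord_eq q0 (coord := coord)) => n; apply/polyP => j.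
    rewrite coord_diagonal mE; case: eqP => [->|_]; last by rewrite coef0 mulr0.
    rewrite coefXn; case: eqP => [->|_]; last by rewrite mulr0.
    have W := weight_invariant x0; rewrite -/dx E1 E2 weightD in W.
    by rewrite mulr1 -W (weight_invariant y0) mulr1.
  exists (InvariantRing mI); first by rewrite -(inj_eq vI).
  change (dx = ((deg m).1 + dy.1, (deg m).2 + dy.2)%N).
  by rewrite dm [LHS]surjective_pairing; congr (_, _); [exact: E1|exact: E2].
Qed.

Lemma invariant_multipliers : inner_multipliers R /\ inner_multipliers R^c.
Proof.
have D := invariant_degree; have domA := plane_domain q0 coord.
have dom (x y : R) : x != 0 -> y != 0 -> x * y != 0 by exact: invariant_domain.
have accl : acc (@left_ideal R) := invariant_left_acc k0 (plane_left_acc q0 coord).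
have accr : acc (@right_ideal R) := invariant_right_acc k0 (plane_right_acc q0 coord).
have domc (x y : R^c) : x != 0 -> y != 0 -> x * y != 0 by move=> x0 y0; exact: dom.
split; first exact: (degree_multipliers D (noetherian_right_ore dom accr)).
exact: (degree_multipliers (degree_converse D) (noetherian_right_ore domc accl)).
Qed.

Lemma cyclic_ideal_gen (x : A) (a : k) :
  (forall i, (a ^+ i == 1) = (#[g]%g %| i)%N) -> al g x = a *: x ->
  ideal_gen (corner (1 : R)) (skew_const al (x ^+ N.-1)).
Proof.
move=> aN gx.
exists [seq (skew_const al (x ^+ (N.-1 - j)), skew_const al (x ^+ j)) | j <- index_iota 0 N].
rewrite -gN (cyclic_isolate k0 aN gx) big_map big_mkord.
apply: eq_bigr => j _; congr (_ * _ * _); apply/ffunP => z; rewrite !ffunE.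
by rewrite gT_cyclic inE /order gT_cyclic cardsT.
Qed.

(** The regular pair is [u^(N-1)], [v^(N-1)]. *)
Lemma cyclic_maximal_orders : maximal_order T /\ maximal_order R.
Proof.
have w0 := root_neq0; have [MR MRc] := invariant_multipliers.
apply: (maximal_orders k0 (plane_domain q0 coord)
  (plane_left_acc q0 coord) (plane_right_acc q0 coord) _
  (cyclic_ideal_gen root_order gu) (cyclic_ideal_gen rootV_order gv) MR MRc).
have semi (x : A) (a : k) : a != 0 -> al g x = a *: x -> forall z,
    exists2 c : k, c != 0 & al z (x ^+ N.-1) = c *: x ^+ N.-1.
  move=> a0 gx; apply: (@cyclic_semi_invariant _ (a ^+ N.-1)); first by rewrite expf_neq0.
  by rewrite rmorphXn /= gx exprZn.
split.
- elim: N.-1 => [|m IH]; first by rewrite expr0 oner_neq0.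
  by rewrite exprS; apply: (plane_domain q0 coord) IH; exact: u_neq0 coord.
- exact: semi gu.
- by apply: semi gv; rewrite invr_eq0.
- exact: u_normall q0 coord _.
- exact: u_normalr coord _.
- exact: vn_modl q0 coord _.
- exact: vn_modr q0 coord _.
Qed.

End DiagonalAction.

(** * The dihedral action on the (-1)-plane *)

(** The ring [k[t]] is completely integrally closed: after removal of the common factor [g], every
    power of [w'] divides the fixed polynomial [g^2 w'], so [w'] is constant. *)
Lemma dvdp_almost_integral (k : fieldType) (w f : {poly k}) :
  w != 0 -> (forall m, w ^+ m %| w * f ^+ m.+1) -> w %| f.
Proof.
move=> w0 wf; pose g := gcdp w f.
have g0 : g != 0 by rewrite gcdp_eq0 negb_and w0.
have [w' wE] := dvdpP _ _ (dvdp_gcdl w f : g %| w).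
have [f' fE] := dvdpP _ _ (dvdp_gcdr w f : g %| f).
have w'0 : w' != 0 by apply: contraNneq w0 => w'0; rewrite wE w'0 mul0r.
have cop : coprimep w' f'.
  have := coprimep_div_gcd (p := w) (q := f); rewrite w0 /= => /(_ isT).
  by rewrite -/g {1}wE {1}fE !mulpK.
suff : size w' = 1%N.
  move/eqP/size_poly1P => [c c0 w'E]; rewrite wE w'E mul_polyC dvdpZl //.
  exact: dvdp_gcdr.
have dvd m : w' ^+ m %| g ^+ 2 * w'.
  have := wf m; rewrite wE fE !exprMn.
  have -> : w' * g * (f' ^+ m.+1 * g ^+ m.+1) = g ^+ 2 * w' * f' ^+ m.+1 * g ^+ m.
    by rewrite (exprS g m); move: (f' ^+ m.+1) (g ^+ m) => F G; ring.
  rewrite dvdp_mul2r ?expf_neq0 // Gauss_dvdpl //.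
  by rewrite coprimep_expl // coprimep_expr.
apply/eqP; rewrite eqn_leq size_poly_gt0 w'0 andbT leqNgt; apply/negP => sw'.
have gw0 : g ^+ 2 * w' != 0 by rewrite mulf_neq0 // expf_neq0.
have := dvdp_leq gw0 (dvd (size (g ^+ 2 * w')%R)).
have := size_exp w' (size (g ^+ 2 * w')).
rewrite -size_poly_gt0 in gw0; move: gw0 sw'.
by case: (size w') => [|[|s]] //=; move: (size _) => S; move: (size _) => S' *; nia.
Qed.

Section SignTwist.
Variables (k : fieldType).
Local Notation tw := (twist (-1 : k) 0).

Lemma sign_twistX e : tw e 'X = (-1) ^+ e *: 'X.
Proof. by have [c c0 ->] := twistX (-1 : k) 0 e; rewrite c0 // polyC0 addr0. Qed.

Lemma coef_sign_twist e f j : (tw e f)`_j = (-1) ^+ (e * j) * f`_j.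
Proof.
elim/poly_ind: f j => [|f c IH] j; first by rewrite linear0 !coef0 mulr0.
rewrite rmorphD rmorphM /= sign_twistX -[c%:P]alg_polyC linearZ /= rmorph1 alg_polyC.
rewrite -scalerAr !coefD coefZ !coefMX !coefC.
case: j => [|j] /=; first by rewrite muln0 mulr0 mul1r.
by rewrite IH mulnS exprD !addr0 mulrA.
Qed.

Lemma sign_twist_odd e f : tw e f = if odd e then tw 1 f else f.
Proof.
apply/polyP => j; rewrite coef_sign_twist -signr_odd oddM.
case: (odd e) => /=; last by rewrite mul1r.
by rewrite coef_sign_twist mul1n -[in RHS]signr_odd.
Qed.

Lemma sign_twistK f : tw 1 (tw 1 f) = f.
Proof. by rewrite -twistD sign_twist_odd. Qed.

End SignTwist.

(** * Central elements of the (-1)-plane *)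

Section MinusOnePlane.
Variables (k : fieldType) (A : algType k) (u v : A).
Variable coord : plane_coord (-1) 0 u v.
Hypothesis two_neq0 : 2%:R != 0 :> k.
Local Notation tw := (twist (-1 : k) 0).

Let q0 : (-1 : k) != 0. Proof. by rewrite oppr_eq0 oner_eq0. Qed.

Definition central (z : A) : Prop := forall a, z * a = a * z.

Lemma skew_vu : v * u = - (u * v).
Proof. by rewrite (plane_rel coord) scale0r addr0 scaleN1r. Qed.

Lemma coord_u n : coord n u = if n is 1 then 1 else 0.
Proof.
have -> : coord n u = coord n (u * 1) by rewrite mulr1.
by case: n => [|[|n]]; rewrite ?coord0_uM ?coord_uM ?coord1.
Qed.

Lemma coord_v n : coord n v = if n is 1 then 'X else 0.
Proof.
have -> : coord n v = coord n (v * 1) by rewrite mulr1.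
by case: n => [|[|n]]; rewrite ?coord0_vM ?coord_vM ?coord1 ?mulr1 ?mulr0.
Qed.

(** Only monomials [u^d t^j] with [d] and [j] even occur, and for them the twists in [coordM] are
    trivial on both sides. *)
Lemma even_central z : (forall d, odd d -> coord d z = 0) ->
  (forall d, tw 1 (coord d z) = coord d z) -> central z.
Proof.
move=> zodd zs a; apply: (coord_eq q0 (coord := coord)) => n.
rewrite !coordM [RHS](reindex_inj rev_ord_inj) /=; apply: eq_bigr => i _.
have i_n : (i <= n)%N by rewrite -ltnS.
rewrite subSS subKn // sign_twist_odd zs if_same.
have [oi|ei] := boolP (odd i); first by rewrite zodd // mul0r mulr0.
by rewrite sign_twist_odd (negbTE ei) mulrC.
Qed.

(** Commuting with [u] makes the top coordinate even in [t]; commuting with [v] then compares [t]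
    with [(-1)^d t]. *)
Lemma central_top z d : central z -> coord d z != 0 -> top_le coord d z ->
  ~~ odd d /\ tw 1 (coord d z) = coord d z.
Proof.
move=> zC z0 zd.
have u_le : top_le coord 1 u by move=> [|[|n]] // _; rewrite coord_u.
have v_le : top_le coord 1 v by move=> [|[|n]] // _; rewrite coord_v.
have sz : tw 1 (coord d z) = coord d z.
  have := coordM_top q0 zd u_le; rewrite coord_u mulr1 => <-.
  by rewrite addn1 zC coord_uM.
split=> //; have := coordM_top q0 zd v_le; rewrite coord_v sz addn1 zC coord_vM mulrC.
move/(mulfI z0); rewrite sign_twistX -signr_odd; case: (odd d) => //.
rewrite expr1 scaleN1r => /eqP; rewrite eq_sym -subr_eq0 opprK -mulr2n -scaler_nat.
by rewrite scaler_eq0 (negbTE two_neq0) -size_poly_eq0 size_polyX.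
Qed.

Lemma even_part x : exists a, central a /\
  forall d j, (coord d a)`_j = if odd d || odd j then 0 else (coord d x)`_j.
Proof.
have [||a aE] := @coord_surj _ (-1) 0 _ u v q0 coord
  (fun d => \poly_(j < d.+1) if odd d || odd j then 0 else (coord d x)`_j).
- by move=> n; exact: size_poly.
- have [N xN] := coord_support coord x; exists N => n Nn; apply/polyP => j.
  by rewrite coef_poly xN // coef0 !if_same.
have aC d j : (coord d a)`_j = if odd d || odd j then 0 else (coord d x)`_j.
  rewrite aE coef_poly ltnS; case: leqP => // dj.
  by rewrite nth_default ?if_same // (leq_trans (size_coord q0 coord d x)).
exists a; split=> //; apply: even_central => d.
  by move=> od; apply/polyP => j; rewrite aC od coef0.
apply/polyP => j; rewrite coef_sign_twist mul1n aC -signr_odd.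
by case: (odd j); rewrite ?orbT ?mulr0 // mul1r.
Qed.

(** Here [y] behaves like a quaternion of trace zero. Exchanging [i] and [n - i] in the product
    formula negates a term when [n] is odd, and applies [tw 1] to it when [n] is even. *)
Lemma odd_square_central y :
  (forall d j, ~~ odd d -> ~~ odd j -> (coord d y)`_j = 0) -> central (y * y).
Proof.
move=> yodd.
have ys d : ~~ odd d -> tw 1 (coord d y) = - coord d y.
  move=> ed; apply/polyP => j; rewrite coef_sign_twist mul1n coefN -signr_odd.
  by case: (boolP (odd j)) => oj; rewrite ?mulN1r // yodd // mulr0 oppr0.
pose t n (i : nat) := tw (n - i) (coord i y) * coord (n - i)%N y.
have sumE n : \sum_(i < n.+1) t n i = \sum_(i < n.+1) t n (n - i)%N.
  rewrite (reindex_inj rev_ord_inj) /=; apply: eq_bigr => i _.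
  by rewrite subSS.
have sqE n : coord n (y * y) = \sum_(i < n.+1) t n i by rewrite coordM.
have odd0 n : odd n -> coord n (y * y) = 0.
  move=> on; rewrite sqE.
  apply/eqP; suff : \sum_(i < n.+1) t n i = - \sum_(i < n.+1) t n i.
    move/eqP; rewrite -subr_eq0 opprK -mulr2n -scaler_nat scaler_eq0.
    by rewrite (negbTE two_neq0).
  rewrite {2}sumE -sumrN; apply: eq_bigr => i _; have i_n : (i <= n)%N by rewrite -ltnS.
  rewrite /t subKn // [tw (n - i) _]sign_twist_odd [tw i _]sign_twist_odd oddB // on.
  by case: (boolP (odd i)) => oi /=; rewrite ys ?oddB ?on ?oi // ?mulNr ?opprK mulrC.
apply: even_central => // n; have [/odd0 ->|en] := boolP (odd n); first by rewrite linear0.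
rewrite sqE linear_sum [RHS]sumE; apply: eq_bigr => i _ /=.
have i_n : (i <= n)%N by rewrite -ltnS.
rewrite /t subKn // rmorphM /= [tw (n - i) _]sign_twist_odd [tw i _]sign_twist_odd oddB //.
rewrite (negbTE en) /=; case: ifP => oi; first by rewrite sign_twistK mulrC.
by rewrite !ys ?oddB ?(negbTE en) ?oi // mulrNN mulrC.
Qed.

(* If [x = a + y] with [a] the even part, then [2 a - x = a - y] is the quaternionic
   conjugate of [x], so the product is the reduced norm [a^2 - y^2]. *)
Lemma central_multiple x : x != 0 -> exists a, central a /\
  (forall d j, (coord d a)`_j = if odd d || odd j then 0 else (coord d x)`_j) /\
  (x * (2%:R *: a - x) != 0 /\ central (x * (2%:R *: a - x)) \/ central x).
Proof.
move=> x0; have [a [aC aE]] := even_part x; exists a; split=> //; split=> //.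
have [d0|d0] := eqVneq (2%:R *: a - x) 0.
  right=> c; have /eqP := d0; rewrite subr_eq0 => /eqP <-.
  by rewrite -scalerAl -scalerAr aC.
left; split; first exact: (plane_domain q0 coord).
pose y := x - a; have yC : central (y * y).
  apply: odd_square_central => d j /negbTE od /negbTE oj.
  by rewrite linearB coefB aE od oj subrr.
have -> : x * (2%:R *: a - x) = a * a - y * y.
  rewrite /y [LHS]mulrBr scaler_nat mulr2n mulrDr [in RHS]mulrBr !mulrBl (aC x).
  by rewrite !opprB addrA [a * a + _]addrCA subrr addr0 addrA.
move=> c; rewrite [LHS]mulrBl [RHS]mulrBr yC; congr (_ - _).
by rewrite -mulrA (aC c) mulrA (aC c) mulrA.
Qed.

End MinusOnePlane.

Section DihedralAction.
Variables (k : fieldType) (A : algType k) (u v : A).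
Variable coord : plane_coord (-1) 0 u v.
Hypothesis k0 : [pchar k] =i pred0.
Local Notation tw := (twist (-1 : k) 0).
Variables (gT : finGroupType) (al : alg_action gT A) (g h : gT) (w : k) (n : nat).
Hypothesis n0 : (0 < n)%N.
Hypothesis wn : n.-primitive_root w.
Hypothesis gn : #[g]%g = n.
Hypothesis hg : h \notin <[g]>%g.
Hypothesis cardG : #|gT| = n.*2.
Hypothesis gu : al g u = w *: u.
Hypothesis gv : al g v = w^-1 *: v.
Hypothesis hu : al h u = v.
Hypothesis hv : al h v = u.
Local Notation R := (invariant_ring al).

Let q0 : (-1 : k) != 0. Proof. by rewrite oppr_eq0 oner_eq0. Qed.

Let two_neq0 : 2%:R != 0 :> k. Proof. by rewrite ((pcharf0P k).1 k0). Qed.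

Lemma dihedral_cover : [set: gT] = <[g]>%g :|: (<[g]> :* h)%g.
Proof.
apply/esym/eqP; rewrite eqEcard subsetT cardsT cardG cardsU card_rcoset.
suff -> : <[g]>%g :&: (<[g]> :* h)%g = set0.
  by rewrite cards0 subn0 [#|<[g]>%g|]gn addnn leqnn.
apply/setP => x; rewrite !inE; apply/negP => /andP[xg]; rewrite mem_rcoset => xh.
by move/negP: hg; apply; rewrite -groupV -[(h^-1)%g](mulKg x) groupM ?groupV.
Qed.

Lemma dihedral_cases z : exists i, z = (g ^+ i)%g \/ z = (g ^+ i * h)%g.
Proof.
have : z \in [set: gT] by rewrite inE.
rewrite dihedral_cover inE => /orP[/cycleP[i ->]|]; first by exists i; left.
by case/rcosetP => y /cycleP[i ->] ->; exists i; right.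
Qed.

Lemma dihedral_ind (P : A -> Prop) x : P x ->
  (forall y, P y -> P (al g y)) -> (forall y, P y -> P (al h y)) ->
  forall z, P (al z x).
Proof.
move=> Px Pg Ph z.
have Pgi i y : P y -> P (al (g ^+ i)%g y).
  by move=> Py; elim: i => [|i IH]; rewrite ?alg_act1 // expgS alg_actM; exact: Pg.
have [i [->|->]] := dihedral_cases z; first exact: Pgi.
by rewrite alg_actM; apply/Pgi/Ph.
Qed.

Lemma dihedral_invariant x : al g x = x -> al h x = x -> x \in invariants al.
Proof.
move=> gx hx; apply/invariantP => z.
by apply: (dihedral_ind (P := fun y => y = x)) => // y ->.
Qed.

(** The sign in [v^d = swap_sign d u^d t^d]; up to it, exchanging [u] and [v] sends [u^d t^j] to
    [u^d t^(d-j)]. *)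
Definition swap_sign (d : nat) : k := \prod_(i < d) (-1) ^+ i.

Lemma coord_swap x d j : (coord d (al h x))`_j =
  if (j <= d)%N then swap_sign d * (coord d x)`_(d - j) else 0.
Proof.
have sS d' : swap_sign d'.+1 = (-1) ^+ d' * swap_sign d'.
  by rewrite /swap_sign big_ord_recr mulrC.
elim/(plane_ind coord): x d j => [c x y IHx IHy||x IH|x IH] d j.
- rewrite !linearP /= !coefD !coefZ IHx IHy; case: ifP => _.
    by rewrite mulrDr mulrCA.
  by rewrite mulr0 addr0.
- rewrite rmorph1 coord1; case: d => [|d]; last by rewrite !coef0 mulr0 if_same.
  by rewrite /swap_sign big_ord0 mul1r !coef1; case: j.
- rewrite rmorphM /= hu; case: d => [|d].
    by rewrite coord0_vM coord0_uM !coef0 mulr0 if_same.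
  rewrite coord_vM coord_uM sign_twistX -scalerAl coefZ coefXM sS.
  case: j => [|j] /=.
    by rewrite mulr0 subn0 [_`_d.+1]nth_default ?mulr0 ?size_coord.
  by rewrite IH ltnS subSS; case: ifP => _; rewrite ?mulr0 // mulrA.
- rewrite rmorphM /= hv; case: d => [|d].
    by rewrite coord0_vM coord0_uM !coef0 mulr0 if_same.
  rewrite coord_vM coord_uM sign_twistX -scalerAl coefZ coefXM sS IH.
  have [jd|dj] := leqP j d; last first.
    case: leqP => // jd; have -> : j = d.+1 by lia.
    by rewrite subnn !mulr0.
  rewrite leqW // subSn //= mulrACA -exprD addnn.
  by rewrite -signr_odd odd_double mul1r.
Qed.

Lemma coord_g x d j : (coord d (al g x))`_j = weight w d j * (coord d x)`_j.
Proof. exact: (coord_diagonal coord wn gu gv (or_introl erefl)). Qed.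

Lemma action_homogeneous d x : coord d x = 0 -> forall z, coord d (al z x) = 0.
Proof.
move=> x0; apply: (dihedral_ind (P := fun y => coord d y = 0)) => // y y0; apply/polyP => j.
  by rewrite coord_g y0 coef0 mulr0.
by rewrite coord_swap y0 !coef0 mulr0 if_same.
Qed.

Lemma even_part_invariant x a : (forall d j, (coord d a)`_j =
    if odd d || odd j then 0 else (coord d x)`_j) ->
  x \in invariants al -> a \in invariants al.
Proof.
move=> aE /invariantP xI.
apply: dihedral_invariant; apply: (coord_eq q0 (coord := coord)) => d; apply/polyP => j.
  rewrite coord_g !aE; case: ifP => _; first by rewrite mulr0.
  by rewrite -coord_g xI.
rewrite coord_swap !aE -[in RHS](xI h) coord_swap.
case: leqP => [jd|_]; last by rewrite if_same.
by rewrite oddB //; case: (odd d); case: (odd j); rewrite /= ?mulr0.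
Qed.

Lemma invariant_central_multiple x : x != 0 -> x \in invariants al ->
  exists y, [/\ y \in invariants al, x * y != 0 & central (x * y)].
Proof.
move=> x0 xI; have [a [aC [aE]]] := central_multiple coord two_neq0 x0.
have /invariantP aI := even_part_invariant aE xI.
case=> [[xy0 xyC]|xC]; last first.
  by exists 1; rewrite mulr1; split=> //; apply/invariantP => z; rewrite rmorph1.
exists (2%:R *: a - x); split=> //; apply/invariantP => z.
by rewrite linearB linearZ /= aI (invariantP _ _ xI).
Qed.

Local Notation top_le := (top_le coord).

Lemma top_le_pow d x m : ~~ odd d -> top_le d x ->
  top_le (d * m) (x ^+ m) /\ coord (d * m)%N (x ^+ m) = coord d x ^+ m.
Proof.
move=> ed xd; elim: m => [|m [IH1 IH2]].
  by rewrite muln0 !expr0; split=> [[|i] // _|]; rewrite coord1.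
rewrite mulnS addnC exprSr; split; first exact: top_leM.
by rewrite coordM_top // IH2 sign_twist_odd (negbTE ed) exprSr.
Qed.

(** Comparing top coordinates gives [W^m] dividing [W f^(m+1)], where [W = coord e z] and
    [f = coord d b]. No twist survives, since [d] is even and [W] is even in [t]. *)
Lemma top_dvd (z b : A) e d : z != 0 -> central z -> coord e z != 0 -> top_le e z ->
  ~~ odd d -> top_le d b -> (forall m, exists y, z * b ^+ m.+1 = z ^+ m * y) ->
  coord e z %| coord d b.
Proof.
move=> z0 zC cz ze ed bd zb; have [ee sz] := central_top two_neq0 zC cz ze.
have [->|cb] := eqVneq (coord d b) 0; first exact: dvdp0.
apply: dvdp_almost_integral => // m; have [y yE] := zb m.
have [bm_le bm] := top_le_pow m.+1 ed bd; have [zm_le zm] := top_le_pow m ee ze.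
have L_le : top_le (e + d * m.+1) (z * b ^+ m.+1) by exact: top_leM.
have LE : coord (e + d * m.+1)%N (z * b ^+ m.+1) = coord e z * coord d b ^+ m.+1.
  by rewrite coordM_top // bm sign_twist_odd oddM (negbTE ed) /=.
have L0 : coord (e + d * m.+1)%N (z * b ^+ m.+1) != 0 by rewrite LE mulf_neq0 // expf_neq0.
have y0 : y != 0 by apply: contraNneq L0 => y0; rewrite yE y0 mulr0 linear0.
have [cy yt] := topP q0 coord y0.
have RE : coord (e * m + top coord y)%N (z ^+ m * y) = coord e z ^+ m * coord (top coord y) y.
  by rewrite coordM_top // zm sign_twist_odd rmorphXn /= sz if_same.
have := top_eq q0 L0 L_le; rewrite yE (@top_eq _ _ _ _ _ _ q0 coord (e * m + top coord y)) //.
- by move=> tE; rewrite -LE -tE yE RE dvdp_mulr.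
- by rewrite RE mulf_neq0 // expf_neq0.
- exact: top_leM.
Qed.

Lemma top_leX d x m : top_le d x -> top_le (d * m) (x ^+ m).
Proof.
move=> xd; elim: m => [|m IH]; first by move=> [|i] // _; rewrite expr0 coord1.
by rewrite mulnS addnC exprSr; exact: top_leM.
Qed.

Lemma top_leD d x y : top_le d x -> top_le d y -> top_le d (x + y).
Proof. by move=> xd yd i di; rewrite linearD /= xd // yd // addr0. Qed.

Lemma top_le_u : top_le 1 u. Proof. by move=> [|[|i]] // _; rewrite (coord_u coord). Qed.
Lemma top_le_v : top_le 1 v. Proof. by move=> [|[|i]] // _; rewrite (coord_v coord). Qed.

Definition power_sign (i m : nat) : k := \prod_(l < m) (-1) ^+ (i + l).

Lemma coord_vn i m x :
  coord (i + m)%N (v ^+ m * x) = power_sign i m *: ('X^m * coord i x).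
Proof.
rewrite /power_sign; elim: m x => [|m IH] x; first by rewrite addn0 !mul1r big_ord0 scale1r.
rewrite addnS exprS -mulrA coord_vM IH sign_twistX big_ord_recr /=.
by rewrite -scalerAl -scalerAr scalerA mulrC exprS mulrA.
Qed.

Lemma power_sign1S m : power_sign 1 m.+1 = - power_sign 0 m.
Proof.
have -> : power_sign 1 m.+1 = power_sign 0 m.+2.
  by rewrite /power_sign [RHS]big_ord_recl mul1r.
rewrite /power_sign !big_ord_recr /= -mulrA -exprD !add0n addnS addnn exprS.
by rewrite -signr_odd odd_double mulr1 mulrN1.
Qed.

(** The two polynomials generate the unit ideal: [t] times the first plus the second is [2 t], and
    the first is [1] modulo [t]. *)
Lemma odd_coprime_dvd (f W : {poly k}) (c : k) :
  W %| f * (1 + c *: 'X^n) -> W %| f * ('X - c *: 'X^(n.+1)) -> W %| f.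
Proof.
move=> W1 W2; have W3 : W %| f * 'X.
  rewrite -(dvdpZr _ _ two_neq0) scaler_nat.
  have -> : f * 'X *+ 2 = f * (1 + c *: 'X^n) * 'X + f * ('X - c *: 'X^(n.+1)).
    rewrite exprSr -!mul_polyC; move: (c%:P) ('X^n) => C Y; ring.
  by rewrite dvdp_add // dvdp_mulr.
have -> : f = f * (1 + c *: 'X^n) - f * 'X * (c *: 'X^(n.-1)).
  rewrite -[in X in X - _](prednK n0) exprSr -!mul_polyC.
  by move: (c%:P) ('X^(n.-1)) => C Y; ring.
by rewrite dvdp_sub // dvdp_mulr.
Qed.

Lemma coord_invariant_swap (a : R) d j : (j <= d)%N ->
  (coord d (inv_val a))`_j != 0 -> (coord d (inv_val a))`_(d - j) != 0.
Proof.
by move=> jd; rewrite -{1}(inv_valE a h) coord_swap jd mulf_eq0 negb_or => /andP[].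
Qed.

(** The symmetry reverses coordinates, so [f] and [W] vanish at [t = 0] to the orders [d - deg f]
    and [e - deg W]. Since [W] divides [f], the latter is at most the former. *)
Lemma invariant_quotient_size (z a : R) e d s : coord e (inv_val z) != 0 ->
  coord d (inv_val a) != 0 -> coord d (inv_val a) = s * coord e (inv_val z) ->
  (e + (size s).-1 <= d)%N.
Proof.
set W := coord e _; set f := coord d _ => W0 f0 fE.
have s0 : s != 0 by apply: contraNneq f0 => s0; rewrite fE s0 mul0r.
have sW : (size W <= e.+1)%N := size_coord q0 coord e _.
have sf : (size f <= d.+1)%N := size_coord q0 coord d _.
have sfE : (size f).-1 = ((size s).-1 + (size W).-1)%N.
  rewrite fE size_mul //; move: W0 s0; rewrite -!size_poly_gt0.
  by case: (size _) => // i _; case: (size _) => // j _; rewrite addSn addnS.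
have dD : ((size f).-1 <= d)%N by case: (size f) sf.
have eE : ((size W).-1 <= e)%N by case: (size W) sW.
have := coord_invariant_swap (a := a) dD; rewrite -/f -lead_coefE lead_coef_eq0 => /(_ f0) fd.
suff : (e - (size W).-1 <= d - (size f).-1)%N by lia.
rewrite leqNgt; apply/negP; move: (d - _)%N fd => K fK lt; move/eqP: fK; apply.
rewrite fE coefM big1 // => i _; have [->|Wi] := eqVneq W`_(K - i)%N 0.
  by rewrite mulr0.
have ie : (K - i <= e)%N by lia.
move: (coord_invariant_swap ie Wi); rewrite nth_default ?eqxx // -/W.
by move: lt eE; case: (size W) => // j; lia.
Qed.

Lemma reynolds_vanish d x : coord d x = 0 -> coord d (inv_val (reynolds al x)) = 0.
Proof.
move=> x0; rewrite /= /reynolds_val linearZ linear_sum /= big1 ?scaler0 // => y _.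
exact: action_homogeneous.
Qed.

(** * Divisibility of almost integral invariants by a central one *)

Section AlmostIntegral.
Variables (P : R -> Prop) (z : R).
Hypothesis z0 : z != 0.
Hypothesis zC : central (inv_val z).
Hypothesis PB : forall a t : R, P a -> P (a - z * t).
Hypothesis PX : forall (a r : R) m, P a -> exists y : R, z * (a * r) ^+ m.+1 = z ^+ m * y.

Let e := top coord (inv_val z).
Let W := coord e (inv_val z).

Let z0' : inv_val z != 0.
Proof. by rewrite -[0]/(inv_val (0 : R)) (inj_eq (@inv_val_inj _ _ _ al)). Qed.

Let W0 : W != 0. Proof. by have [] := topP q0 coord z0'. Qed.
Let ze : top_le e (inv_val z). Proof. by have [] := topP q0 coord z0'. Qed.

Let ee : ~~ odd e. Proof. by have [] := central_top two_neq0 zC W0 ze. Qed.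
Let sW : tw 1 W = W. Proof. by have [] := central_top two_neq0 zC W0 ze. Qed.

Lemma inv_valX (a : R) m : inv_val (a ^+ m) = inv_val a ^+ m.
Proof. by elim: m => // m IH; rewrite !exprS -IH. Qed.

Lemma almost_integral_dvd_mul (a r : R) d l : P a -> ~~ odd (d + l) ->
  top_le d (inv_val a) -> top_le l (inv_val r) ->
  W %| tw l (coord d (inv_val a)) * coord l (inv_val r).
Proof.
move=> Pa odl ad rl; rewrite -(coordM_top q0 ad rl).
apply: (top_dvd z0' zC W0 ze odl); first exact: top_leM.
move=> m; have [y yE] := PX r m Pa; exists (inv_val y).
by have := congr1 (@inv_val _ _ _ al) yE; rewrite /= inv_valX inv_valX.
Qed.

Lemma gen1_invariant : u ^+ n + v ^+ n \in invariants al.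
Proof.
have w0 := root_neq0 wn; apply: dihedral_invariant.
  rewrite linearD !rmorphXn /= gu gv !exprZn exprVn (prim_expr_order wn).
  by rewrite invr1 !scale1r.
by rewrite linearD !rmorphXn /= hu hv addrC.
Qed.

Lemma gen2_invariant : u ^+ n.+1 * v + v ^+ n.+1 * u \in invariants al.
Proof.
have w0 := root_neq0 wn; apply: dihedral_invariant.
  rewrite linearD !rmorphM !rmorphXn /= gu gv !exprZn exprVn.
  rewrite -!scalerAl -!scalerAr !scalerA exprS (prim_expr_order wn) mulr1.
  by rewrite mulfV // mulVf // !scale1r.
by rewrite linearD !rmorphM !rmorphXn /= hu hv addrC.
Qed.

(** For even [n], weight one means [w^d = w^(2j)]; raising to the power [n/2] gives [w^(d n/2) = 1],
    which forces [d] to be even. *)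
Lemma odd_degree d (a : R) : coord d (inv_val a) != 0 -> odd d -> odd n.
Proof.
move=> a0 od; apply/negPn/negP => en; move/eqP: a0; apply; apply/polyP => j.
rewrite coef0; apply/eqP; apply: contraT => aj.
have : weight w d j = 1.
  by apply: (mulIf aj); rewrite mul1r -coord_g inv_valE.
rewrite /weight exprVn => /(congr1 ( *%R^~ (w ^+ (j + j)))).
rewrite mulfVK ?expf_neq0 ?(root_neq0 wn) // mul1r => wE.
have n2 : n = (n./2).*2 by rewrite even_halfK.
have : w ^+ (d * n./2) == 1.
  rewrite exprM wE -exprM addnn -doubleMl mulnC doubleMl -n2 exprM.
  by rewrite (prim_expr_order wn) expr1n.
rewrite -(prim_order_dvd wn) => /dvdnP[c cE].
have n20 : (0 < n./2)%N by lia.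
have : (d * n./2 = c.*2 * n./2)%N by rewrite cE [in LHS]n2 -doubleMr doubleMl.
move/eqP; rewrite eqn_pmul2r // => /eqP dE; move: od.
by rewrite dE odd_double.
Qed.

Lemma coord_gen1 : coord n (u ^+ n + v ^+ n) = 1 + power_sign 0 n *: 'X^n.
Proof.
have := coord_unM coord n 0 1; have := coord_vn 0 n 1.
by rewrite !add0n !mulr1 coord1 mulr1 linearD /= => -> ->.
Qed.

Lemma coord_gen2 : coord n.+2 (u ^+ n.+1 * v + v ^+ n.+1 * u) =
  'X - power_sign 0 n *: 'X^(n.+1).
Proof.
have := coord_unM coord n.+1 1 v; have := coord_vn 1 n.+1 u.
rewrite add1n (coord_u coord) (coord_v coord) mulr1 power_sign1S linearD /= => -> ->.
by rewrite scaleNr.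
Qed.

Lemma sign_twist_odd_eq l f : odd l -> tw l f = tw 1 f.
Proof. by move=> ol; rewrite sign_twist_odd ol. Qed.

(** For odd [d], [n] is odd too, and multiplying by invariants of degrees [n] and [n + 2] restores
    an even degree. The coordinates of these two are coprime and can be cancelled. *)
Lemma almost_integral_dvd (a : R) d : P a -> top_le d (inv_val a) ->
  W %| coord d (inv_val a).
Proof.
move=> Pa ad; have [->|a0] := eqVneq (coord d (inv_val a)) 0; first exact: dvdp0.
have [od|ed] := boolP (odd d); last first.
  have := @almost_integral_dvd_mul a 1 d 0 Pa; rewrite addn0 => /(_ ed ad).
  by rewrite coord1 mulr1; apply => -[|i] //= _; rewrite coord1.
have on := odd_degree a0 od.
(* An odd multiplier twists the coordinate of [a]; this can be undone because [tw 1] fixes [W]. *)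
suff /dvdpP[s sE] : W %| tw 1 (coord d (inv_val a)).
  by rewrite -(sign_twistK (coord d _)) sE rmorphM /= sW dvdp_mull.
have un_le m : top_le m (u ^+ m) by rewrite -[X in top_le X]mul1n; exact: top_leX top_le_u.
have vn_le m : top_le m (v ^+ m) by rewrite -[X in top_le X]mul1n; exact: top_leX top_le_v.
apply: (@odd_coprime_dvd _ _ (power_sign 0 n)).
  rewrite -coord_gen1 -[in X in X * _](sign_twist_odd_eq _ on).
  apply: (@almost_integral_dvd_mul a (InvariantRing gen1_invariant)) => //=.
    by rewrite oddD od on.
  exact: top_leD.
rewrite -coord_gen2 -[in X in X * _](@sign_twist_odd_eq n.+2 _); last by rewrite /= on.
apply: (@almost_integral_dvd_mul a (InvariantRing gen2_invariant)) => //=.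
  by rewrite oddD od /= on.
rewrite -[n.+2]addn1; apply: top_leD.
  exact: (top_leM q0 (un_le n.+1) top_le_v).
exact: (top_leM q0 (vn_le n.+1) top_le_u).
Qed.

(** The quotient of top coordinates is lifted to [t0]; averaging [t0] preserves the cancellation, as
    [z] is invariant and the group acts degree by degree. An abstract [P] serves both right and left
    endomorphisms. *)
Lemma almost_integral_multiple (a : R) : P a -> exists t, a = z * t.
Proof.
have [D] : exists D, forall i, (D <= i)%N -> coord i (inv_val a) = 0.
  exact: coord_support.
elim: D a => [|D IH] a aD Pa.
  exists 0; apply: (@inv_val_inj _ _ _ al); rewrite mulr0.
  by apply: (coord_inj q0 (coord := coord)) => i; exact: aD.
have /dvdpP[s sE] := almost_integral_dvd Pa aD.
have [f0|f0] := eqVneq (coord D (inv_val a)) 0.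
  apply: IH => // i; rewrite leq_eqVlt => /predU1P[<- //|]; exact: aD.
have sz := invariant_quotient_size W0 f0 sE.
have [||t0 tE] := @coord_surj _ (-1) 0 _ u v q0 coord
  (fun i => if i == (D - e)%N then - s else 0).
- move=> i; case: eqP => [->|_]; last by rewrite size_poly0.
  by rewrite size_polyN; move: sz; case: (size s) => // j /=; lia.
- by exists (D - e).+1 => i Di; rewrite gtn_eqF.
have t_le : top_le (D - e) t0 by move=> i Di; rewrite tE gtn_eqF.
pose t := reynolds al t0.
have [|t' t'E] := IH (a - z * - t) _ (PB _ Pa); last first.
  by exists (t' - t); rewrite mulrBr -t'E mulrN opprK -addrA addrN addr0.
have -> : a - z * - t = reynolds al (inv_val a + inv_val z * t0).
  by rewrite reynoldsD reynolds_id // reynoldsMl mulrN opprK.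
move=> i Di; apply: reynolds_vanish; rewrite linearD /=.
have eD : (e + (D - e) = D)%N by lia.
have [->|iD] := eqVneq i D.
  rewrite -[X in coord X (_ * _)]eD (coordM_top q0 ze t_le) tE eqxx.
  by rewrite sign_twist_odd -/W sW if_same sE mulrN mulrC addrN.
have Di' : (D < i)%N by rewrite ltn_neqAle eq_sym iD.
by rewrite aD // (top_leM q0 ze t_le) ?addr0 // eD.
Qed.

End AlmostIntegral.

Lemma central_in_ideal (I : R -> Prop) : right_ideal I -> (exists2 x, I x & x != 0) ->
  exists z, [/\ I z, z != 0 & central (inv_val z)].
Proof.
case=> _ _ IM [x Ix x0].
have x0' : inv_val x != 0 by rewrite -[0]/(inv_val (0 : R)) (inj_eq (@inv_val_inj _ _ _ al)).
have [y [yI xy0 xyC]] := invariant_central_multiple x0' (inv_valP x).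
exists (x * InvariantRing yI); split=> //; exact: IM.
Qed.

Lemma dihedral_multipliers : inner_multipliers R.
Proof.
move=> I phi LI RI I_neq0 phiI phiD phiM.
have IMl a x : I x -> I (a * x) by case: LI => _ _; apply.
have [z [Iz z0 zC]] := central_in_ideal RI I_neq0.
have zR a : z * a = a * z by apply: (@inv_val_inj _ _ _ al); exact: zC.
have zXR m a : z ^+ m * a = a * z ^+ m.
  by elim: m => [|m IH]; rewrite ?mul1r ?mulr1 // exprS -mulrA IH mulrA zR -mulrA.
(* The fraction [a / z] maps [I] into itself; hence so do all powers of [(a r) / z]. *)
pose P (a : R) := forall x, I x -> exists2 y, I y & a * x = z * y.
have PB a t : P a -> P (a - z * t).
  move=> Pa x Ix; have [y Iy yE] := Pa x Ix; exists (y - t * x).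
    by apply: left_idealB => //; exact: IMl.
  by rewrite mulrBl yE mulrBr mulrA.
have Ppow a r m x : P a -> I x -> exists2 y, I y & (a * r) ^+ m * x = z ^+ m * y.
  move=> Pa; elim: m x => [|m IH] x Ix; first by exists x; rewrite ?mul1r.
  have [y Iy yE] := IH x Ix; have [y' Iy' y'E] := Pa _ (IMl r _ Iy).
  by exists y' => //; rewrite exprS -mulrA yE mulrA -zXR -!mulrA y'E mulrA -exprSr.
have PX a r m : P a -> exists y, z * (a * r) ^+ m.+1 = z ^+ m * y.
  move=> Pa; have [y Iy yE] := Ppow a r m.+1 z Pa Iz.
  by exists (z * y); rewrite zR yE exprSr mulrA.
have Pphi : P (phi z).
  by move=> x Ix; exists (phi x); [exact: phiI|rewrite -phiM // (zR x) phiM // (zR (phi x))].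
have [t tE] := almost_integral_multiple z0 zC PB PX Pphi.
exists t => x Ix; apply/eqP; rewrite -subr_eq0; apply: contraT => d0.
have := invariant_domain (plane_domain q0 coord) z0 d0.
by rewrite mulrBr mulrA -tE -phiM // (zR x) phiM // (zR (phi x)) subrr eqxx.
Qed.

Lemma dihedral_multipliers_converse : inner_multipliers R^c.
Proof.
move=> I phi RI LI I_neq0 phiI phiD phiM'.
have phiM (x r : R) : I x -> phi (r * x) = r * (phi x : R) by exact: phiM'.
have IMr (a x : R) : I x -> I (x * a) by case: RI => _ _; apply.
have [z [Iz z0 zC]] := central_in_ideal RI I_neq0.
have zR (a : R) : z * a = a * z by apply: (@inv_val_inj _ _ _ al); exact: zC.
have zXR m (a : R) : z ^+ m * a = a * z ^+ m.
  by elim: m => [|m IH]; rewrite ?mul1r ?mulr1 // exprS -mulrA IH mulrA zR -mulrA.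
(* Now [a / z] acts on [I] from the right. *)
pose P (a : R) := forall x : R, I x -> exists2 y : R, I y & x * a = z * y.
have PB (a t : R) : P a -> P (a - z * t).
  move=> Pa x Ix; have [y Iy yE] := Pa x Ix; exists (y - x * t).
    exact: (@left_idealB R^c I y (x * t) RI Iy (IMr t x Ix)).
  by rewrite mulrBr yE mulrBr !mulrA (zR x).
have Ppow (a r : R) m (x : R) : P a -> I x -> exists2 y : R, I y & x * (r * a) ^+ m = z ^+ m * y.
  move=> Pa; elim: m x => [|m IH] x Ix; first by exists x; rewrite ?mul1r ?mulr1.
  have [y Iy yE] := Pa _ (IMr r _ Ix); have [y' Iy' y'E] := IH _ Iy.
  by exists y' => //; rewrite exprS !mulrA yE -mulrA y'E mulrA exprS.
have PX (a r : R) m : P a -> exists y : R, z * (a * r) ^+ m.+1 = z ^+ m * y.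
  move=> Pa; have [y Iy yE] := Ppow a r m z Pa Iz; exists (a * y * r).
  (* Acting from the right produces powers of [r a]; regrouping costs one factor [a] and one factor
     [r]. *)
  have -> : (a * r) ^+ m.+1 = a * (r * a) ^+ m * r.
    elim: (m) => [|i IH]; first by rewrite expr1 mulr1.
    by rewrite exprS IH exprS !mulrA.
  by rewrite !mulrA (zR a) -(mulrA a z) yE (zXR m a) !mulrA.
have Pphi : P (phi z).
  by move=> x Ix; exists (phi x); [exact: phiI|rewrite -phiM // -zR phiM].
have [t tE] := almost_integral_multiple z0 zC PB PX Pphi.
exists t => x Ix; change (phi x = (x : R) * t); apply/eqP; rewrite -subr_eq0.
apply: contraT => d0; have := invariant_domain (plane_domain q0 coord) z0 d0.
have zE : z * (phi x : R) = z * ((x : R) * t).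
  by rewrite mulrA (zR x) -mulrA -tE -(phiM z x Iz) -(zR x) (phiM x z Ix).
by rewrite mulrBr zE subrr eqxx.
Qed.

Lemma v_neq0 : v != 0.
Proof.
have u0 : u != 0 by exact: u_neq0 coord.
by apply: contraNneq u0 => v0; rewrite -hv v0 linear0.
Qed.

Lemma even_power_central m : ~~ odd m -> central (u ^+ m) /\ central (v ^+ m).
Proof.
move=> em; have uC : central (u ^+ m).
  have um i : coord i (u ^+ m) = if i == m then 1 else 0.
    rewrite -[u ^+ m]mulr1; have [im|mi] := ltnP i m.
      by rewrite coord_unM_small // ltn_eqF.
    rewrite -(subnK mi); move: (i - m)%N => j.
    by rewrite coord_unM coord1 -{2}[m]add0n eqn_add2r; case: j.
  apply: (even_central (coord := coord)) => i; rewrite um.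
    by case: eqP => // ->; rewrite (negbTE em).
  by case: eqP; rewrite ?rmorph1 ?linear0.
split=> // a; have [x ->] : exists x, a = al h x by exists (al h^-1%g a); rewrite al_invr.
by rewrite -hu -rmorphXn -!rmorphM /= uC.
Qed.

Lemma u_expv m : u ^+ m * v = (-1) ^+ m *: (v * u ^+ m).
Proof.
elim: m => [|m IH]; first by rewrite !expr0 scale1r mul1r mulr1.
have uv : u * v = - (v * u) by rewrite (skew_vu coord) opprK.
rewrite [in LHS]exprS -mulrA IH -scalerAr (mulrA u v) uv mulNr scalerN -mulrA -exprS.
by rewrite [in RHS](exprS (-1)) mulN1r scaleNr.
Qed.

Lemma v_expu m : v ^+ m * u = (-1) ^+ m *: (u * v ^+ m).
Proof.
elim: m => [|m IH]; first by rewrite !expr0 scale1r mul1r mulr1.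
rewrite [in LHS]exprS -mulrA IH -scalerAr (mulrA v u) (skew_vu coord) mulNr scalerN.
by rewrite -mulrA -exprS [in RHS](exprS (-1)) mulN1r scaleNr.
Qed.

(** * The ideal generated by the mean of the dihedral group *)

Local Notation T := (skew_ring al).
Local Notation e := (corner (1 : R)).
Local Notation eC := (cyclic_mean al g).
Local Notation const := (skew_const al).

Lemma skew_constM a b : const a * const b = const (a * b).
Proof. by rewrite /skew_const skew_singleM alg_act1 mulg1. Qed.

Lemma skew_constD a b : const (a + b) = const a + const b.
Proof. by apply/ffunP => z; rewrite !ffunE; case: eqP; rewrite ?addr0. Qed.

Lemma skew_addE (f f' : T) z : (f + f') z = f z + f' z. Proof. by rewrite ffunE. Qed.

Lemma skew_oppE (f : T) z : (- f) z = - f z. Proof. by rewrite ffunE. Qed.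

(** Since [e = eC (1 + h) / 2] and [h b] commutes with [eC], the elements [2 e b] and [2 (h b) e]
    share the part [(h b) eC h]; the difference of what remains is [eC (b - h b)]. *)
Lemma trace_mean b : al g b = b -> al g (al h b) = al h b ->
  ideal_gen e (eC * const (b - al h b)).
Proof.
move=> gb ghb; have fixg y i : al g y = y -> al (g ^+ i)%g y = y.
  by move=> gy; rewrite (al_expg_scale (w := 1)) ?scale1r // expr1n scale1r.
have -> : eC * const (b - al h b) =
    e * const (2%:R *: b) + - (const (2%:R *: al h b) * e).
  apply/ffunP => z; rewrite skew_constMr skew_addE skew_oppE skew_constMr skew_constMl.
  rewrite !ffunE /= cardG.
  have cE : (n.*2%:R^-1 * 2%:R : k) = n%:R^-1.
    by rewrite -muln2 natrM invfM mulfVK.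
  have [zC|zC] := boolP (z \in <[g]>%g).
    have /cycleP[i ->] := zC; rewrite linearB linearZ /= !fixg // gn.
    rewrite -!scalerAl -!scalerAr !mul1r !mulr1 !scalerA.
    by rewrite [2%:R / _]mulrC cE scalerBr.
  have [i [zE|zE]] := dihedral_cases z.
    by rewrite zE mem_cycle in zC.
  rewrite mul0r zE alg_actM !linearZ /= fixg //.
  rewrite -!scalerAl -!scalerAr !mul1r !mulr1 !scalerA.
  by rewrite mulrC subrr.
apply: ideal_genD; first by apply: ideal_genMr; exists [:: (1, 1)]; rewrite big_seq1 mul1r mulr1.
by apply: ideal_genN; apply: ideal_genMl; exists [:: (1, 1)]; rewrite big_seq1 mul1r mulr1.
Qed.

(** In [cyclic_isolate] the central [d] can be moved next to each occurrence of [eC]. *)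
Lemma trace_power x a d : (forall i, (a ^+ i == 1) = (#[g]%g %| i)%N) ->
  al g x = a *: x -> central d -> ideal_gen e (eC * const d) ->
  ideal_gen e (const (x ^+ n.-1 * d)).
Proof.
move=> aN gx dC Ld; rewrite -skew_constM -gn (cyclic_isolate k0 aN gx) mulr_suml.
elim/big_ind: _ => [||j _]; [exact: ideal_gen0|exact: ideal_genD|].
rewrite -!mulrA skew_constM -dC -skew_constM (mulrA eC).
by apply: ideal_genMl; apply: ideal_genMr.
Qed.

Lemma trace_uv : ideal_gen e (eC * const (u * v)).
Proof.
have w0 := root_neq0 wn.
have guv : al g (u * v) = u * v.
  by rewrite rmorphM /= gu gv -scalerAl -scalerAr scalerA mulfV // scale1r.
have huv : al h (u * v) = - (u * v) by rewrite rmorphM /= hu hv (skew_vu coord).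
(* As [h] negates [u v], half of it satisfies [b - h b = u v]. *)
pose b := 2%:R^-1 *: (u * v).
have gb : al g b = b by rewrite linearZ /= guv.
have hb : al h b = - b by rewrite linearZ /= huv scalerN.
have := trace_mean gb; rewrite hb raddfN /= gb opprK.
by rewrite -mulr2n -scaler_nat scalerA mulfV // scale1r; apply.
Qed.

Lemma trace_u2v2 : ideal_gen e (eC * const (u ^+ 2 * v ^+ 2)).
Proof.
have -> : u ^+ 2 * v ^+ 2 = u * v * - (u * v).
  rewrite mulrN -(mulrA u v) (mulrA v u) (skew_vu coord) mulNr mulrN opprK.
  by rewrite !expr2 !mulrA.
by rewrite -skew_constM mulrA; apply: ideal_genMr; exact: trace_uv.
Qed.

Lemma trace_diff : ideal_gen e (eC * const (u ^+ (n + n) - v ^+ (n + n))).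
Proof.
have [m nE] : exists m, n = m.+1 by exists n.-1; rewrite prednK.
(* The mixed products [u^n v^n] and [v^n u^n] are multiples of [u v], settled by [trace_uv]; the
   factor [u^n - v^n] has the form [b - h b]. *)
have [x xE] : exists x, u ^+ n * v ^+ n = u * v * x.
  exists ((-1) ^+ m *: (u ^+ m * v ^+ m)).
  by rewrite nE exprS (exprS v) mulrA -(mulrA u) u_expv -!scalerAr -scalerAl !mulrA.
have [y yE] : exists y, v ^+ n * u ^+ n = u * v * y.
  exists (- ((-1) ^+ m *: (v ^+ m * u ^+ m))).
  rewrite nE exprS (exprS u) mulrA -(mulrA v) v_expu -!scalerAr -scalerAl.
  by rewrite !mulrA (skew_vu coord) !mulNr mulrN -scalerAr scalerN !mulrA.
have -> : u ^+ (n + n) - v ^+ (n + n) =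
    (u ^+ n - v ^+ n) * (u ^+ n + v ^+ n) + u * v * (y - x).
  rewrite mulrBr -xE -yE mulrDr !mulrBl !exprD.
  move: (u ^+ n * u ^+ n) (v ^+ n * v ^+ n) (u ^+ n * v ^+ n) (v ^+ n * u ^+ n) => a b c d.
  by rewrite -addrA [c - b + _]addrC [d - c + _]addrA subrK addrA subrK.
rewrite skew_constD mulrDr -!skew_constM !mulrA.
apply: ideal_genD; apply: ideal_genMr; last by rewrite -mulrA skew_constM; exact: trace_uv.
have hun : al h (u ^+ n) = v ^+ n by rewrite rmorphXn /= hu.
rewrite -hun; apply: trace_mean; rewrite ?hun rmorphXn /= ?gu ?gv exprZn ?exprVn.
  by rewrite (prim_expr_order wn) scale1r.
by rewrite (prim_expr_order wn) invr1 scale1r.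
Qed.

Let uM := u ^+ (n + n).
Let vM := v ^+ (n + n).

Let evenM : ~~ odd (n + n). Proof. by rewrite addnn odd_double. Qed.
Let uMC : central uM. Proof. by have [] := even_power_central evenM. Qed.
Let vMC : central vM. Proof. by have [] := even_power_central evenM. Qed.
Let u2C : central (u ^+ 2). Proof. by have [] := @even_power_central 2 isT. Qed.
Let v2C : central (v ^+ 2). Proof. by have [] := @even_power_central 2 isT. Qed.

Lemma centralM (a b : A) : central a -> central b -> central (a * b).
Proof. by move=> aC bC c; rewrite -mulrA bC mulrA aC mulrA. Qed.

Lemma centralB (a b : A) : central a -> central b -> central (a - b).
Proof. by move=> aC bC c; rewrite mulrBl mulrBr aC bC. Qed.

Lemma root_order_dihedral i : (w ^+ i == 1) = (#[g]%g %| i)%N.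
Proof. by rewrite gn (prim_order_dvd wn). Qed.

Lemma rootV_order_dihedral i : (w^-1 ^+ i == 1) = (#[g]%g %| i)%N.
Proof. by rewrite exprVn invr_eq1 root_order_dihedral. Qed.

Lemma ideal_gen_p : ideal_gen e (const (uM * vM)).
Proof.
have u2v2C := centralM u2C v2C.
have -> : uM * vM = u ^+ n.-1 * (u ^+ 2 * v ^+ 2) * (u ^+ n.-1 * v ^+ (n + n - 2)).
  transitivity (u ^+ (n.-1 + 2 + n.-1) * v ^+ (2 + (n + n - 2))).
    by congr (_ ^+ _ * _ ^+ _); lia.
  have swap (a b c d f : A) : c * d = d * c -> a * b * d * (c * f) = a * (b * c) * (d * f).
    by move=> cd; rewrite !mulrA -(mulrA (a * b) c) cd !mulrA.
  by rewrite !exprD; apply: swap.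
rewrite -skew_constM; apply: ideal_genMr.
exact: (trace_power root_order_dihedral gu u2v2C trace_u2v2).
Qed.

(** For [d = uM - vM], the ideal contains [u^(n-1) d] and [v^(n-1) d], hence [uM d] and [vM d], and
    so [d^2]. *)
Lemma ideal_gen_w : ideal_gen e (const ((uM - vM) * (uM - vM))).
Proof.
have dC := centralB uMC vMC.
have Lu := trace_power root_order_dihedral gu dC trace_diff.
have Lv := trace_power rootV_order_dihedral gv dC trace_diff.
have split x : x ^+ (n + n) = x ^+ n.+1 * x ^+ n.-1 :> A.
  by rewrite -exprD; congr (_ ^+ _); lia.
have -> : (uM - vM) * (uM - vM) =
    u ^+ n.+1 * (u ^+ n.-1 * (uM - vM)) + - v ^+ n.+1 * (v ^+ n.-1 * (uM - vM)).
  by rewrite mulNr (mulrA (u ^+ n.+1)) (mulrA (v ^+ n.+1)) -!split -mulrBl.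
rewrite skew_constD -!(skew_constM (_ ^+ n.+1)) -(skew_constM (- _)).
by apply: ideal_genD; apply: ideal_genMl.
Qed.

(** Modulo [uM] the element [uM - vM] is [- vM], and modulo [vM] it is [uM]; both cases reduce to
    [vn_modl], which also yields divisibility by the product from divisibility by each factor. *)
Lemma dihedral_regular_pair : regular_pair al (uM * vM) ((uM - vM) * (uM - vM)).
Proof.
have dom := plane_domain q0 coord.
have uM0 : uM != 0.
  rewrite /uM; elim: (n + n)%N => [|m IH]; first by rewrite expr0 oner_neq0.
  by rewrite exprS; apply: dom IH; exact: u_neq0 coord.
have vM0 : vM != 0.
  rewrite /vM; elim: (n + n)%N => [|m IH]; first by rewrite expr0 oner_neq0.
  by rewrite exprS; apply: dom IH; exact: v_neq0.
have wM : w ^+ (n + n) = 1 by rewrite exprD (prim_expr_order wn) mulr1.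
have guM : al g uM = uM by rewrite rmorphXn /= gu exprZn wM scale1r.
have gvM : al g vM = vM by rewrite rmorphXn /= gv exprZn exprVn wM invr1 scale1r.
have huM : al h uM = vM by rewrite rmorphXn /= hu.
have hvM : al h vM = uM by rewrite rmorphXn /= hv.
have pC := centralM uMC vMC; have dC := centralB uMC vMC; have wC := centralM dC dC.
have pI : uM * vM \in invariants al.
  by apply: dihedral_invariant; rewrite rmorphM /= ?guM ?gvM // huM hvM vMC.
have wI : (uM - vM) * (uM - vM) \in invariants al.
  apply: dihedral_invariant; rewrite rmorphM rmorphB /= ?guM ?gvM //.
  by rewrite huM hvM -opprB mulrNN.
have du a y : (uM - vM) * a = uM * y -> exists z, a = uM * z.
  move=> E; apply: (vn_modl q0 coord (y := a - y)).
  by rewrite -/uM -/vM mulrBr -E mulrBl opprB addrC subrK.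
have dv a y : (uM - vM) * a = vM * y -> exists z, a = vM * z.
  move=> E; have [z zE] : exists z, y + a = uM * z.
    by apply: (vn_modl q0 coord (y := a)); rewrite -/uM -/vM mulrDr -E mulrBl subrK.
  exists z; apply/eqP; rewrite -subr_eq0; apply: contraT => d0.
  have aE : uM * a = uM * (vM * z).
    by rewrite (mulrA uM) (uMC vM) -mulrA -zE mulrDr -E mulrBl subrK.
  by have := dom _ _ uM0 d0; rewrite mulrBr aE subrr eqxx.
have modl a b : (uM - vM) * (uM - vM) * a = uM * vM * b -> exists c, a = uM * vM * c.
  move=> E; have [y yE] : exists y, a = uM * y.
    have [|y yE] := du ((uM - vM) * a) (vM * b); first by rewrite !mulrA.
    exact: du yE.
  have [x xE] : exists x, a = vM * x.
    have [|x xE] := dv ((uM - vM) * a) (uM * b); first by rewrite mulrA E uMC !mulrA.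
    exact: dv xE.
  have [z zE] : exists z, x = uM * z.
    by apply: (vn_modl q0 coord (y := y)); rewrite -/uM -/vM -xE.
  by exists z; rewrite xE zE (mulrA vM) -uMC.
split=> //.
- exact: dom.
- by move=> x; exists 1; rewrite ?oner_eq0 // scale1r (invariantP _ _ pI).
- by move=> x; exists 1; rewrite ?oner_eq0 // scale1r (invariantP _ _ wI).
- by move=> a; exists a; rewrite pC.
- by move=> a; exists a; rewrite pC.
- move=> a b; rewrite -wC -pC => /modl[c cE].
  by exists c; rewrite cE pC.
Qed.

Lemma dihedral_maximal_orders : maximal_order T /\ maximal_order R.
Proof.
exact: (maximal_orders k0 (plane_domain q0 coord) (plane_left_acc q0 coord)
  (plane_right_acc q0 coord) dihedral_regular_pair ideal_gen_p ideal_gen_w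
  dihedral_multipliers dihedral_multipliers_converse).
Qed.

End DihedralAction.

(** * The quantum Kleinian singularities *)

Lemma qplane_relE (k : comNzRingType) (q : k) :
  qplane_rel q = free_v k * free_u k - q *: (free_u k * free_v k) - 0 *: free_u k ^+ 2.
Proof.
have -> : 0 *: free_u k ^+ 2 = 0 by exact: scale0r.
exact: (esym (subr0 _)).
Qed.

Lemma jplane_relE (k : comNzRingType) :
  jplane_rel k = free_v k * free_u k - 1 *: (free_u k * free_v k) - 1 *: free_u k ^+ 2.
Proof.
by congr (_ - _ - _); apply: (esym (scale1r _)).
Qed.

Section Planes.
Variable k : fieldType.
Local Notation kc := (k : comNzRingType).

Definition qplane_coord (q : k) :
  @plane_coord k q 0 (qplane (q : kc)) (@qu kc q) (@qv kc q).
Proof.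
exact: (presalg_plane_coord _ (qplane_relE (q : kc))).
Defined.

Definition jplane_coord : @plane_coord k 1 1 (jplane kc) (ju kc) (jv kc).
Proof.
exact: (presalg_plane_coord _ (jplane_relE kc)).
Defined.

End Planes.

Theorem theorem1p4 (k : closedFieldType) (k0 : [pchar k] =i pred0)
    (gT : finGroupType) (A : algType k) (al : alg_action gT A) :
  quantum_kleinian al ->
  maximal_order (skew_ring al) /\ maximal_order (invariant_ring al).
Proof.
case=> {gT A al}.
- move=> q w n gT g al q0 n0 wn gn gT_g gu gv.
  exact: (cyclic_maximal_orders q0 (qplane_coord q) wn gn gu gv (or_introl erefl) k0 gT_g).
(* The swap is treated as the dihedral case [n = 1] with trivial rotation. *)
- move=> gT h al h2 gT_h hu hv.
  have w1 : 1.-primitive_root (1 : k).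
    by apply/andP; split=> //; apply/forallP => -[[|i] // ?]; rewrite unity_rootE expr1n !eqxx.
  have h1 : h \notin <[1]>%g.
    by rewrite cycle1 inE; apply: contra_eqN h2 => /eqP ->; rewrite order1.
  have cG : #|gT| = 1.*2 by rewrite -cardsT -gT_h.
  apply: (dihedral_maximal_orders (qplane_coord (-1 : k)) k0 (isT : (0 < 1)%N) w1
    (order1 gT) h1 cG _ _ hu hv).
    by rewrite alg_act1 scale1r.
  by rewrite alg_act1 invr1 scale1r.
- move=> w n gT g h al n0 wn gn1 _ _ gT_gh cG gu gv hu hv.
  (* The relations only say that the order of [g] divides [n]; its action on [u] gives the
     converse. *)
  have gn : #[g]%g = n.
    apply/eqP; rewrite eqn_dvd order_dvdn gn1 eqxx /= (prim_order_dvd wn) -subr_eq0.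
    have u0 := u_neq0 (qplane_coord (-1 : k)).
    have /eqP : (w ^+ #[g]%g - 1) *: qu (-1 : k) = 0.
      by rewrite scalerBl scale1r -(al_expg_scale _ gu) expg_order alg_act1 subrr.
    by rewrite scaler_eq0 (negbTE u0) orbF.
  (* Otherwise [g] alone would generate a group of order [2 n]. *)
  have hg : h \notin <[g]>%g.
    apply/negP => hg; have : (#|[set: gT]| <= #[g]%g)%N.
      by rewrite subset_leq_card // -gT_gh gen_subG subUset !sub1set cycle_id hg.
    by rewrite cardsT cG gn -addnn; lia.
  exact: (dihedral_maximal_orders (qplane_coord (-1 : k)) k0 n0 wn gn hg cG gu gv hu hv).
(* The Jordan plane has [q = b = 1], and [w = -1] is its own inverse. *)
- move=> gT g al g2 gT_g gu gv.
  have w2 : 2.-primitive_root (-1 : k).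
    apply/andP; split=> //; apply/forallP => -[[|[|i]] // ?]; rewrite unity_rootE /=.
      have -> : (-1 == 1 :> k) = false.
        by rewrite eq_sym -subr_eq0 opprK -[1 + 1]/(2%:R) ((pcharf0P k).1 k0).
      by [].
    by rewrite sqrrN expr1n !eqxx.
  apply: (cyclic_maximal_orders (oner_neq0 k) (jplane_coord k) w2 g2 _ _ _ k0 gT_g).
  - by rewrite scaleN1r.
  - by rewrite invrN1 scaleN1r.
  - by right; rewrite invrN1.
Qed.
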